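(* Let $X$ be a complex manifold and let $H=H^{3,0}+H^{2,1}+H^{1,2}+H^{0,3}\in\Omega^3_{\mathbb C}(X)$, with $H^{i,j}\in\Omega^{i,j}(X)$, be a closed 3-form. Let $(C^{1,0}_X)_{H^{3,0}}$ be the complex Courant algebroid structure on $C^{1,0}_X=T^{1,0}_X\oplus(T^{1,0}_X)^*$ twisted by $H^{3,0}$, and $(C^{0,1}_X)_{H^{0,3}}$ the complex Courant algebroid structure on $C^{0,1}_X=T^{0,1}_X\oplus(T^{0,1}_X)^*$ twisted by $H^{0,3}$. Then $(C^{1,0}_X)_{H^{3,0}}$ and $(C^{0,1}_X)_{H^{0,3}}$ form a matched pair of (complex) Courant algebroids, with connections given by $$\overrightarrow\nabla_{X\oplus\alpha}(Y\oplus\beta)=\nabla^o_XY\oplus\big(\nabla^o_X\beta+H^{1,2}(X,Y,\cdot)\big),\qquad \overleftarrow\nabla_{Y\oplus\beta}(X\oplus\alpha)=\nabla^o_YX\oplus\big(\nabla^o_Y\alpha+H^{2,1}(Y,X,\cdot)\big)$$ for all $X\in\mathfrak X^{1,0}$, $\alpha\in\Omega^{1,0}$, $Y\in\mathfrak X^{0,1}$, $\beta\in\Omega^{0,1}$. The resulting matched sum Courant algebroid is isomorphic to the standard complex Courant algebroid $(T_X\oplus T_X^* )\otimes\mathbb C$ twisted by $H$.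
   Context: Notation: $T_X\otimes\mathbb C=T_X^{1,0}\oplus T_X^{0,1}$; $\mathfrak X^{1,0},\mathfrak X^{0,1}$ are the smooth sections of the summands and $\Omega^{i,j}$ the smooth $(i,j)$-forms. $\mathrm{pr}^{1,0},\mathrm{pr}^{0,1}$ are the projections (on vectors and on 1-forms). For $X\in\mathfrak X^{1,0}$, $Y\in\mathfrak X^{0,1}$, $\alpha\in\Omega^{1,0}$, $\beta\in\Omega^{0,1}$: $\nabla^o_XY=\mathrm{pr}^{0,1}[X,Y]$, $\nabla^o_YX=\mathrm{pr}^{1,0}[Y,X]$, $\nabla^o_X\beta=\mathrm{pr}^{0,1}(\mathcal L_X\beta)$, $\nabla^o_Y\alpha=\mathrm{pr}^{1,0}(\mathcal L_Y\alpha)$. A complex Courant algebroid is a complex vector bundle $E\to M$ over a smooth manifold with a fibrewise symmetric nondegenerate $\mathbb C$-bilinear form $\langle\cdot,\cdot\rangle$, a $\mathbb C$-bilinear operation $\diamond$ on $\Gamma(E)$ and an anchor $\rho:E\to TM\otimes\mathbb C$ such that for all $\phi,\psi,\psi_1,\psi_2\in\Gamma(E)$, $f\in C^\infty(M;\mathbb C)$: $\phi\diamond(\psi_1\diamond\psi_2)=(\phi\diamond\psi_1)\diamond\psi_2+\psi_1\diamond(\phi\diamond\psi_2)$; $\phi\diamond(f\psi)=\rho(\phi)[f]\psi+f(\phi\diamond\psi)$; $\phi\diamond\phi=\frac12\mathcal D\langle\phi,\phi\rangle$; $\rho(\phi)\langle\psi,\psi\rangle=2\langle\phi\diamond\psi,\psi\rangle$,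 where $\mathcal D=\rho^*\circ d$, i.e. $\langle\mathcal Df,\phi\rangle=\rho(\phi)[f]$. Twisted structures: let $A$ be one of the complex Lie algebroids $T_X\otimes\mathbb C,\ T^{1,0}_X,\ T^{0,1}_X$ with differential $d_A=d,\ \partial,\ \bar\partial$, respectively, and $h\in\Gamma(\Lambda^3A^* )$ with $d_Ah=0$. The Courant algebroid $A\oplus A^*$ twisted by $h$ has inner product $\langle X\oplus\alpha,Y\oplus\beta\rangle=\alpha(Y)+\beta(X)$, anchor $X\oplus\alpha\mapsto X\in A\subset T_X\otimes\mathbb C$, and bracket $(X\oplus\alpha)\diamond(Y\oplus\beta)=[X,Y]\oplus(\mathcal L^A_X\beta-\iota_Yd_A\alpha+h(X,Y,\cdot))$ with $\mathcal L^A_X=\iota_Xd_A+d_A\iota_X$. Matched pairs. For an anchored bundle $(E,\rho)$ an $E$-connection on $V$ is a bilinear $\nabla:\Gamma(E)\otimes\Gamma(V)\to\Gamma(V)$ with $\nabla_{f\psi}v=f\nabla_\psi v$, $\nabla_\psi(fv)=(\rho(\psi)[f])v+f\nabla_\psi v$. Two Courant algebroids $E_1,E_2$ over the same base with an $E_1$-connection $\overrightarrow\nabla$ on $E_2$ and an $E_2$-connection $\overleftarrow\nabla$ on $E_1$ form a matched pair if the connections preserve the fibre metrics, satisfy $\overrightarrow\nabla_{\mathcal D_1f}\beta=0$, $\overleftarrow\nabla_{\mathcal D_2f}b=0$ for all functions $f$ and sections $b$ of $E_1$, $\beta$ of $E_2$, and satisfy, for all sections $a,a_i$ of $E_1$ and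 $\alpha,\alpha_i$ of $E_2$: (1) $\overleftarrow\nabla_\alpha(a_1\diamond_1a_2)-(\overleftarrow\nabla_\alpha a_1)\diamond_1a_2-a_1\diamond_1(\overleftarrow\nabla_\alpha a_2)-\overleftarrow\nabla_{\overrightarrow\nabla_{a_2}\alpha}a_1+\overleftarrow\nabla_{\overrightarrow\nabla_{a_1}\alpha}a_2=-\mho(\alpha,\omega_{12})-\frac12\mathcal D_1\langle\alpha,\omega_{12}\rangle_2$ with $\omega_{12}=\Omega(a_1,a_2)+\frac12\mathcal D_2\langle a_1,a_2\rangle_1$; (2) the same with the roles of $(E_1,\overrightarrow\nabla,\Omega)$ and $(E_2,\overleftarrow\nabla,\mho)$ exchanged; (3) $\langle\overrightarrow R(a_1,a_2)\alpha_1,\alpha_2\rangle_2+\langle\overleftarrow R(\alpha_1,\alpha_2)a_1,a_2\rangle_1=0$, where $\overrightarrow R(a,b)=[\overrightarrow\nabla_a,\overrightarrow\nabla_b]-\overrightarrow\nabla_{a\diamond_1b}$, $\overleftarrow R(\alpha,\beta)=[\overleftarrow\nabla_\alpha,\overleftarrow\nabla_\beta]-\overleftarrow\nabla_{\alpha\diamond_2\beta}$; (4) $\overleftarrow\nabla_{\Omega(a_1,a_2)}a_3+$ cyclic permutations $=0$; (5) $\overrightarrow\nabla_{\mho(\alpha_1,\alpha_2)}\alpha_3+$ cyclic permutations $=0$. Here $\Omega,\mho$ are the skew maps with $\langle\gamma,\Omega(a,b)\rangle_2=\frac12(\langle\overleftarrow\nabla_\gamma a,b\rangle_1-\langle a,\overleftarrow\nabla_\gamma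 b\rangle_1)$ and $\langle c,\mho(\alpha,\beta)\rangle_1=\frac12(\langle\overrightarrow\nabla_c\alpha,\beta\rangle_2-\langle\alpha,\overrightarrow\nabla_c\beta\rangle_2)$. The matched sum Courant algebroid is $E_1\oplus E_2$ with the direct sum metric, anchor $\rho_1+\rho_2$, and bracket $(a\oplus\alpha)\diamond(b\oplus\beta)=(a\diamond_1b+\overleftarrow\nabla_\alpha b-\overleftarrow\nabla_\beta a+\mho(\alpha,\beta)+\frac12\mathcal D_1\langle\alpha,\beta\rangle_2)\oplus(\alpha\diamond_2\beta+\overrightarrow\nabla_a\beta-\overrightarrow\nabla_b\alpha+\Omega(a,b)+\frac12\mathcal D_2\langle a,b\rangle_1)$. In the claim $E_1=(C_X^{1,0})_{H^{3,0}}$ and $E_2=(C_X^{0,1})_{H^{0,3}}$. *)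

(* Defs.v *)
From HB Require Import structures.
From mathcomp Require Import all_boot all_order all_algebra.
From mathcomp Require Import complex.
From mathcomp Require Import all_classical all_reals all_analysis.
Import Order.TTheory GRing.Theory Num.Theory.
Import numFieldNormedType.Exports.

Set Implicit Arguments.
Unset Strict Implicit.
Unset Printing Implicit Defensive.

Local Open Scope classical_set_scope.
Local Open Scope ring_scope.
Local Open Scope complex_scope.

Definition pder (R : realType) (m : nat) (k : 'I_m) (g : 'rV[R]_m -> R) :
  'rV[R]_m -> R := 'D_(delta_mx 0 k) g.

(* Infinitely differentiable at x: all iterated partial derivatives are
   differentiable at x.  A function is C^oo on an open set W iff this holds at
   every point of W. *)
Definition inf_diff (R : realType) (m : nat) (g : 'rV[R]_m -> R)
  (x : 'rV[R]_m) : Prop :=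
  forall s : seq 'I_m, differentiable (foldr (@pder R m) g s) x.

Definition cinf_diff (R : realType) (m : nat) (g : 'rV[R]_m -> R[i])
  (x : 'rV[R]_m) : Prop :=
  inf_diff (fun y => complex.Re (g y)) x /\
  inf_diff (fun y => complex.Im (g y)) x.

Definition cpder (R : realType) (m : nat) (k : 'I_m) (g : 'rV[R]_m -> R[i])
  (x : 'rV[R]_m) : R[i] :=
  pder k (fun y => complex.Re (g y)) x +i* pder k (fun y => complex.Im (g y)) x.

(* A chart is given by its domain, its coordinate map and the inverse [mf_pt]
   of the latter (meaningful on the image of the domain only). *)
Record manifold (R : realType) (m : nat) := Manifold {
  mf_space :> topologicalType;
  mf_hausdorff : hausdorff_space mf_space;
  mf_second_countable : @second_countable mf_space;
  mf_chart : Type;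
  mf_dom : mf_chart -> set mf_space;
  mf_crd : mf_chart -> mf_space -> 'rV[R]_m;
  mf_pt : mf_chart -> 'rV[R]_m -> mf_space;
  mf_cover : forall p : mf_space, exists i, mf_dom i p;
  mf_dom_open : forall i, open (mf_dom i);
  mf_img_open : forall i, open (mf_crd i @` mf_dom i);
  mf_ptK : forall i p, mf_dom i p -> mf_pt i (mf_crd i p) = p;
  mf_crd_continuous : forall i p, mf_dom i p -> {for p, continuous (mf_crd i)};
  mf_pt_continuous : forall i p, mf_dom i p ->
    {for mf_crd i p, continuous (mf_pt i)};
  mf_transition : forall i j p, mf_dom i p -> mf_dom j p -> forall l : 'I_m,
    inf_diff (fun x => mf_crd j (mf_pt i x) 0 l) (mf_crd i p)
}.

(* A chosen chart around each point, used to coordinatize the tangent spaces. *)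
Definition chart_at (R : realType) (m : nat) (M : manifold R m) (p : M) :
  mf_chart M := projT1 (cid (mf_cover p)).

Definition smooth_at (R : realType) (m : nat) (M : manifold R m) (p : M)
  (f : M -> R[i]) : Prop :=
  forall i, mf_dom i p ->
    \forall x \near mf_crd i p, cinf_diff (fun y => f (mf_pt i y)) x.

Definition smooth (R : realType) (m : nat) (M : manifold R m)
  (f : M -> R[i]) : Prop := forall p, smooth_at p f.

(* Jacobian matrix at p of the change of coordinates from chart i to chart j,
   acting on row vectors from the right. *)
Definition jac (R : realType) (m : nat) (M : manifold R m) (i j : mf_chart M)
  (p : M) : 'M[R]_m :=
  \matrix_(k, l) pder k (fun x => mf_crd j (mf_pt i x) 0 l) (mf_crd i p).

(* The fibre of TM (x) C at p is C^m, the row vector v standing for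
   \sum_k v_k d/dx_k in the coordinates of [chart_at p].  In any other chart i
   around p its components are given by [tcoord i p v]; conversely
   [tconst i q v] is the tangent vector at q with components v in chart i. *)
Definition tcoord (R : realType) (m : nat) (M : manifold R m) (i : mf_chart M)
  (p : M) (v : 'rV[R[i]]_m) : 'rV[R[i]]_m :=
  v *m map_mx (real_complex R) (jac (chart_at p) i p).

Definition tconst (R : realType) (m : nat) (M : manifold R m) (i : mf_chart M)
  (q : M) (v : 'rV[R[i]]_m) : 'rV[R[i]]_m :=
  v *m map_mx (real_complex R) (jac i (chart_at q) q).

Definition der (R : realType) (m : nat) (M : manifold R m) (p : M)
  (v : 'rV[R[i]]_m) (f : M -> R[i]) : R[i] :=
  \sum_(k < m) v 0 k *
    cpder k (fun y => f (mf_pt (chart_at p) y)) (mf_crd (chart_at p) p).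

Definition vec_smooth_at (R : realType) (m : nat) (M : manifold R m) (p : M)
  (X : M -> 'rV[R[i]]_m) : Prop :=
  forall i, mf_dom i p -> forall l, smooth_at p (fun q => tcoord i q (X q) 0 l).

(* [X, Y] at p, by the usual formula in the coordinates of [chart_at p] *)
Definition lie (R : realType) (m : nat) (M : manifold R m)
  (X Y : M -> 'rV[R[i]]_m) (p : M) : 'rV[R[i]]_m :=
  \row_l (der p (X p) (fun q => tcoord (chart_at p) q (Y q) 0 l) -
          der p (Y p) (fun q => tcoord (chart_at p) q (X q) 0 l)).

(* The cotangent space at p consists of the linear functionals on C^m. *)
Definition form1_smooth_at (R : realType) (m : nat) (M : manifold R m) (p : M)
  (a : M -> 'rV[R[i]]_m -> R[i]) : Prop :=
  forall i, mf_dom i p -> forall u, smooth_at p (fun q => a q (tconst i q u)).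

(* Exterior derivatives of 1-forms and 3-forms at p, evaluated on tangent
   vectors extended with constant coefficients in the chart [chart_at p]; no
   normalization factor, so (da)(X,Y) = X[a(Y)] - Y[a(X)] - a([X,Y]). *)
Definition d1 (R : realType) (m : nat) (M : manifold R m)
  (a : M -> 'rV[R[i]]_m -> R[i]) (p : M) (u v : 'rV[R[i]]_m) : R[i] :=
  let e := tconst (chart_at p) in
  der p u (fun q => a q (e q v)) - der p v (fun q => a q (e q u)).

Definition form3 (R : realType) (m : nat) (M : manifold R m) : Type :=
  M -> 'rV[R[i]]_m -> 'rV[R[i]]_m -> 'rV[R[i]]_m -> R[i].

Definition d3 (R : realType) (m : nat) (M : manifold R m) (h : form3 M) (p : M)
  (u v w x : 'rV[R[i]]_m) : R[i] :=
  let e := tconst (chart_at p) in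
  der p u (fun q => h q (e q v) (e q w) (e q x)) -
  der p v (fun q => h q (e q u) (e q w) (e q x)) +
  der p w (fun q => h q (e q u) (e q v) (e q x)) -
  der p x (fun q => h q (e q u) (e q v) (e q w)).

Record is_form3 (R : realType) (m : nat) (M : manifold R m) (h : form3 M) :
  Prop := IsForm3 {
  form3_linear1 : forall p v w, linear (fun u => h p u v w : R[i]^o);
  form3_linear2 : forall p u w, linear (fun v => h p u v w : R[i]^o);
  form3_linear3 : forall p u v, linear (fun w => h p u v w : R[i]^o);
  form3_alt12 : forall p u w, h p u u w = 0;
  form3_alt23 : forall p u v, h p u v v = 0;
  form3_smooth : forall p i, mf_dom i p -> forall u v w,
    smooth_at p (fun q => h q (tconst i q u) (tconst i q v) (tconst i q w))
}.

(* The matrix (acting on row vectors) of the standard complex structure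
   d/dx_k |-> d/dy_k, d/dy_k |-> - d/dx_k in the real coordinates
   (x_1, ..., x_n, y_1, ..., y_n) of C^n. *)
Definition Jmx (S : pzRingType) (n : nat) : 'M[S]_(n + n) :=
  block_mx 0 1%:M (- 1%:M) 0.

(* The condition says that the coordinate changes satisfy the Cauchy-Riemann
   equations. *)
Record complex_manifold (R : realType) (n : nat) := ComplexManifold {
  cm_manifold :> manifold R (n + n);
  cm_holomorphic : forall (i j : mf_chart cm_manifold) (p : cm_manifold),
    mf_dom i p -> mf_dom j p -> Jmx R n *m jac i j p = jac i j p *m Jmx R n
}.

Inductive algebroid := Full | Holo | Anti.

Definition afib (R : realType) (n : nat) (A : algebroid) :
  set 'rV[R[i]]_(n + n) :=
  match A with
  | Full => setT
  | Holo => [set v | v *m Jmx R[i] n = 'i *: v]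
  | Anti => [set v | v *m Jmx R[i] n = - 'i *: v]
  end.

(* The projection of T_X (x) C onto A: the identity, pr^{1,0} or pr^{0,1}. *)
Definition apr (R : realType) (n : nat) (A : algebroid)
  (v : 'rV[R[i]]_(n + n)) : 'rV[R[i]]_(n + n) :=
  match A with
  | Full => v
  | Holo => 2^-1 *: (v - 'i *: (v *m Jmx R[i] n))
  | Anti => 2^-1 *: (v + 'i *: (v *m Jmx R[i] n))
  end.

(* h is of type (a, 3 - a) *)
Definition is_form_type (R : realType) (n : nat) (X : complex_manifold R n)
  (a : nat) (h : form3 X) : Prop :=
  let T (b : bool) := @afib R n (if b then Holo else Anti) in
  forall p (b1 b2 b3 : bool) u v w, T b1 u -> T b2 v -> T b3 w ->
    (b1 + b2 + b3 <> a)%N -> h p u v w = 0.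

(* d_A on functions and on sections of A^*.  Sections of A^* are the 1-forms
   that factor through the projection onto A, and d_A is d followed by the
   projection; so d_A = d, \partial, \bar\partial respectively. *)
Definition dA0 (R : realType) (n : nat) (X : complex_manifold R n)
  (A : algebroid) (f : X -> R[i]) (p : X) (u : 'rV[R[i]]_(n + n)) : R[i] :=
  der p (apr A u) f.

Definition dA1 (R : realType) (n : nat) (X : complex_manifold R n)
  (A : algebroid) (a : X -> 'rV[R[i]]_(n + n) -> R[i]) (p : X)
  (u v : 'rV[R[i]]_(n + n)) : R[i] := d1 a p (apr A u) (apr A v).

Definition lieA (R : realType) (n : nat) (X : complex_manifold R n)
  (A : algebroid) (Y : X -> 'rV[R[i]]_(n + n))
  (b : X -> 'rV[R[i]]_(n + n) -> R[i]) (p : X) (u : 'rV[R[i]]_(n + n)) : R[i] :=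
  dA1 A b p (Y p) u + dA0 A (fun q => b q (Y q)) p u.

(* The fibre at p is the subspace [vb_fib p] of [vb_amb];
   [vb_smooth p s] says that s is a smooth section in a neighbourhood of p. *)
Record vbundle (R : realType) (m : nat) (M : manifold R m) := VBundle {
  vb_amb : lmodType R[i];
  vb_fib : M -> set vb_amb;
  vb_smooth : M -> (M -> vb_amb) -> Prop
}.

(* Existence of local frames; the first clause for the fibre over q includes
   that it is a linear subspace. *)
Definition is_vbundle (R : realType) (m : nat) (M : manifold R m)
  (E : vbundle M) : Prop :=
  forall p : M, exists (r : nat) (e : 'I_r -> M -> vb_amb E),
    \forall q \near p,
    [/\ forall v, vb_fib q v <->
          exists c : 'rV[R[i]]_r, v = \sum_(k < r) c 0 k *: e k q,
        forall c : 'rV[R[i]]_r, \sum_(k < r) c 0 k *: e k q = 0 -> c = 0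
      & forall s, vb_smooth q s <->
          exists c : M -> 'rV[R[i]]_r,
            (forall k, smooth_at q (fun q' => c q' 0 k)) /\
            \forall q' \near q, s q' = \sum_(k < r) c q' 0 k *: e k q'].

Definition sections (R : realType) (m : nat) (M : manifold R m)
  (E : vbundle M) : set (M -> vb_amb E) :=
  [set s | forall p, vb_fib p (s p) /\ vb_smooth p s].

Arguments sections {R m M} E _.

Definition vb_sum (R : realType) (m : nat) (M : manifold R m)
  (E F : vbundle M) : vbundle M :=
  @VBundle R m M (vb_amb E * vb_amb F)%type
    (fun p => [set v | vb_fib p v.1 /\ vb_fib p v.2])
    (fun p s => vb_smooth p (fun q => (s q).1) /\
                vb_smooth p (fun q => (s q).2)).

Record courant (R : realType) (m : nat) (M : manifold R m) := Courant {
  ca_bundle :> vbundle M;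
  ca_ip : M -> vb_amb ca_bundle -> vb_amb ca_bundle -> R[i];
  ca_anchor : M -> vb_amb ca_bundle -> 'rV[R[i]]_m;
  ca_br : (M -> vb_amb ca_bundle) -> (M -> vb_amb ca_bundle) ->
          (M -> vb_amb ca_bundle)
}.

Definition ipf (R : realType) (m : nat) (M : manifold R m) (E : courant M)
  (s t : M -> vb_amb E) : M -> R[i] := fun p => ca_ip p (s p) (t p).

(* rho(s)[f] *)
Definition anch (R : realType) (m : nat) (M : manifold R m) (E : courant M)
  (s : M -> vb_amb E) (f : M -> R[i]) : M -> R[i] :=
  fun p => der p (ca_anchor p (s p)) f.

(* D f at p is the element of the fibre with <D f, v> = rho(v)[f] for all v in
   the fibre; it is unique when the metric is nondegenerate. *)
Definition cD (R : realType) (m : nat) (M : manifold R m) (E : courant M)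
  (f : M -> R[i]) : M -> vb_amb E :=
  fun p => xget 0 [set e | vb_fib p e /\
    forall v, vb_fib p v -> ca_ip p e v = der p (ca_anchor p v) f].

Record is_courant (R : realType) (m : nat) (M : manifold R m)
  (E : courant M) : Prop := IsCourant {
  cou_bundle : is_vbundle E;
  cou_ip_linear : forall p (a : R[i]) (u v w : vb_amb E),
    vb_fib p u -> vb_fib p v -> vb_fib p w ->
    ca_ip p (a *: u + v) w = a * ca_ip p u w + ca_ip p v w;
  cou_ip_sym : forall p (u v : vb_amb E),
    vb_fib p u -> vb_fib p v -> ca_ip p u v = ca_ip p v u;
  cou_ip_nondeg : forall p (u : vb_amb E), vb_fib p u ->
    (forall v, vb_fib p v -> ca_ip p u v = 0) -> u = 0;
  cou_ip_smooth : forall p (s t : M -> vb_amb E),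
    vb_smooth p s -> vb_smooth p t -> smooth_at p (ipf s t);
  cou_anchor_linear : forall p (a : R[i]) (u v : vb_amb E),
    vb_fib p u -> vb_fib p v ->
    ca_anchor p (a *: u + v) = a *: ca_anchor p u + ca_anchor p v;
  cou_anchor_smooth : forall p (s : M -> vb_amb E),
    vb_smooth p s -> vec_smooth_at p (fun q => ca_anchor q (s q));
  cou_br_section : forall s t : M -> vb_amb E,
    sections E s -> sections E t -> sections E (ca_br s t);
  cou_br_linear1 : forall (a : R[i]) (s s' t : M -> vb_amb E),
    sections E s -> sections E s' -> sections E t ->
    forall p, ca_br (fun q => a *: s q + s' q) t p =
              a *: ca_br s t p + ca_br s' t p;
  cou_br_linear2 : forall (a : R[i]) (s t t' : M -> vb_amb E),
    sections E s -> sections E t -> sections E t' ->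
    forall p, ca_br s (fun q => a *: t q + t' q) p =
              a *: ca_br s t p + ca_br s t' p;
  cou_jacobi : forall s t t' : M -> vb_amb E,
    sections E s -> sections E t -> sections E t' ->
    forall p, ca_br s (ca_br t t') p =
              ca_br (ca_br s t) t' p + ca_br t (ca_br s t') p;
  cou_leibniz : forall (f : M -> R[i]) (s t : M -> vb_amb E),
    smooth f -> sections E s -> sections E t ->
    forall p, ca_br s (fun q => f q *: t q) p =
              anch s f p *: t p + f p *: ca_br s t p;
  cou_square : forall s : M -> vb_amb E, sections E s ->
    forall p, ca_br s s p = 2^-1 *: cD E (ipf s s) p;
  cou_metric : forall s t : M -> vb_amb E, sections E s -> sections E t ->
    forall p, anch s (ipf t t) p = 2 * ipf (ca_br s t) t p
}.

Record is_courant_iso (R : realType) (m : nat) (M : manifold R m)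
  (E F : courant M) (Phi : M -> vb_amb E -> vb_amb F) : Prop := IsCourantIso {
  iso_linear : forall p (a : R[i]) (u v : vb_amb E),
    vb_fib p u -> vb_fib p v -> Phi p (a *: u + v) = a *: Phi p u + Phi p v;
  iso_bij : forall p,
    set_bij (@vb_fib _ _ _ E p) (@vb_fib _ _ _ F p) (Phi p);
  iso_smooth : forall p (s : M -> vb_amb E),
    (\forall q \near p, vb_fib q (s q)) ->
    (vb_smooth p s <-> vb_smooth (v := F) p (fun q => Phi q (s q)));
  iso_ip : forall p (u v : vb_amb E), vb_fib p u -> vb_fib p v ->
    ca_ip p (Phi p u) (Phi p v) = ca_ip p u v;
  iso_anchor : forall p (u : vb_amb E), vb_fib p u ->
    ca_anchor p (Phi p u) = ca_anchor p u;
  iso_br : forall s t : M -> vb_amb E, sections E s -> sections E t ->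
    forall p, Phi p (ca_br s t p) =
              ca_br (fun q => Phi q (s q)) (fun q => Phi q (t q)) p
}.

Definition courant_isomorphic (R : realType) (m : nat) (M : manifold R m)
  (E F : courant M) : Prop :=
  [/\ is_courant E, is_courant F & exists Phi, @is_courant_iso R m M E F Phi].

Definition conn (R : realType) (m : nat) (M : manifold R m)
  (E V : vbundle M) : Type :=
  (M -> vb_amb E) -> (M -> vb_amb V) -> (M -> vb_amb V).

Record is_connection (R : realType) (m : nat) (M : manifold R m)
  (E : courant M) (V : vbundle M) (D : conn E V) : Prop := IsConnection {
  conn_section : forall (s : M -> vb_amb E) (v : M -> vb_amb V),
    sections E s -> sections V v -> sections V (D s v);
  conn_add1 : forall (s s' : M -> vb_amb E) (v : M -> vb_amb V),
    sections E s -> sections E s' -> sections V v ->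
    forall p, D (fun q => s q + s' q) v p = D s v p + D s' v p;
  conn_add2 : forall (s : M -> vb_amb E) (v v' : M -> vb_amb V),
    sections E s -> sections V v -> sections V v' ->
    forall p, D s (fun q => v q + v' q) p = D s v p + D s v' p;
  conn_tensorial : forall (f : M -> R[i]) (s : M -> vb_amb E)
      (v : M -> vb_amb V), smooth f -> sections E s -> sections V v ->
    forall p, D (fun q => f q *: s q) v p = f p *: D s v p;
  conn_leibniz : forall (f : M -> R[i]) (s : M -> vb_amb E)
      (v : M -> vb_amb V), smooth f -> sections E s -> sections V v ->
    forall p, D s (fun q => f q *: v q) p = anch s f p *: v p + f p *: D s v p
}.

(* [Om] is the skew map Omega (or Mho, for the exchanged roles) attached to a
   connection D of E2 on E1. *)
Definition is_skew_map (R : realType) (m : nat) (M : manifold R m)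
  (E1 E2 : courant M) (D : conn E2 E1)
  (Om : (M -> vb_amb E1) -> (M -> vb_amb E1) -> (M -> vb_amb E2)) : Prop :=
  forall a b, sections E1 a -> sections E1 b ->
  [/\ sections E2 (Om a b),
      forall p, Om a b p = - Om b a p
    & forall c, sections E2 c -> forall p,
        ipf c (Om a b) p = 2^-1 * (ipf (D c a) b p - ipf a (D c b) p)].

Definition preserves_metric (R : realType) (m : nat) (M : manifold R m)
  (E1 E2 : courant M) (D : conn E1 E2) : Prop :=
  forall a c d, sections E1 a -> sections E2 c -> sections E2 d ->
  forall p, anch a (ipf c d) p = ipf (D a c) d p + ipf c (D a d) p.

Definition omega12 (R : realType) (m : nat) (M : manifold R m)
  (E1 E2 : courant M)
  (Om : (M -> vb_amb E1) -> (M -> vb_amb E1) -> (M -> vb_amb E2))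
  (a1 a2 : M -> vb_amb E1) : M -> vb_amb E2 :=
  fun p => Om a1 a2 p + 2^-1 *: cD E2 (ipf a1 a2) p.

(* Used twice in a matched pair, the second time with E1 and E2 exchanged. *)
Definition derivation_condition (R : realType) (m : nat) (M : manifold R m)
  (E1 E2 : courant M) (fwd : conn E1 E2) (bwd : conn E2 E1)
  (Om : (M -> vb_amb E1) -> (M -> vb_amb E1) -> (M -> vb_amb E2))
  (Mho : (M -> vb_amb E2) -> (M -> vb_amb E2) -> (M -> vb_amb E1)) : Prop :=
  forall a1 a2 al, sections E1 a1 -> sections E1 a2 -> sections E2 al ->
  forall p,
    bwd al (ca_br a1 a2) p - ca_br (bwd al a1) a2 p - ca_br a1 (bwd al a2) p
    - bwd (fwd a2 al) a1 p + bwd (fwd a1 al) a2 p =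
    - Mho al (omega12 Om a1 a2) p
    - 2^-1 *: cD E1 (ipf al (omega12 Om a1 a2)) p.

Definition curvature (R : realType) (m : nat) (M : manifold R m)
  (E : courant M) (V : vbundle M) (D : conn E V) (a b : M -> vb_amb E)
  (v : M -> vb_amb V) : M -> vb_amb V :=
  fun p => D a (D b v) p - D b (D a v) p - D (ca_br a b) v p.

Record matched_pair (R : realType) (m : nat) (M : manifold R m)
  (E1 E2 : courant M) (fwd : conn E1 E2) (bwd : conn E2 E1)
  (Om : (M -> vb_amb E1) -> (M -> vb_amb E1) -> (M -> vb_amb E2))
  (Mho : (M -> vb_amb E2) -> (M -> vb_amb E2) -> (M -> vb_amb E1)) : Prop :=
  MatchedPair {
  mp_courant1 : is_courant E1;
  mp_courant2 : is_courant E2;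
  mp_fwd : is_connection fwd;
  mp_bwd : is_connection bwd;
  mp_fwd_metric : preserves_metric fwd;
  mp_bwd_metric : preserves_metric bwd;
  mp_fwd_D : forall f be, smooth f -> sections E2 be ->
    forall p, fwd (cD E1 f) be p = 0;
  mp_bwd_D : forall f b, smooth f -> sections E1 b ->
    forall p, bwd (cD E2 f) b p = 0;
  mp_Om : is_skew_map bwd Om;
  mp_Mho : is_skew_map fwd Mho;
  mp_cond1 : derivation_condition fwd bwd Om Mho;
  mp_cond2 : derivation_condition bwd fwd Mho Om;
  mp_cond3 : forall a1 a2 al1 al2, sections E1 a1 -> sections E1 a2 ->
    sections E2 al1 -> sections E2 al2 ->
    forall p, ipf (curvature fwd a1 a2 al1) al2 p +
              ipf (curvature bwd al1 al2 a1) a2 p = 0;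
  mp_cond4 : forall a1 a2 a3,
    sections E1 a1 -> sections E1 a2 -> sections E1 a3 ->
    forall p, bwd (Om a1 a2) a3 p + bwd (Om a2 a3) a1 p +
              bwd (Om a3 a1) a2 p = 0;
  mp_cond5 : forall al1 al2 al3,
    sections E2 al1 -> sections E2 al2 -> sections E2 al3 ->
    forall p, fwd (Mho al1 al2) al3 p + fwd (Mho al2 al3) al1 p +
              fwd (Mho al3 al1) al2 p = 0
}.

Definition matched_sum (R : realType) (m : nat) (M : manifold R m)
  (E1 E2 : courant M) (fwd : conn E1 E2) (bwd : conn E2 E1)
  (Om : (M -> vb_amb E1) -> (M -> vb_amb E1) -> (M -> vb_amb E2))
  (Mho : (M -> vb_amb E2) -> (M -> vb_amb E2) -> (M -> vb_amb E1)) :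
  courant M :=
  @Courant R m M (vb_sum E1 E2)
    (fun p u v => ca_ip p u.1 v.1 + ca_ip p u.2 v.2)
    (fun p u => ca_anchor p u.1 + ca_anchor p u.2)
    (fun s t =>
       let a q := (s q).1 in let al q := (s q).2 in
       let b q := (t q).1 in let be q := (t q).2 in
       fun p =>
       (ca_br a b p + bwd al b p - bwd be a p + Mho al be p
          + 2^-1 *: cD E1 (ipf al be) p,
        ca_br al be p + fwd a be p - fwd b al p + Om a b p
          + 2^-1 *: cD E2 (ipf a b) p)).

(* A (+) A^*: pairs (v, al) with v in A and al a cotangent vector in A^*, i.e.
   a linear functional on T_X (x) C that factors through the projection onto A
   (so that sections of (T^{1,0})^* are (1,0)-forms). *)
Definition gtb_fib (R : realType) (n : nat) (A : algebroid) :
  set ('rV[R[i]]_(n + n) * ('rV[R[i]]_(n + n) -> R[i]^o)) :=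
  [set x | [/\ afib A x.1, linear x.2 & forall v, x.2 (apr A v) = x.2 v]].

Definition gtb (R : realType) (n : nat) (X : complex_manifold R n)
  (A : algebroid) : vbundle X :=
  @VBundle R (n + n) X ('rV[R[i]]_(n + n) * ('rV[R[i]]_(n + n) -> R[i]^o))%type
    (fun _ => @gtb_fib R n A)
    (fun p s => [/\ \forall q \near p, gtb_fib A (s q),
                    vec_smooth_at p (fun q => (s q).1)
                  & form1_smooth_at p (fun q => (s q).2)]).

Definition twisted (R : realType) (n : nat) (X : complex_manifold R n)
  (A : algebroid) (h : form3 X) : courant X :=
  @Courant R (n + n) X (gtb X A)
    (fun _ x y => x.2 y.1 + y.2 x.1)
    (fun _ x => x.1)
    (fun s t =>
       let Y q := (s q).1 in let al q := (s q).2 in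
       let Z q := (t q).1 in let be q := (t q).2 in
       fun p =>
       (lie Y Z p,
        fun u => lieA A Y be p u - dA1 A al p (Z p) u + h p (Y p) (Z p) u)).

(* For A = Holo, B = Anti and k = H^{1,2}:
     (X (+) al, Y (+) be) |-> nabla^o_X Y (+) (nabla^o_X be + H^{1,2}(X, Y, .)),
   where nabla^o_X Y = pr^{0,1} [X, Y] and nabla^o_X be = pr^{0,1} (L_X be);
   for A = Anti, B = Holo and k = H^{2,1} the connection in the other
   direction. *)
Definition nabla (R : realType) (n : nat) (X : complex_manifold R n)
  (A B : algebroid) (k : form3 X) : conn (gtb X A) (gtb X B) :=
  fun s t =>
    let Y q := (s q).1 in
    let Z q := (t q).1 in let be q := (t q).2 in
    fun p => (apr B (lie Y Z p),
              fun u => lieA Full Y be p (apr B u) + k p (Y p) (Z p) u).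

Arguments nabla {R n X} A B k _ _.

(* Main.v *)
Require Import Defs.
From HB Require Import structures.
From mathcomp Require Import all_boot all_order all_algebra.
From mathcomp Require Import complex.
From mathcomp Require Import all_classical all_reals all_analysis.
From mathcomp Require Import ring.
Import Order.TTheory GRing.Theory Num.Theory.
Import numFieldNormedType.Exports.
Set Implicit Arguments.
Unset Strict Implicit.
Unset Printing Implicit Defensive.
Local Open Scope classical_set_scope.
Local Open Scope ring_scope.
Local Open Scope complex_scope.

(** The theorem is read off from one Courant algebroid, [F := twisted Full H].

    Let [A] and [B] be the two types [Holo] and [Anti], in any order. They are
    complementary and integrable, so [A + A*] and [B + B*] are complementary
    orthogonal subbundles of [F]. Comparing types of forms, the bracket of
    [twisted A hA] is the [A]-component of the bracket of [F] ([tbr_gpr]), and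
    the connection [nabla A B kAB] is the [B]-component of the bracket of a
    section of [A + A*] with one of [B + B*] ([nabla_gpr]). Such mixed brackets
    are skew by orthogonality ([br_skew]), so a mixed bracket is the difference
    of the two connections. The one remaining component, namely the [B]-part of
    the bracket of two sections of [A + A*], is [omega12], and [Omega] is
    obtained from it by removing the symmetric part ([skew_part]).

    With this dictionary the conditions on a matched pair are components of the
    axioms of [F]. The connections preserve the metrics because the bracket of
    [F] does. The two derivation conditions are components of the Jacobi
    identity ([derivation_cond]); the relation between the curvatures is a
    Jacobi identity paired with a fourth section ([curvature_cond]). The cyclic
    conditions on [Omega] and [Mho], and the vanishing of the connections along
    [D f], hold because the elements concerned have no vector part while [nabla]
    depends on that part only ([nabla_vec0]). The bracket of
    the matched sum is the bracket of [F] written in components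
    ([half_bracket]), so that adding up components is an isomorphism
    ([sum_map_iso]), along which the axioms are transported
    ([courant_transport]).

    It remains to know that [twisted A h] is a Courant algebroid when [h] is a
    section of the third exterior power of [A*] that is closed along [A]. This
    is done at once for the three values of [A] ([twisted_courant]): evaluated
    on a local section of [A], the form part of the bracket only involves
    derivatives of functions and brackets of vector fields ([tbr2]), and the
    Jacobi identity follows from that of the Lie bracket and the Koszul formula
    for [d h] ([tbr_jacobi2]). The analytic input is the chain rule, which makes
    these notions independent of charts, and the symmetry of second derivatives
    ([derive_comm]), which gives [[X, Y] f = X Y f - Y X f] ([der_lie]). *)

(** * Symmetry of second derivatives and smooth functions on open sets *)

Lemma near_eq_differentiable (K : numFieldType) (V W : normedModType K)
    (f g : V -> W) x :
  (\forall y \near x, f y = g y) -> differentiable f x -> differentiable g x.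
Proof.
move=> fg dfx; have cdf := diff_continuous dfx.
have /eqaddoP df := diff_locally dfx.
have E : g \o shift x = cst (g x) + 'd f x +o_ 0 id.
  have fg0 : \forall z \near (0 : V), f (z + x) = g (z + x).
    by move: fg; rewrite (near_shift 0) subr0.
  apply/eqaddoP => e e0; have := df e e0; apply: filterS2 fg0 => h fgh.
  by rewrite /= !fctE/= -(nbhs_singleton fg) -fgh.
apply/diff_locallyP; rewrite (diff_unique cdf E); split=> //.
Qed.

Section RealCalculus.
Variables (R : realType) (m : nat).
Local Notation V := 'rV[R]_m.
Implicit Types (f g : V -> R) (W : set V) (x u v : V) (k l : 'I_m).

(** The mean value theorem in the direction [u] turns the second difference
    over the parallelogram spanned by [h *: u] and [h *: v] into [h] times an
    increment of ['D_u f], and the differentiability of ['D_u f] at [x]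
    evaluates that increment. *)
Lemma second_difference f x u v :
  (\forall y \near x, differentiable f y) -> differentiable ('D_u f) x ->
  forall e, 0 < e -> exists2 d, 0 < d & forall h, 0 < h < d ->
  `|f (x + h *: u + h *: v) - f (x + h *: u) - f (x + h *: v) + f x
    - h ^+ 2 * 'D_v ('D_u f) x| <= e * h ^+ 2.
Proof.
move=> /nbhs_ballP[r /= r0 fr] dG e e0.
set G := 'D_u f; pose K := `|u| + `|v| + 1.
have K0 : 0 < K by rewrite ltr_wpDl// addr_ge0.
(* two errors [e' * (h * K)], multiplied by [h], must add up to [e * h ^+ 2] *)
pose e' := e / (2 * K); have e'0 : 0 < e' by rewrite divr_gt0// mulr_gt0.
have GP : \forall w \near (0 : V), `|G (w + x) - (G x + 'd G x w)| <= e' * `|w|.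
  by have /eqaddoP/(_ _ e'0) := diff_locally dG; apply: filterS => w /=.
have /nbhs_ballP[r' /= r'0 {}GP] := GP.
pose rr := Num.min r r'.
have rr0 : 0 < rr by rewrite lt_min r0 r'0.
exists (rr / K); first by rewrite divr_gt0.
move=> h /andP[h0]; rewrite ltr_pdivlMr// => hK.
have hKr : h * K < r by apply: lt_le_trans hK _; rewrite ge_min lexx.
have hKr' : h * K < r' by apply: lt_le_trans hK _; rewrite ge_min lexx orbT.
have small c s : 0 <= c <= h -> 0 <= s <= h -> `|c *: u + s *: v| <= h * K.
  move=> /andP[c0 ch] /andP[s0 sh].
  apply: le_trans (ler_normD _ _) _; rewrite !normrZ !ger0_norm// /K !mulrDr mulr1.
  by rewrite -[leLHS]addr0 !lerD ?ler_wpM2r// ltW.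
have fd c s : 0 <= c <= h -> 0 <= s <= h -> differentiable f (x + c *: u + s *: v).
  move=> hc hs; apply: fr; rewrite -ball_normE /ball_/= -addrA opprD addNKr normrN.
  exact: le_lt_trans (small _ _ hc hs) hKr.
have GB c s : 0 <= c <= h -> 0 <= s <= h ->
    `|G (x + c *: u + s *: v) - (G x + 'd G x (c *: u + s *: v))| <= e' * (h * K).
  move=> hc hs; rewrite -addrA [x + _]addrC.
  apply: le_trans (GP _ _) _; last by rewrite ler_pM2l// small.
  rewrite -ball_normE /ball_/= sub0r normrN.
  exact: le_lt_trans (small _ _ hc hs) hKr'.
have h00 : 0 <= (0:R) <= h by rewrite lexx ltW.
have hhh : 0 <= h <= h by rewrite lexx ltW.
have line s t : 0 <= s <= h -> 0 <= t <= h ->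
    is_derive t (1:R) (fun t => f (x + t *: u + s *: v)) (G (x + t *: u + s *: v)).
  move=> hs ht; have fd' := fd _ _ ht hs.
  suff E : (fun r : R => r^-1 *: (f (x + (r *: (1 : R) + t) *: u + s *: v)
        - f (x + t *: u + s *: v))) =
      (fun r : R => r^-1 *: (f (r *: u + (x + t *: u + s *: v)) - f (x + t *: u + s *: v))).
    apply: DeriveDef; rewrite /derivable /derive /G /derive E//.
    exact: (@diff_derivable _ _ _ f _ u fd').
  apply/funext => r0'; congr (_ *: (f _ - _)).
  by rewrite [r0' *: 1]mulr1 scalerDl !addrA; congr (_ + _ + _); rewrite addrC.
pose phi t := f (x + t *: u + h *: v) - f (x + t *: u + (0:R) *: v).
have dphi t : 0 <= t <= h ->
   is_derive t (1:R) phi (G (x + t *: u + h *: v) - G (x + t *: u + (0:R) *: v)).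
  move=> ht; have H1 := line _ _ hhh ht; have H2 := line _ _ h00 ht.
  exact: is_deriveB.
have phi_cont : {within `[0, h], continuous phi}.
  apply: derivable_within_continuous => t; rewrite in_itv/= => ht.
  by have [] := dphi _ ht.
have phi_der t : t \in `]0, h[%R -> is_derive t (1:R) phi
    (G (x + t *: u + h *: v) - G (x + t *: u + (0:R) *: v)).
  by rewrite in_itv/= => /andP[t0 th]; apply: dphi; rewrite !ltW.
have [c] := MVT h0 phi_der phi_cont.
rewrite in_itv/= subr0 /phi => /andP[c0 ch].
rewrite !scale0r !addr0 => phiE.
have hc : 0 <= c <= h by rewrite !ltW.
have B1 := GB c h hc hhh; have B2 := GB c 0 hc h00.
rewrite scale0r !addr0 in B2.
have -> : f (x + h *: u + h *: v) - f (x + h *: u) - f (x + h *: v) + f x =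
   (G (x + c *: u + h *: v) - G (x + c *: u)) * h.
  by rewrite -phiE; ring.
have DE : 'd G x (c *: u + h *: v) = 'd G x (c *: u) + h * 'D_v G x.
  by rewrite linearD [X in _ + X]linearZ (@deriveE _ _ _ G x v dG).
rewrite DE in B1.
set A := G (x + c *: u + h *: v) in B1 *; set B := G (x + c *: u) in B2 *.
set D := 'D_v G x in B1 *; set L := 'd G x (c *: u) in B1 B2.
have -> : (A - B) * h - h ^+ 2 * D = ((A - (G x + (L + h * D))) - (B - (G x + L))) * h by ring.
rewrite normrM (gtr0_norm h0) expr2 mulrA ler_pM2r//.
apply: le_trans (ler_normB _ _) _; apply: le_trans (lerD B1 B2) _.
rewrite /e'; have -> : e / (2 * K) * (h * K) = e * h / 2 by field; rewrite gt_eqF.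
by rewrite -splitr.
Qed.

(** Young's theorem: both mixed derivatives are approximated by the same
    second difference, which is symmetric in [u] and [v]. *)
Lemma derive_comm f x u v :
  (\forall y \near x, differentiable f y) ->
  differentiable ('D_u f) x -> differentiable ('D_v f) x ->
  'D_v ('D_u f) x = 'D_u ('D_v f) x.
Proof.
move=> fn du dv; apply/eqP; rewrite -subr_eq0 -normr_eq0 eq_le normr_ge0 andbT.
apply/ler_addgt0Pr => e e0; rewrite add0r.
have e20 : 0 < e / 2 by rewrite divr_gt0.
have [d1 d10 H1] := second_difference v fn du e20.
have [d2 d20 H2] := second_difference u fn dv e20.
pose h := Num.min d1 d2 / 2.
have m0 : 0 < Num.min d1 d2 by rewrite lt_min d10.
have h0 : 0 < h by rewrite divr_gt0.
have hm : h < Num.min d1 d2 by rewrite /h ltr_pdivrMr// ltr_pMr// ltr1n.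
move: hm; rewrite lt_min => /andP[hd1 hd2].
have {}H1 := H1 h (introT andP (conj h0 hd1)).
have {}H2 := H2 h (introT andP (conj h0 hd2)).
rewrite -(ler_pM2r (exprn_gt0 2 h0)).
rewrite -[X in `|_| * X](gtr0_norm (exprn_gt0 2 h0)) -normrM.
rewrite [x + h *: v + h *: u]addrAC in H2.
set A := f _ in H1 H2; set B := f (x + h *: u) in H1 H2; set C := f (x + h *: v) in H1 H2.
set D1 := 'D_v _ _ in H1 *; set D2 := 'D_u _ _ in H2 *.
have -> : (D1 - D2) * h ^+ 2 = (A - C - B + f x - h ^+ 2 * D2) -
   (A - B - C + f x - h ^+ 2 * D1) by ring.
apply: le_trans (ler_normB _ _) _; apply: le_trans (lerD H2 H1) _.
by rewrite -mulrDl -splitr.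
Qed.

(** Differentiability of order [N] on a set, unfolding [inf_diff] from the
    innermost partial derivative, so that the product and chain rules close up
    by induction on [N]. *)
Fixpoint Cn (N : nat) W g : Prop :=
  (forall x, W x -> differentiable g x) /\
  (if N is N'.+1 then forall k, Cn N' W (pder k g) else True).

Lemma Cn_diff N W g x : Cn N W g -> W x -> differentiable g x.
Proof. by case: N => [|N] [+ _]; apply. Qed.

Lemma CnW N W g : Cn N.+1 W g -> Cn N W g.
Proof.
elim: N g => [|N IH] g [dg pg]; first by split.
by split=> // k; apply: IH; apply: pg.
Qed.

Lemma inf_diffP W g : (forall x, W x -> inf_diff g x) <-> forall N, Cn N W g.
Proof.
split=> [H N|H x Wx s].
  elim: N g H => [|N IH] g H; split=> //; try by move=> x /H/(_ [::]).
  by move=> k; apply: IH => x /H Hx s; have := Hx (rcons s k); rewrite foldr_rcons.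
elim/last_ind: s g H => [|s k IH] g H; first exact: Cn_diff (H 0%N) Wx.
by rewrite foldr_rcons; apply: IH => N; have [_] := H N.+1; apply.
Qed.

Lemma open_near W x : open W -> W x -> \forall y \near x, W y.
Proof. by move=> oW Wx; exact: open_nbhs_nbhs. Qed.

Lemma eq_near W f g x : open W -> {in W, f =1 g} -> W x -> \forall y \near x, f y = g y.
Proof.
move=> oW fg Wx; apply: filterS (open_near oW Wx) => y Wy; apply: fg.
exact/mem_set.
Qed.

Lemma pder_eq W f g k : open W -> {in W, f =1 g} -> {in W, pder k f =1 pder k g}.
Proof.
by move=> oW fg x /set_mem Wx; apply: near_eq_derive; exact: eq_near fg Wx.
Qed.

Lemma Cn_eq N W f g : open W -> {in W, f =1 g} -> Cn N W f -> Cn N W g.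
Proof.
move=> oW; elim: N f g => [|N IH] f g fg [df pf].
  by split=> // x Wx; apply: near_eq_differentiable (eq_near oW fg Wx) (df _ Wx).
split=> [x Wx|k]; first by apply: near_eq_differentiable (eq_near oW fg Wx) (df _ Wx).
by apply: IH (pf k); exact: pder_eq.
Qed.

Lemma Cn_sub N W W' f : W' `<=` W -> Cn N W f -> Cn N W' f.
Proof.
move=> WW'; elim: N f => [|N IH] f [df pf]; first by split=> // x /WW'/df.
by split=> [x /WW'/df//|k]; exact: IH (pf k).
Qed.

Lemma pder_cst k (c : R) : pder k (fun=> c) = (fun=> 0) :> (V -> R).
Proof. by apply/funext => x; rewrite /pder; exact: derive_cst. Qed.

Lemma Cn_cst N W c : Cn N W (fun=> c).
Proof.
elim: N c => [|N IH] c; first by split=> // x _; exact: differentiable_cst.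
by split=> [x _|k]; [exact: differentiable_cst|rewrite pder_cst].
Qed.

Lemma Cn_add N W f g : open W -> Cn N W f -> Cn N W g -> Cn N W (f \+ g).
Proof.
move=> oW; elim: N f g => [|N IH] f g [df pf] [dg pg].
  by split=> // x Wx; apply: differentiableD; [exact: df|exact: dg].
split=> [x Wx|k]; first by apply: differentiableD; [exact: df|exact: dg].
apply: Cn_eq oW _ (IH _ _ (pf k) (pg k)) => x /set_mem Wx.
by rewrite /pder deriveD//; apply: diff_derivable; [exact: df|exact: dg].
Qed.

Lemma Cn_mul N W f g : open W -> Cn N W f -> Cn N W g -> Cn N W (f \* g).
Proof.
move=> oW; elim: N f g => [|N IH] f g Cf Cg.
  by split=> // x Wx; apply: differentiableM; [exact: Cn_diff Cf Wx|exact: Cn_diff Cg Wx].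
have [df pf] := Cf; have [dg pg] := Cg.
split=> [x Wx|k]; first by apply: differentiableM; [exact: df|exact: dg].
apply: Cn_eq oW _ (Cn_add oW (IH _ _ (CnW Cf) (pg k)) (IH _ _ (CnW Cg) (pf k))).
move=> x /set_mem Wx.
by rewrite /pder deriveM//; apply: diff_derivable; [exact: df|exact: dg].
Qed.

Lemma Cn_sum N W n (F : 'I_n -> V -> R) : open W -> (forall i, Cn N W (F i)) ->
  Cn N W (fun x => \sum_i F i x).
Proof.
move=> oW CF; elim: n F CF => [|n IH] F CF.
  by rewrite (_ : (fun _ => _) = fun=> 0); [exact: Cn_cst|apply/funext => x; rewrite big_ord0].
rewrite (_ : (fun _ => _) = (fun x => \sum_(i < n) F (widen_ord (leqnSn n) i) x) \+ F ord_max).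
  by apply: Cn_add oW _ _ => //; apply: IH.
by apply/funext => x; rewrite big_ord_recr.
Qed.

Lemma row_decomp (v : V) : v = \sum_k v 0 k *: delta_mx 0 k.
Proof. by rewrite {1}[v]row_sum_delta. Qed.

Lemma diff_pder g x (v : V) : differentiable g x ->
  'd g x v = \sum_k v 0 k * pder k g x.
Proof.
move=> dg; rewrite {1}[v]row_decomp linear_sum/=; apply: eq_bigr => k _.
by rewrite linearZ /pder deriveE.
Qed.

Lemma differentiable_row (phi : V -> V) x :
  (forall l, differentiable (fun y => phi y 0 l) x) -> differentiable phi x.
Proof.
move=> dphi.
rewrite (_ : phi = \sum_l (fun y => phi y 0 l *: (delta_mx 0 l : V))).
  by apply: differentiable_sum => l; apply: differentiableZl.
by apply/funext => y; rewrite fct_sumE -row_decomp.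
Qed.

Lemma pder_comp g (phi : V -> V) x k :
  (forall l, differentiable (fun y => phi y 0 l) x) -> differentiable g (phi x) ->
  pder k (g \o phi) x = \sum_l pder l g (phi x) * pder k (fun y => phi y 0 l) x.
Proof.
move=> dphi dg; have dp := differentiable_row dphi.
rewrite /pder deriveE; last exact: differentiable_comp.
rewrite diff_comp//= diff_pder//; apply: eq_bigr => l _; rewrite mulrC; congr (_ * _).
rewrite deriveE//.
pose c (N : V) : R := N 0 l.
have dc : differentiable c (phi x) by exact: differentiable_coord.
have -> : (fun y => phi y 0 l) = c \o phi by [].
rewrite (diff_comp dp dc) /=.
have @f : {linear V -> R}.
  by exists c; do 2![eexists]; do ?[constructor];
     rewrite /c ?mxE// => ? *; rewrite ?mxE//; move=> ?; rewrite !mxE.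
have fc : continuous f by exact: coord_continuous.
by have := @diff_lin _ _ _ f (phi x) fc => ->.
Qed.

Lemma Cn_comp N W W' g (phi : V -> V) : open W -> open W' ->
  (forall x, W x -> W' (phi x)) -> Cn N W' g ->
  (forall l, Cn N W (fun y => phi y 0 l)) -> Cn N W (g \o phi).
Proof.
move=> oW oW' WW'; elim: N g => [|N IH] g Cg Cphi.
  split=> // x Wx; apply: differentiable_comp; last exact: Cn_diff Cg (WW' _ Wx).
  by apply: differentiable_row => l; exact: Cn_diff (Cphi l) Wx.
have [dg pg] := Cg; split=> [x Wx|k].
  apply: differentiable_comp; last exact: dg _ (WW' _ Wx).
  by apply: differentiable_row => l; exact: Cn_diff (Cphi l) Wx.
pose S x := \sum_l pder l g (phi x) * pder k (fun y => phi y 0 l) x.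
apply: (@Cn_eq _ _ S) => // [x /set_mem Wx|].
  rewrite pder_comp//; last exact: dg _ (WW' _ Wx).
  by move=> l; exact: Cn_diff (Cphi l) Wx.
apply: Cn_sum => // l; apply: Cn_mul => //.
  by apply: (IH _ (pg l)) => l'; exact: CnW (Cphi l').
by have [_ +] := Cphi l; apply.
Qed.

(** Smoothness as a property of germs: unlike [inf_diff] at one point, it
    passes to nearby points ([rsm_near]). *)
Definition rsm g x := \forall y \near x, inf_diff g y.

Lemma rsmP g x : rsm g x <-> exists W, [/\ open W, W x & forall N, Cn N W g].
Proof.
rewrite /rsm /prop_near1 nbhsE; split=> [[W [oW Wx] H]|[W [oW Wx H]]].
  by exists W; split=> //; apply/inf_diffP.
by exists W => //; apply/inf_diffP.
Qed.

End RealCalculus.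

(** * Germs of smooth functions *)

Section SmoothGerms.
Variables (R : realType) (m : nat).
Local Notation V := 'rV[R]_m.
Implicit Types (f g : V -> R) (x u v : V) (k l : 'I_m).

Lemma rsm_near g x : rsm g x -> \forall y \near x, rsm g y.
Proof. exact: near_join. Qed.

Lemma rsm_eq f g x : (\forall y \near x, f y = g y) -> rsm f x -> rsm g x.
Proof.
move=> fg /rsmP[W [oW Wx CW]]; apply/rsmP.
have [U [oU Ux] fgU] : exists2 U : set V, open U /\ U x & U `<=` (fun y => f y = g y).
  by move: fg; rewrite /prop_near1 nbhsE => -[U [oU Ux] H]; exists U.
exists (W `&` U); split=> [|//|N]; first exact: openI.
apply: (@Cn_eq _ _ _ _ f).
- exact: openI.
- by move=> y /set_mem[_ /fgU].
- by apply: (@Cn_sub _ _ _ W) => // y [].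
Qed.

Lemma rsm_cst (c : R) x : rsm (fun=> c) x.
Proof. by apply/rsmP; exists setT; split=> [||N]; [exact: openT|by []|exact: Cn_cst]. Qed.

Lemma rsm_op2 (Q : (V -> R) -> (V -> R) -> (V -> R)) f g x :
  (forall W N, open W -> Cn N W f -> Cn N W g -> Cn N W (Q f g)) ->
  rsm f x -> rsm g x -> rsm (Q f g) x.
Proof.
move=> HQ /rsmP[W [oW Wx CW]] /rsmP[U [oU Ux CU]]; apply/rsmP.
exists (W `&` U); split=> [|//|N]; first exact: openI.
apply: HQ; first exact: openI.
- by apply: (@Cn_sub _ _ _ W) => // y [].
- by apply: (@Cn_sub _ _ _ U) => // y [].
Qed.

Lemma rsm_add f g x : rsm f x -> rsm g x -> rsm (fun y => f y + g y) x.
Proof. by apply: (@rsm_op2 (fun f g => f \+ g)) => W N; exact: Cn_add. Qed.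

Lemma rsm_mul f g x : rsm f x -> rsm g x -> rsm (fun y => f y * g y) x.
Proof. by apply: (@rsm_op2 (fun f g => f \* g)) => W N; exact: Cn_mul. Qed.

Lemma rsm_sub f g x : rsm f x -> rsm g x -> rsm (fun y => f y - g y) x.
Proof.
move=> sf sg; have := rsm_add sf (rsm_mul (rsm_cst (- 1) x) sg).
by congr rsm; apply/funext => y; rewrite mulN1r.
Qed.

Lemma rsm_pder k g x : rsm g x -> rsm (pder k g) x.
Proof.
move=> /rsmP[W [oW Wx CW]]; apply/rsmP; exists W; split=> // N.
by have [_] := CW N.+1; apply.
Qed.

Lemma rsm_comp g (phi : V -> V) x : {for x, continuous phi} ->
  (forall l, rsm (fun y => phi y 0 l) x) -> rsm g (phi x) ->
  rsm (fun y => g (phi y)) x.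
Proof.
move=> cphi sphi /rsmP[W' [oW' Wx' CW']].
have near1 : \forall y \near x, W' (phi y) by exact: cphi (open_near oW' Wx').
have near2 : \forall y \near x, forall l, inf_diff (fun z => phi z 0 l) y.
  exact: (@filter_forall V _ (fun l y => inf_diff (fun z => phi z 0 l) y) (nbhs x)).
have : \forall y \near x, W' (phi y) /\ forall l, inf_diff (fun z => phi z 0 l) y.
  exact: filterI near1 near2.
rewrite /prop_near1 nbhsE => -[W [oW Wx] H]; apply/rsmP; exists W; split=> // N.
apply: (@Cn_comp _ _ _ _ W') => // [y /H[]//|l].
by apply: (iffLR (inf_diffP _ _)) => y /H[].
Qed.

Lemma rsm_differentiable g x : rsm g x -> differentiable g x.
Proof. by move=> /nbhs_singleton/(_ [::]). Qed.

Lemma pderD k f g x : rsm f x -> rsm g x ->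
  pder k (fun y => f y + g y) x = pder k f x + pder k g x.
Proof.
move=> sf sg; rewrite /pder (_ : (fun y => f y + g y) = f + g)// deriveD//;
by apply: diff_derivable; exact: rsm_differentiable.
Qed.

Lemma pderM k f g x : rsm f x -> rsm g x ->
  pder k (fun y => f y * g y) x = pder k f x * g x + f x * pder k g x.
Proof.
move=> sf sg; rewrite /pder (_ : (fun y => f y * g y) = f * g)// deriveM//; last 2 first.
- by apply: diff_derivable; exact: rsm_differentiable.
- by apply: diff_derivable; exact: rsm_differentiable.
by rewrite addrC; congr (_ + _); exact: mulrC.
Qed.

Lemma pder_comm k l g x : rsm g x -> pder k (pder l g) x = pder l (pder k g) x.
Proof.
move=> sg; apply: derive_comm.
- by apply: filterS (rsm_near sg) => y; exact: rsm_differentiable.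
- exact/rsm_differentiable/rsm_pder.
- exact/rsm_differentiable/rsm_pder.
Qed.

End SmoothGerms.

Section ComplexGerms.
Variables (R : realType) (m : nat).
Local Notation V := 'rV[R]_m.
Local Notation C := R[i].
Implicit Types (f g : V -> C) (x u v : V) (k l : 'I_m).
Local Notation Re := complex.Re.
Local Notation Im := complex.Im.

Definition csm g x := \forall y \near x, cinf_diff g y.

Lemma csmP g x : csm g x <-> rsm (fun y => Re (g y)) x /\ rsm (fun y => Im (g y)) x.
Proof.
split=> [H|[H1 H2]]; last exact: filterI H1 H2.
by split; apply: filterS H => y [].
Qed.

Lemma csm_near g x : csm g x -> \forall y \near x, csm g y.
Proof. exact: near_join. Qed.

Lemma csm_eq f g x : (\forall y \near x, f y = g y) -> csm f x -> csm g x.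
Proof.
move=> fg /csmP[s1 s2]; apply/csmP; split; [move: s1|move: s2]; apply: rsm_eq;
by apply: filterS fg => y ->.
Qed.

Lemma csm_cst (c : C) x : csm (fun=> c) x.
Proof. by apply/csmP; split; exact: rsm_cst. Qed.

Lemma ReD (a b : C) : Re (a + b) = Re a + Re b. Proof. by case: a; case: b. Qed.
Lemma ImD (a b : C) : Im (a + b) = Im a + Im b. Proof. by case: a; case: b. Qed.
Lemma ReM (a b : C) : Re (a * b) = Re a * Re b - Im a * Im b.
Proof. by case: a; case: b. Qed.
Lemma ImM (a b : C) : Im (a * b) = Re a * Im b + Im a * Re b.
Proof. by case: a; case: b. Qed.

Lemma csm_add f g x : csm f x -> csm g x -> csm (fun y => f y + g y) x.
Proof.
move=> /csmP[f1 f2] /csmP[g1 g2]; apply/csmP; split.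
  by under eq_fun do rewrite ReD; exact: rsm_add.
by under eq_fun do rewrite ImD; exact: rsm_add.
Qed.

Lemma csm_mul f g x : csm f x -> csm g x -> csm (fun y => f y * g y) x.
Proof.
move=> /csmP[f1 f2] /csmP[g1 g2]; apply/csmP; split.
  by under eq_fun do rewrite ReM; apply: rsm_sub; exact: rsm_mul.
by under eq_fun do rewrite ImM; apply: rsm_add; exact: rsm_mul.
Qed.

Lemma csm_comp g (phi : V -> V) x : {for x, continuous phi} ->
  (forall l, rsm (fun y => phi y 0 l) x) -> csm g (phi x) ->
  csm (fun y => g (phi y)) x.
Proof.
move=> cphi sphi /csmP[g1 g2]; apply/csmP; split.
  exact: (@rsm_comp _ _ (fun y => Re (g y))).
exact: (@rsm_comp _ _ (fun y => Im (g y))).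
Qed.

Lemma csm_cpder k g x : csm g x -> csm (cpder k g) x.
Proof. by move=> /csmP[g1 g2]; apply/csmP; split; exact: rsm_pder. Qed.

Lemma cpder_eq k f g x : (\forall y \near x, f y = g y) -> cpder k f x = cpder k g x.
Proof.
by move=> fg; rewrite /cpder; congr (_ +i* _); apply: near_eq_derive;
   apply: filterS fg => y ->.
Qed.

Lemma cpder_cst k (c : C) x : cpder k (fun=> c) x = 0.
Proof. by rewrite /cpder !pder_cst. Qed.

Lemma cpderD k f g x : csm f x -> csm g x ->
  cpder k (fun y => f y + g y) x = cpder k f x + cpder k g x.
Proof.
move=> /csmP[f1 f2] /csmP[g1 g2]; rewrite /cpder.
under eq_fun do rewrite ReD; under [X in _ +i* pder _ X _]eq_fun do rewrite ImD.
by rewrite !pderD.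
Qed.

Lemma cpderM k f g x : csm f x -> csm g x ->
  cpder k (fun y => f y * g y) x = cpder k f x * g x + f x * cpder k g x.
Proof.
move=> /csmP[f1 f2] /csmP[g1 g2]; rewrite /cpder.
have -> : (fun y => Re (f y * g y)) =
    (fun y => Re (f y) * Re (g y) + (- 1) * (Im (f y) * Im (g y))).
  by apply/funext => y; rewrite ReM mulN1r.
have -> : (fun y => Im (f y * g y)) =
    (fun y => Re (f y) * Im (g y) + Im (f y) * Re (g y)).
  by apply/funext => y; rewrite ImM.
have s1 := rsm_mul f1 g1; have s2 := rsm_mul f2 g2.
have s3 := rsm_mul f1 g2; have s4 := rsm_mul f2 g1.
have s5 := rsm_mul (rsm_cst (-1) x) s2.
rewrite pderD// pderD// (pderM k (rsm_cst (-1) x) s2) !pderM//.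
rewrite pder_cst.
by apply/eqP; rewrite eq_complex !(ReD, ImD, ReM, ImM)/=; apply/andP; split;
   apply/eqP; ring.
Qed.

Lemma cpder_comm k l g x : csm g x -> cpder k (cpder l g) x = cpder l (cpder k g) x.
Proof.
by move=> /csmP[g1 g2]; rewrite /cpder/= (pder_comm k l g1) (pder_comm k l g2).
Qed.

Lemma Re_sum n (F : 'I_n -> C) : Re (\sum_i F i) = \sum_i Re (F i).
Proof. by elim/big_rec2: _ => // i a b _ <-; rewrite ReD. Qed.
Lemma Im_sum n (F : 'I_n -> C) : Im (\sum_i F i) = \sum_i Im (F i).
Proof. by elim/big_rec2: _ => // i a b _ <-; rewrite ImD. Qed.

Lemma cpder_comp k g (phi : V -> V) x :
  (forall l, rsm (fun y => phi y 0 l) x) -> csm g (phi x) ->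
  cpder k (fun y => g (phi y)) x =
  \sum_l cpder l g (phi x) * (pder k (fun y => phi y 0 l) x)%:C.
Proof.
move=> sphi /csmP[g1 g2]; rewrite /cpder.
rewrite -[X in X +i* _]/(pder k ((fun y => Re (g y)) \o phi) x).
rewrite -[X in _ +i* X]/(pder k ((fun y => Im (g y)) \o phi) x).
have dphi l : differentiable (fun y => phi y 0 l) x by exact: rsm_differentiable.
rewrite !pder_comp//; try exact: rsm_differentiable.
apply/eqP; rewrite eq_complex Re_sum Im_sum/=; apply/andP; split; apply/eqP.
  by apply: eq_bigr => l _; rewrite /= mulr0 subr0.
by apply: eq_bigr => l _; rewrite /= mulr0 add0r.
Qed.

End ComplexGerms.

(** * Calculus on a manifold *)

(** Opaque copies of [der] and [lie]: once the chain rule has shown that they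
    do not depend on charts, only their algebraic rules are used. *)
HB.lock Definition vder (R : realType) (m : nat) (M : manifold R m) :=
  @der R m M.

HB.lock Definition vlie (R : realType) (m : nat) (M : manifold R m) :=
  @lie R m M.

Section Charts.
Variables (R : realType) (m : nat) (M : manifold R m).
Local Notation C := R[i].
Local Notation V := 'rV[R]_m.
Implicit Types (p q : M) (i j : mf_chart M) (k l : 'I_m) (f g : M -> C).

Lemma vderE : @vder R m M = @der R m M. Proof. by rewrite vder.unlock. Qed.
Lemma vlieE : @vlie R m M = @lie R m M. Proof. by rewrite vlie.unlock. Qed.

Lemma chart_at_dom p : mf_dom (chart_at p) p.
Proof. exact: projT2 (cid (mf_cover p)). Qed.

Lemma dom_near i p : mf_dom i p -> \forall q \near p, mf_dom i q.
Proof. by move=> dp; apply: open_nbhs_nbhs; split=> //; exact: mf_dom_open. Qed.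

Lemma near_pt i p (P : M -> Prop) : mf_dom i p ->
  (\forall q \near p, P q) -> \forall x \near mf_crd i p, P (mf_pt i x).
Proof.
by move=> dp nP; apply: (mf_pt_continuous dp); rewrite mf_ptK.
Qed.

Lemma near_crd i p (P : V -> Prop) : mf_dom i p ->
  (\forall x \near mf_crd i p, P x) -> \forall q \near p, P (mf_crd i q).
Proof. by move=> dp nP; exact: (mf_crd_continuous dp). Qed.

Lemma crd_ptK_near i p : mf_dom i p ->
  \forall x \near mf_crd i p, mf_crd i (mf_pt i x) = x.
Proof.
move=> dp; have : (mf_crd i @` mf_dom i) (mf_crd i p) by exists p.
move=> /(open_near (@mf_img_open _ _ _ i)); apply: filterS => x [q dq <-].
by rewrite mf_ptK.
Qed.

Lemma transition_rsm i j p l : mf_dom i p -> mf_dom j p ->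
  rsm (fun x => mf_crd j (mf_pt i x) 0 l) (mf_crd i p).
Proof.
move=> di dj; apply: filterS3 (near_pt di (dom_near di)) (near_pt di (dom_near dj))
  (crd_ptK_near di) => x dix djx xE.
by have := mf_transition dix djx l; rewrite xE.
Qed.

Lemma transition_continuous i j p : mf_dom i p -> mf_dom j p ->
  {for mf_crd i p, continuous (fun x => mf_crd j (mf_pt i x))}.
Proof.
move=> di dj; apply: (@continuous_comp _ _ _ (mf_pt i) (mf_crd j)).
  exact: mf_pt_continuous.
by rewrite mf_ptK//; exact: mf_crd_continuous.
Qed.

Lemma transition_ptK i j p : mf_dom i p -> mf_dom j p ->
  \forall x \near mf_crd i p, mf_pt j (mf_crd j (mf_pt i x)) = mf_pt i x.
Proof.
by move=> di dj; apply: filterS (near_pt di (dom_near dj)) => x; exact: mf_ptK.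
Qed.

(** Transition maps are smooth, so a single chart decides smoothness in all of
    them. *)
Lemma smooth_at_chart i p f : mf_dom i p ->
  csm (fun y => f (mf_pt i y)) (mf_crd i p) -> smooth_at p f.
Proof.
move=> di sf j dj.
apply: (@csm_eq _ _ (fun y => f (mf_pt i (mf_crd i (mf_pt j y))))).
  by apply: filterS (transition_ptK dj di) => x ->.
apply: (@csm_comp _ _ (fun x => f (mf_pt i x)) (fun y => mf_crd i (mf_pt j y))).
- exact: transition_continuous.
- by move=> l; exact: transition_rsm.
- by rewrite mf_ptK.
Qed.

Lemma smooth_at_near p f : smooth_at p f -> \forall q \near p, smooth_at q f.
Proof.
move=> sf; have dp := chart_at_dom p.
have := near_crd dp (csm_near (sf _ dp)); apply: filterS2 (dom_near dp) => q dq.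
exact: smooth_at_chart.
Qed.

Lemma smooth_at_eq p f g : (\forall q \near p, f q = g q) -> smooth_at p f -> smooth_at p g.
Proof.
move=> fg sf i di; apply: csm_eq (sf i di).
exact: (@near_pt i p (fun q => f q = g q)).
Qed.

Lemma smooth_at_cst p (c : C) : smooth_at p (fun=> c).
Proof. by move=> i di; exact: csm_cst. Qed.

Lemma smooth_atD p f g : smooth_at p f -> smooth_at p g -> smooth_at p (fun q => f q + g q).
Proof. by move=> sf sg i di; apply: csm_add; [exact: sf|exact: sg]. Qed.

Lemma smooth_atM p f g : smooth_at p f -> smooth_at p g -> smooth_at p (fun q => f q * g q).
Proof. by move=> sf sg i di; apply: csm_mul; [exact: sf|exact: sg]. Qed.

Lemma smooth_atN p f : smooth_at p f -> smooth_at p (fun q => - f q).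
Proof.
move=> sf; have := smooth_atM (@smooth_at_cst p (- 1)) sf.
by apply: smooth_at_eq; apply: nearW => q; rewrite mulN1r.
Qed.

Lemma smooth_atB p f g : smooth_at p f -> smooth_at p g -> smooth_at p (fun q => f q - g q).
Proof. by move=> sf /smooth_atN sg; exact: smooth_atD. Qed.

Lemma smooth_at_sum p n (F : 'I_n -> M -> C) : (forall a, smooth_at p (F a)) ->
  smooth_at p (fun q => \sum_a F a q).
Proof.
elim: n F => [|n IH] F sF.
  have -> : (fun q => \sum_a F a q) = (fun=> 0).
    by apply/funext => q; rewrite big_ord0.
  exact: smooth_at_cst.
have -> : (fun q => \sum_a F a q) =
    (fun q => \sum_a F (widen_ord (leqnSn n) a) q + F ord_max q).
  by apply/funext => q; rewrite big_ord_recr.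
refine (smooth_atD _ (sF _)).
by apply: (IH (fun a => F (widen_ord (leqnSn n) a))) => a; exact: sF.
Qed.

Lemma pder_coord k l (x : V) : pder k (fun y : V => y 0 l) x = (k == l)%:R.
Proof.
have dc : differentiable (fun y : V => y 0 l) x by exact: differentiable_coord.
have @f : {linear V -> R}.
  by exists (fun y : V => y 0 l); do 2![eexists]; do ?[constructor];
     rewrite ?mxE// => ? *; rewrite ?mxE//; move=> ?; rewrite !mxE.
have fc : continuous f by exact: coord_continuous.
rewrite /pder deriveE//.
have := @diff_lin _ _ _ f x fc => ->.
by rewrite /= mxE eqxx/= eq_sym.
Qed.

(** The chain rule for transition maps. *)
Lemma jac_comp i j h p : mf_dom i p -> mf_dom j p -> mf_dom h p ->
  jac i j p *m jac j h p = jac i h p.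
Proof.
move=> di dj dh; apply/matrixP => k l; rewrite !mxE.
have -> : pder k (fun x => mf_crd h (mf_pt i x) 0 l) (mf_crd i p) =
   pder k ((fun y => mf_crd h (mf_pt j y) 0 l) \o (fun x => mf_crd j (mf_pt i x)))
     (mf_crd i p).
  apply: near_eq_derive; apply: filterS (transition_ptK di dj) => x /=.
  by move=> ->.
rewrite pder_comp/=.
- by apply: eq_bigr => a _; rewrite !mxE mulrC mf_ptK.
- by move=> a; exact/rsm_differentiable/transition_rsm.
- by rewrite mf_ptK//; exact/rsm_differentiable/transition_rsm.
Qed.

Lemma jac_id i p : mf_dom i p -> jac i i p = 1%:M.
Proof.
move=> di; apply/matrixP => k l; rewrite !mxE -(pder_coord k l (mf_crd i p)).
by apply: near_eq_derive; apply: filterS (crd_ptK_near di) => x ->.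
Qed.

Definition cjac i j p : 'M[C]_m := map_mx (real_complex R) (jac i j p).

Lemma cjac_comp i j h p : mf_dom i p -> mf_dom j p -> mf_dom h p ->
  cjac i j p *m cjac j h p = cjac i h p.
Proof. by move=> di dj dh; rewrite -map_mxM jac_comp. Qed.

Lemma cjac_id i p : mf_dom i p -> cjac i i p = 1%:M.
Proof. by move=> di; rewrite /cjac jac_id// map_mx1. Qed.

Lemma cjac_smooth i j p k l : mf_dom i p -> mf_dom j p ->
  smooth_at p (fun q => cjac i j q k l).
Proof.
move=> di dj; apply: (@smooth_at_chart i) => //.
apply: (@csm_eq _ _ (fun y => (pder k (fun x => mf_crd j (mf_pt i x) 0 l) y)%:C)).
  by apply: filterS (crd_ptK_near di) => x xE; rewrite !mxE xE.
by apply/csmP; split; [exact/rsm_pder/transition_rsm|exact: rsm_cst].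
Qed.

Lemma tcoordE i p v : tcoord i p v = v *m cjac (chart_at p) i p.
Proof. by []. Qed.

Lemma tconstE i p v : tconst i p v = v *m cjac i (chart_at p) p.
Proof. by []. Qed.

Lemma tcoord_id p v : tcoord (chart_at p) p v = v.
Proof. by rewrite tcoordE cjac_id ?mulmx1//; exact: chart_at_dom. Qed.

Lemma tconst_id p v : tconst (chart_at p) p v = v.
Proof. by rewrite tconstE cjac_id ?mulmx1//; exact: chart_at_dom. Qed.

Lemma tcoordK i p v : mf_dom i p -> tconst i p (tcoord i p v) = v.
Proof.
move=> di; have dp := chart_at_dom p.
by rewrite tcoordE tconstE -mulmxA cjac_comp// cjac_id// mulmx1.
Qed.

Lemma tconstK i p v : mf_dom i p -> tcoord i p (tconst i p v) = v.
Proof.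
move=> di; have dp := chart_at_dom p.
by rewrite tcoordE tconstE -mulmxA cjac_comp// cjac_id// mulmx1.
Qed.

Lemma tcoord_trans i j p v : mf_dom i p -> mf_dom j p ->
  tcoord j p v = tcoord i p v *m cjac i j p.
Proof.
move=> di dj; have dp := chart_at_dom p.
by rewrite !tcoordE -mulmxA cjac_comp.
Qed.

(** The chain rule, for a function read in two charts. *)
Lemma cpder_chart i j p f k : mf_dom i p -> mf_dom j p -> smooth_at p f ->
  cpder k (fun y => f (mf_pt j y)) (mf_crd j p) =
  \sum_l cjac j i p k l * cpder l (fun y => f (mf_pt i y)) (mf_crd i p).
Proof.
move=> di dj sf.
rewrite (@cpder_eq _ _ k _ (fun x => f (mf_pt i (mf_crd i (mf_pt j x))))); last first.
  by apply: filterS (transition_ptK dj di) => x ->.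
rewrite (@cpder_comp _ _ k (fun y => f (mf_pt i y)) (fun x => mf_crd i (mf_pt j x))).
- by apply: eq_bigr => l _; rewrite !mxE mulrC mf_ptK.
- by move=> l; exact: transition_rsm.
- by rewrite mf_ptK//; exact: sf.
Qed.

(** The Jacobian in [tcoord] and the one of the chain rule cancel, so [der]
    may be computed in any chart. *)
Lemma derE i p v f : mf_dom i p -> smooth_at p f ->
  vder p v f = \sum_k tcoord i p v 0 k * cpder k (fun y => f (mf_pt i y)) (mf_crd i p).
Proof.
move=> di sf; rewrite vder.unlock /der.
under eq_bigr do rewrite (cpder_chart _ di (chart_at_dom p) sf) mulr_sumr.
rewrite exchange_big/=; apply: eq_bigr => l _; rewrite tcoordE mxE mulr_suml.
by apply: eq_bigr => k _; rewrite mulrA.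
Qed.

Lemma der_eq p v f g : (\forall q \near p, f q = g q) -> vder p v f = vder p v g.
Proof.
move=> fg; rewrite vder.unlock; apply: eq_bigr => k _; congr (_ * _); apply: cpder_eq.
exact: (@near_pt _ p (fun q => f q = g q) (chart_at_dom p)).
Qed.

Lemma der_cst p v (c : C) : vder p v (fun=> c) = 0.
Proof. by rewrite vder.unlock /der big1// => k _; rewrite cpder_cst mulr0. Qed.

Lemma derD p v f g : smooth_at p f -> smooth_at p g ->
  vder p v (fun q => f q + g q) = vder p v f + vder p v g.
Proof.
move=> sf sg; have dp := chart_at_dom p; rewrite vder.unlock /der -big_split/=.
by apply: eq_bigr => k _; rewrite cpderD ?mulrDr//; [exact: sf|exact: sg].
Qed.

Lemma derM p v f g : smooth_at p f -> smooth_at p g ->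
  vder p v (fun q => f q * g q) = vder p v f * g p + f p * vder p v g.
Proof.
move=> sf sg; have dp := chart_at_dom p.
rewrite vder.unlock /der mulr_suml mulr_sumr -big_split/=.
apply: eq_bigr => k _; rewrite cpderM; [|exact: sf|exact: sg].
by rewrite mf_ptK// mulrDr mulrA mulrCA.
Qed.

Lemma derN p v f : smooth_at p f -> vder p v (fun q => - f q) = - vder p v f.
Proof.
move=> sf; have := derM v (@smooth_at_cst p (- 1)) sf.
rewrite der_cst mul0r add0r mulN1r => <-.
by apply: der_eq; apply: nearW => q; rewrite mulN1r.
Qed.

Lemma derB p v f g : smooth_at p f -> smooth_at p g ->
  vder p v (fun q => f q - g q) = vder p v f - vder p v g.
Proof. by move=> sf sg; rewrite derD ?derN//; exact: smooth_atN. Qed.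

Lemma der_sum p v n (F : 'I_n -> M -> C) : (forall a, smooth_at p (F a)) ->
  vder p v (fun q => \sum_a F a q) = \sum_a vder p v (F a).
Proof.
elim: n F => [|n IH] F sF.
  have -> : (fun q => \sum_a F a q) = (fun=> 0).
    by apply/funext => q; rewrite big_ord0.
  by rewrite big_ord0 der_cst.
have -> : (fun q => \sum_a F a q) =
    (fun q => \sum_a F (widen_ord (leqnSn n) a) q + F ord_max q).
  by apply/funext => q; rewrite big_ord_recr.
rewrite derD; last exact: sF.
  by rewrite big_ord_recr/= (IH (fun a => F (widen_ord (leqnSn n) a))).
by apply: (@smooth_at_sum p n (fun a => F (widen_ord (leqnSn n) a))) => a; exact: sF.
Qed.

Lemma der_lin p a u v f : vder p (a *: u + v) f = a * vder p u f + vder p v f.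
Proof.
rewrite vder.unlock /der mulr_sumr -big_split/=; apply: eq_bigr => k _.
by rewrite !mxE mulrDl mulrA.
Qed.

Lemma derZl p a u f : vder p (a *: u) f = a * vder p u f.
Proof.
rewrite vder.unlock /der mulr_sumr; apply: eq_bigr => k _; by rewrite !mxE mulrA.
Qed.

Lemma derDl p u v f : vder p (u + v) f = vder p u f + vder p v f.
Proof. by have := der_lin p 1 u v f; rewrite scale1r mul1r. Qed.

Lemma der0l p f : vder p 0 f = 0.
Proof. by rewrite -[0](scale0r (0 : 'rV[C]_m)) derZl mul0r. Qed.

(** Coordinate functions; they extract the components of tangent vectors
    ([der_xcrd]). *)
Definition xcrd i l q : C := (mf_crd i q 0 l)%:C.

Lemma xcrd_smooth i l p : mf_dom i p -> smooth_at p (xcrd i l).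
Proof.
move=> di j dj; apply/csmP; split=> /=; last exact: rsm_cst.
exact: transition_rsm.
Qed.

Lemma der_xcrd i l p v : mf_dom i p -> vder p v (xcrd i l) = tcoord i p v 0 l.
Proof.
move=> di; rewrite (derE _ di)//; last exact: xcrd_smooth.
rewrite (bigD1 l)//= big1 ?addr0; last first.
  move=> k kl; rewrite (@cpder_eq _ _ k _ (fun x : V => (x 0 l)%:C)).
    by rewrite /cpder/= pder_coord (negPf kl) pder_cst mulr0.
  by apply: filterS (crd_ptK_near di) => x xE; rewrite /xcrd xE.
rewrite (@cpder_eq _ _ l _ (fun x : V => (x 0 l)%:C)).
  by rewrite /cpder/= pder_coord eqxx pder_cst mulr1.
by apply: filterS (crd_ptK_near di) => x xE; rewrite /xcrd xE.
Qed.

End Charts.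

(** * Vector fields and Koszul formulas *)

Section VectorFields.
Variables (R : realType) (m : nat) (M : manifold R m).
Local Notation C := R[i].
Local Notation T := 'rV[C]_m.
Implicit Types (p q : M) (i j : mf_chart M) (k l : 'I_m) (f g : M -> C).
Implicit Types (X Y Z : M -> T) (a b : M -> T -> C).

Lemma vec_smooth_chart i p X : mf_dom i p ->
  (forall l, smooth_at p (fun q => tcoord i q (X q) 0 l)) -> vec_smooth_at p X.
Proof.
move=> di sX j dj l.
apply: (@smooth_at_eq _ _ _ p (fun q => \sum_k tcoord i q (X q) 0 k * cjac i j q k l)).
  by apply: filterS2 (dom_near di) (dom_near dj) => q diq djq; rewrite (tcoord_trans _ diq djq) mxE.
by apply: smooth_at_sum => k; apply: smooth_atM (sX k) (cjac_smooth k l di dj).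
Qed.

Lemma near_all_ord n (P : 'I_n -> M -> Prop) p :
  (forall c, \forall q \near p, P c q) -> \forall q \near p, forall c, P c q.
Proof. exact: filter_forall. Qed.

Lemma vec_smooth_near p X : vec_smooth_at p X -> \forall q \near p, vec_smooth_at q X.
Proof.
move=> sX; have dp := chart_at_dom p.
have : \forall q \near p, forall l, smooth_at q (fun q => tcoord (chart_at p) q (X q) 0 l).
  by apply: near_all_ord => l; exact/smooth_at_near/sX.
by apply: filterS2 (dom_near dp) => q dq; exact: vec_smooth_chart.
Qed.

Lemma vec_smooth_eq p X Y : (\forall q \near p, X q = Y q) ->
  vec_smooth_at p X -> vec_smooth_at p Y.
Proof.
move=> XY sX i di l; apply: smooth_at_eq (sX i di l).
by apply: filterS XY => q ->.
Qed.

Lemma vec_smooth_lin p X Y f g : smooth_at p f -> smooth_at p g ->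
  vec_smooth_at p X -> vec_smooth_at p Y ->
  vec_smooth_at p (fun q => f q *: X q + g q *: Y q).
Proof.
move=> sf sg sX sY i di l.
have := smooth_atD (smooth_atM sf (sX i di l)) (smooth_atM sg (sY i di l)).
by apply: smooth_at_eq; apply: nearW => q; rewrite !tcoordE mulmxDl -!scalemxAl !mxE.
Qed.

Lemma vec_smoothZ p X f : smooth_at p f -> vec_smooth_at p X ->
  vec_smooth_at p (fun q => f q *: X q).
Proof.
move=> sf sX; have := vec_smooth_lin sf (@smooth_at_cst _ _ _ p 0) sX sX.
by apply: vec_smooth_eq; apply: nearW => q; rewrite scale0r addr0.
Qed.

Lemma vec_smoothD p X Y : vec_smooth_at p X -> vec_smooth_at p Y ->
  vec_smooth_at p (fun q => X q + Y q).
Proof.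
move=> sX sY; have s1 := @smooth_at_cst _ _ _ p 1.
have := vec_smooth_lin s1 s1 sX sY.
by apply: vec_smooth_eq; apply: nearW => q; rewrite !scale1r.
Qed.

Lemma vec_smooth0 p : vec_smooth_at p (fun=> 0 : T).
Proof.
move=> i di l; have := @smooth_at_cst _ _ _ p 0.
by apply: smooth_at_eq; apply: nearW => q; rewrite tcoordE mul0mx mxE.
Qed.

Lemma tconst_smooth i p (u : T) : mf_dom i p -> vec_smooth_at p (fun q => tconst i q u).
Proof.
move=> di; apply: (vec_smooth_chart di) => l.
have := @smooth_at_cst _ _ _ p (u 0 l); apply: smooth_at_eq.
by apply: filterS (dom_near di) => q dq; rewrite tconstK.
Qed.

(** Tensorial identities at [p] are tested on these extensions of tangent
    vectors, which are smooth near [p]; being local, they need no partition of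
    unity. *)
Definition vext p (u : T) : M -> T := fun q => tconst (chart_at p) q u.

Lemma vext_smooth p u : vec_smooth_at p (vext p u).
Proof. exact/tconst_smooth/chart_at_dom. Qed.

Lemma vext_id p u : vext p u p = u. Proof. exact: tconst_id. Qed.

Lemma der_smooth p X f : vec_smooth_at p X -> smooth_at p f ->
  smooth_at p (fun q => vder q (X q) f).
Proof.
move=> sX sf; have dp := chart_at_dom p; set c := chart_at p in dp.
apply: (@smooth_at_eq _ _ _ p (fun q => \sum_k tcoord c q (X q) 0 k *
   cpder k (fun y => f (mf_pt c y)) (mf_crd c q))).
  by apply: filterS2 (dom_near dp) (smooth_at_near sf) => q dq sfq; rewrite (derE _ dq sfq).
apply: smooth_at_sum => k; apply: smooth_atM (sX c dp k) _.
apply: (smooth_at_chart dp).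
apply: csm_eq (csm_cpder k (sf c dp)).
by apply: filterS (crd_ptK_near dp) => x ->.
Qed.

(** The second-order terms cancel by the symmetry of second derivatives, and
    the first-order ones are the components of the bracket. *)
Lemma der_lie p X Y f : vec_smooth_at p X -> vec_smooth_at p Y -> smooth_at p f ->
  vder p (vlie X Y p) f =
  vder p (X p) (fun q => vder q (Y q) f) - vder p (Y p) (fun q => vder q (X q) f).
Proof.
move=> sX sY sf; have dp := chart_at_dom p; set c := chart_at p in dp.
pose F k q := cpder k (fun y => f (mf_pt c y)) (mf_crd c q).
have sF k : smooth_at p (F k).
  apply: (smooth_at_chart dp); apply: csm_eq (csm_cpder k (sf c dp)).
  by apply: filterS (crd_ptK_near dp) => x xE; rewrite /F xE.
have derF (u : T) k : vder p u (F k) =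
    \sum_l u 0 l * cpder l (cpder k (fun y => f (mf_pt c y))) (mf_crd c p).
  have FE : \forall x \near mf_crd c p, F k (mf_pt c x) =
      cpder k (fun y => f (mf_pt c y)) x.
    by apply: filterS (crd_ptK_near dp) => x xE; rewrite /F xE.
  by rewrite vder.unlock /der -/c; apply: eq_bigr => l _; rewrite (cpder_eq l FE).
have dd Z W : vec_smooth_at p Z -> vec_smooth_at p W ->
  vder p (W p) (fun q => vder q (Z q) f) =
  \sum_k (vder p (W p) (fun q => tcoord c q (Z q) 0 k) * F k p +
          Z p 0 k * vder p (W p) (F k)).
  move=> sZ sW.
  rewrite (@der_eq _ _ _ p _ _ (fun q => \sum_k tcoord c q (Z q) 0 k * F k q)); last first.
    by apply: filterS2 (dom_near dp) (smooth_at_near sf) => q dq sfq; rewrite (derE _ dq sfq).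
  rewrite der_sum; last by move=> k; exact: smooth_atM (sZ c dp k) (sF k).
  apply: eq_bigr => k _; rewrite derM//; last exact: sZ c dp k.
  by rewrite tcoord_id.
rewrite (dd _ _ sY sX) (dd _ _ sX sY) !big_split/= opprD addrACA -sumrB.
have -> : \sum_k (Y p) 0 k * vder p (X p) (F k) = \sum_k (X p) 0 k * vder p (Y p) (F k).
  under eq_bigr do rewrite derF mulr_sumr.
  rewrite exchange_big/=; apply: eq_bigr => k _; rewrite derF mulr_sumr.
  apply: eq_bigr => l _; rewrite (cpder_comm k l (sf c dp)).
  exact: mulrCA.
rewrite subrr addr0 vlie.unlock [in LHS]vder.unlock; apply: eq_bigr => k _.
by rewrite -mulrBl mxE vder.unlock.
Qed.

(** Coordinate functions separate tangent vectors. With [der_lie], this turns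
    identities between Lie brackets into identities between operators on
    functions. *)
Lemma vec_ext p (u v : T) : (forall f, smooth_at p f -> vder p u f = vder p v f) -> u = v.
Proof.
move=> uv; have dp := chart_at_dom p; apply/rowP => l.
have := uv (xcrd (chart_at p) l) (xcrd_smooth _ dp).
by rewrite !der_xcrd// !tcoord_id.
Qed.

Lemma lie_smooth p X Y : vec_smooth_at p X -> vec_smooth_at p Y -> vec_smooth_at p (vlie X Y).
Proof.
move=> sX sY i di l; have sx := xcrd_smooth l di.
have := smooth_atB (der_smooth sX (der_smooth sY sx)) (der_smooth sY (der_smooth sX sx)).
apply: smooth_at_eq.
apply: filterS3 (dom_near di) (vec_smooth_near sX) (vec_smooth_near sY) => q diq sXq sYq.
by rewrite -der_lie ?der_xcrd//; exact: xcrd_smooth.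
Qed.

Lemma lieC p X Y : vlie X Y p = - vlie Y X p.
Proof. by rewrite ?vlie.unlock; apply/rowP => l; rewrite -?vderE [LHS]mxE [RHS]mxE [in RHS]mxE opprB. Qed.

Lemma lieDr p X Y Z : vec_smooth_at p X -> vec_smooth_at p Y -> vec_smooth_at p Z ->
  vlie X (fun q => Y q + Z q) p = vlie X Y p + vlie X Z p.
Proof.
move=> sX sY sZ; apply: (@vec_ext p) => f sf; rewrite derDl !der_lie//; last exact: vec_smoothD.
rewrite (@der_eq _ _ _ p (X p) _ (fun q => vder q (Y q) f + vder q (Z q) f)); last first.
  by apply: nearW => q; rewrite derDl.
by rewrite derDl derD; [ring|exact: der_smooth|exact: der_smooth].
Qed.

Lemma lieZr p X Y f : vec_smooth_at p X -> vec_smooth_at p Y -> smooth_at p f ->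
  vlie X (fun q => f q *: Y q) p = vder p (X p) f *: Y p + f p *: vlie X Y p.
Proof.
move=> sX sY sf; apply: (@vec_ext p) => g sg.
rewrite der_lie ?derDl ?derZl ?der_lie//; last exact: vec_smoothZ.
rewrite (@der_eq _ _ _ p (X p) _ (fun q => f q * vder q (Y q) g)); last first.
  by apply: nearW => q; rewrite derZl.
rewrite derM//; last exact: der_smooth.
by ring.
Qed.

Lemma lie_jacobi p X Y Z : vec_smooth_at p X -> vec_smooth_at p Y -> vec_smooth_at p Z ->
  vlie X (vlie Y Z) p = vlie (vlie X Y) Z p + vlie Y (vlie X Z) p.
Proof.
move=> sX sY sZ; apply: (@vec_ext p) => f sf.
have step A B D : vec_smooth_at p A -> vec_smooth_at p B -> vec_smooth_at p D ->
    vder p (A p) (fun q => vder q (vlie B D q) f) =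
    vder p (A p) (fun q => vder q (B q) (fun q' => vder q' (D q') f)) -
    vder p (A p) (fun q => vder q (D q) (fun q' => vder q' (B q') f)).
  move=> sA sB sD; rewrite -derB; last 2 first.
  - by apply: der_smooth => //; exact: der_smooth.
  - by apply: der_smooth => //; exact: der_smooth.
  apply: der_eq; apply: filterS3 (vec_smooth_near sB) (vec_smooth_near sD) (smooth_at_near sf).
  by move=> q sBq sDq sfq; rewrite der_lie.
have sXY := lie_smooth sX sY; have sYZ := lie_smooth sY sZ; have sXZ := lie_smooth sX sZ.
rewrite [RHS]derDl (der_lie sX sYZ sf) (der_lie sXY sZ sf) (der_lie sY sXZ sf).
rewrite (step _ _ _ sX sY sZ) (step _ _ _ sZ sX sY) (step _ _ _ sY sX sZ).
have E1 := der_lie sX sY (der_smooth sZ sf).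
have E2 := der_lie sY sZ (der_smooth sX sf).
have E3 := der_lie sX sZ (der_smooth sY sf).
rewrite E1.
rewrite E2.
rewrite E3.
by ring.
Qed.

Definition lin1 p a := linear (a p : T -> C^o).

Lemma lin1P p a x u v : lin1 p a -> a p (x *: u + v) = x * a p u + a p v.
Proof. by move=> ->. Qed.
Lemma lin1D p a u v : lin1 p a -> a p (u + v) = a p u + a p v.
Proof. by move=> la; rewrite -[u]scale1r lin1P// mul1r scale1r. Qed.
Lemma lin1_0 p a : lin1 p a -> a p 0 = 0.
Proof. by move=> la; have := lin1D 0 0 la; rewrite addr0 => /eqP; rewrite -subr_eq subrr eq_sym => /eqP. Qed.
Lemma lin1Z p a x u : lin1 p a -> a p (x *: u) = x * a p u.
Proof. by move=> la; rewrite -[_ *: _]addr0 lin1P// lin1_0// addr0. Qed.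
Lemma lin1N p a u : lin1 p a -> a p (- u) = - a p u.
Proof. by move=> la; rewrite -scaleN1r lin1Z// mulN1r. Qed.
Lemma lin1B p a u v : lin1 p a -> a p (u - v) = a p u - a p v.
Proof. by move=> la; rewrite lin1D// lin1N. Qed.
Lemma lin1_sum p a n (F : 'I_n -> T) : lin1 p a -> a p (\sum_k F k) = \sum_k a p (F k).
Proof.
move=> la; elim: n F => [|n IH] F; first by rewrite !big_ord0 lin1_0.
by rewrite !big_ord_recr/= lin1D// IH.
Qed.

Lemma lin1_chart i q a (u : T) : mf_dom i q -> lin1 q a ->
  a q u = \sum_k tcoord i q u 0 k * a q (tconst i q (delta_mx 0 k)).
Proof.
move=> di la; rewrite -{1}[u](tcoordK _ di) {1}[tcoord i q u]row_sum_delta.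
rewrite tconstE mulmx_suml (lin1_sum _ la); apply: eq_bigr => k _.
by rewrite -scalemxAl lin1Z.
Qed.

Lemma pair_smooth_chart i p a X : mf_dom i p -> (\forall q \near p, lin1 q a) ->
  (forall u, smooth_at p (fun q => a q (tconst i q u))) -> vec_smooth_at p X ->
  smooth_at p (fun q => a q (X q)).
Proof.
move=> di la sa sX.
apply: (@smooth_at_eq _ _ _ p
  (fun q => \sum_k tcoord i q (X q) 0 k * a q (tconst i q (delta_mx 0 k)))).
  by apply: filterS2 (dom_near di) la => q dq laq; rewrite -lin1_chart.
by apply: smooth_at_sum => k; exact: smooth_atM (sX i di k) (sa _).
Qed.

Lemma form1_smooth_chart i p a : mf_dom i p -> (\forall q \near p, lin1 q a) ->
  (forall u, smooth_at p (fun q => a q (tconst i q u))) -> form1_smooth_at p a.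
Proof.
move=> di la sa j dj u; apply: (pair_smooth_chart di la sa).
exact: tconst_smooth.
Qed.

(** Germs of 1-forms. Linearity is required near [p], so that the pairing with
    a vector field can be expanded in the frame of a chart. *)
Record form1_at p a : Prop := Form1At {
  form1_lin : \forall q \near p, lin1 q a;
  form1_sm : form1_smooth_at p a }.

Lemma form1_smooth_fields p a : (\forall q \near p, lin1 q a) ->
  (forall X, vec_smooth_at p X -> smooth_at p (fun q => a q (X q))) -> form1_at p a.
Proof.
by move=> la sa; split=> // i di u; apply/sa/tconst_smooth.
Qed.

Lemma pair_smooth p a X : form1_at p a -> vec_smooth_at p X ->
  smooth_at p (fun q => a q (X q)).
Proof.
move=> [la sa]; have dp := chart_at_dom p.
by apply: (pair_smooth_chart dp la) => u; exact: sa.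
Qed.

Lemma form1_near p a : form1_at p a -> \forall q \near p, form1_at q a.
Proof.
move=> [la sa]; have dp := chart_at_dom p.
have : \forall q \near p, forall k : 'I_m,
    smooth_at q (fun q' => a q' (tconst (chart_at p) q' (delta_mx 0 k))).
  by apply: near_all_ord => k; apply: smooth_at_near; exact: sa.
apply: filterS3 (near_join la) (dom_near dp) => q laq dq saq; split=> //.
apply: (form1_smooth_chart dq laq) => u.
apply: (@smooth_at_eq _ _ _ q
  (fun q' => \sum_k u 0 k * a q' (tconst (chart_at p) q' (delta_mx 0 k)))).
  apply: filterS2 (dom_near dq) laq => q' dq' laq'.
  by rewrite (lin1_chart (tconst _ _ u) dq' laq') tconstK.
by apply: smooth_at_sum => k; exact: smooth_atM (@smooth_at_cst _ _ _ q _) (saq k).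
Qed.

(** The flat derivative of [Y] in the chart at [p]. Its skew-symmetrization is
    the Lie bracket ([lieE]), and [d1], [d3] are defined with fields whose
    flat derivative vanishes. *)
Definition cder p (u : T) Y : T := \row_l vder p u (fun q => tcoord (chart_at p) q (Y q) 0 l).

Lemma lieE p X Y : vlie X Y p = cder p (X p) Y - cder p (Y p) X.
Proof.
rewrite vlieE /lie -vderE; apply/rowP => l.
rewrite [LHS]mxE [RHS]mxE [cder p (X p) Y 0 l]mxE [(- cder _ _ _) 0 l]mxE.
by rewrite [cder p (Y p) X 0 l]mxE.
Qed.

(** Product rule for the pairing: replacing [Y] by its flat extension costs
    the value of [a] on the flat derivative of [Y]. *)
Lemma der_pair p a (u : T) Y : form1_at p a -> vec_smooth_at p Y ->
  vder p u (fun q => a q (Y q)) =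
  vder p u (fun q => a q (vext p (Y p) q)) + a p (cder p u Y).
Proof.
move=> fa sY; have dp := chart_at_dom p; set c := chart_at p in dp.
have [la _] := fa.
have sd k : smooth_at p (fun q => a q (tconst c q (delta_mx 0 k))).
  by apply: (pair_smooth fa); exact: tconst_smooth.
rewrite (@der_eq _ _ _ p u _
  (fun q => \sum_k tcoord c q (Y q) 0 k * a q (tconst c q (delta_mx 0 k)))); last first.
  by apply: filterS2 (dom_near dp) la => q dq laq; rewrite -lin1_chart.
rewrite [in RHS](@der_eq _ _ _ p u _
  (fun q => \sum_k (Y p) 0 k * a q (tconst c q (delta_mx 0 k)))); last first.
  apply: filterS2 (dom_near dp) la => q dq laq.
  by rewrite (lin1_chart (vext _ _ q) dq laq) tconstK.
have s1 k := smooth_atM (sY c dp k) (sd k).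
have s2 k := smooth_atM (@smooth_at_cst _ _ M p (Y p 0 k)) (sd k).
rewrite (der_sum u s1) (der_sum u s2).
rewrite (lin1_chart (cder p u Y) dp (nbhs_singleton la)) -big_split/=.
apply: eq_bigr => k _.
rewrite (derM u (sY c dp k) (sd k)) (derM u (@smooth_at_cst _ _ M p (Y p 0 k)) (sd k)).
by rewrite der_cst mul0r add0r !tcoord_id mxE addrC.
Qed.

(** The flat derivatives produced by [der_pair] assemble into the bracket. *)
Lemma d1_koszul p a Y Z : form1_at p a -> vec_smooth_at p Y -> vec_smooth_at p Z ->
  d1 a p (Y p) (Z p) =
  vder p (Y p) (fun q => a q (Z q)) - vder p (Z p) (fun q => a q (Y q)) - a p (vlie Y Z p).
Proof.
move=> fa sY sZ; rewrite (der_pair (Y p) fa sZ) (der_pair (Z p) fa sY) lieE.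
rewrite lin1B; last exact: nbhs_singleton (form1_lin fa).
by rewrite /d1/= /vext -vderE; ring.
Qed.

End VectorFields.

Section ThreeForms.
Variables (R : realType) (m : nat) (M : manifold R m).
Local Notation C := R[i].
Local Notation T := 'rV[C]_m.
Variables (h : form3 M) (hh : is_form3 h).
Implicit Types (p q : M) (X Y Z W : M -> T) (u v w x : T).

Lemma form3_D1 p u u' v w : h p (u + u') v w = h p u v w + h p u' v w.
Proof. exact: (@lin1D _ _ _ p (fun q x => h q x v w) u u' (form3_linear1 hh p v w)). Qed.
Lemma form3_D2 p u v v' w : h p u (v + v') w = h p u v w + h p u v' w.
Proof. exact: (@lin1D _ _ _ p (fun q x => h q u x w) v v' (form3_linear2 hh p u w)). Qed.
Lemma form3_D3 p u v w w' : h p u v (w + w') = h p u v w + h p u v w'.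
Proof. exact: (@lin1D _ _ _ p (fun q x => h q u v x) w w' (form3_linear3 hh p u v)). Qed.
Lemma form3_N1 p u v w : h p (- u) v w = - h p u v w.
Proof. exact: (@lin1N _ _ _ p (fun q x => h q x v w) u (form3_linear1 hh p v w)). Qed.
Lemma form3_Z2 p c u v w : h p u (c *: v) w = c * h p u v w.
Proof. exact: (@lin1Z _ _ _ p (fun q x => h q u x w) c v (form3_linear2 hh p u w)). Qed.
Lemma form3_Z3 p c u v w : h p u v (c *: w) = c * h p u v w.
Proof. exact: (@lin1Z _ _ _ p (fun q x => h q u v x) c w (form3_linear3 hh p u v)). Qed.

Lemma form3_swap12 p u v w : h p u v w = - h p v u w.
Proof.
have := form3_alt12 hh p (u + v) w.
rewrite form3_D1 !form3_D2 !(form3_alt12 hh) add0r addr0 => /eqP.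
by rewrite addr_eq0 => /eqP.
Qed.

Lemma form3_swap23 p u v w : h p u v w = - h p u w v.
Proof.
have := form3_alt23 hh p u (v + w).
rewrite form3_D2 !form3_D3 !(form3_alt23 hh) add0r addr0 => /eqP.
by rewrite addr_eq0 => /eqP.
Qed.

Lemma form3_rot p u v w : h p u v w = h p w u v.
Proof. by rewrite form3_swap23 form3_swap12 opprK. Qed.

(** Expand one argument after the other in the frame of the chart at [p]. *)
Lemma form3_smooth_fields p X Y Z : vec_smooth_at p X -> vec_smooth_at p Y ->
  vec_smooth_at p Z -> smooth_at p (fun q => h q (X q) (Y q) (Z q)).
Proof.
move=> sX sY sZ; have dp := chart_at_dom p; set c := chart_at p in dp.
have s3 u v : smooth_at p (fun q => h q (tconst c q u) (tconst c q v) (Z q)).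
  apply: (@pair_smooth_chart _ _ _ c p
    (fun q x => h q (tconst c q u) (tconst c q v) x) Z) => //.
    by apply: nearW => q; exact: (form3_linear3 hh).
  by move=> w; exact: (form3_smooth hh).
have s2 u : smooth_at p (fun q => h q (tconst c q u) (Y q) (Z q)).
  apply: (@pair_smooth_chart _ _ _ c p
    (fun q x => h q (tconst c q u) x (Z q)) Y) => //.
  by apply: nearW => q; exact: (form3_linear2 hh).
apply: (@pair_smooth_chart _ _ _ c p (fun q x => h q x (Y q) (Z q)) X) => //.
by apply: nearW => q; exact: (form3_linear1 hh).
Qed.

(** [der_pair] in each of the three arguments; the signs come from moving the
    flat derivative to the first place. *)
Lemma der_form3 p u X Y Z : vec_smooth_at p X -> vec_smooth_at p Y ->
  vec_smooth_at p Z ->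
  vder p u (fun q => h q (X q) (Y q) (Z q)) =
  vder p u (fun q => h q (vext p (X p) q) (vext p (Y p) q) (vext p (Z p) q)) +
  h p (cder p u X) (Y p) (Z p) - h p (cder p u Y) (X p) (Z p) +
  h p (cder p u Z) (X p) (Y p).
Proof.
move=> sX sY sZ.
have f1 : form1_at p (fun q x => h q x (Y q) (Z q)).
  apply: form1_smooth_fields; first by apply: nearW => q; exact: (form3_linear1 hh).
  by move=> X' sX'; exact: form3_smooth_fields.
have eX := @vext_smooth _ _ _ p (X p); have eY := @vext_smooth _ _ _ p (Y p).
have f2 : form1_at p (fun q x => h q (vext p (X p) q) x (Z q)).
  apply: form1_smooth_fields; first by apply: nearW => q; exact: (form3_linear2 hh).
  by move=> X' sX'; exact: form3_smooth_fields.
have f3 : form1_at p (fun q x => h q (vext p (X p) q) (vext p (Y p) q) x).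
  apply: form1_smooth_fields; first by apply: nearW => q; exact: (form3_linear3 hh).
  by move=> X' sX'; exact: form3_smooth_fields.
rewrite (der_pair u f1 sX) (der_pair u f2 sY) (der_pair u f3 sZ) !vext_id.
rewrite (form3_swap12 p (X p) (cder p u Y)) (form3_rot p (X p) (Y p)).
by ring.
Qed.

(** As for 1-forms, the flat derivatives of [der_form3] assemble into the six
    brackets. *)
Lemma d3_koszul p X Y Z W : vec_smooth_at p X -> vec_smooth_at p Y ->
  vec_smooth_at p Z -> vec_smooth_at p W ->
  d3 h p (X p) (Y p) (Z p) (W p) =
    vder p (X p) (fun q => h q (Y q) (Z q) (W q))
  - vder p (Y p) (fun q => h q (X q) (Z q) (W q))
  + vder p (Z p) (fun q => h q (X q) (Y q) (W q))
  - vder p (W p) (fun q => h q (X q) (Y q) (Z q))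
  - h p (vlie X Y p) (Z p) (W p) + h p (vlie X Z p) (Y p) (W p)
  - h p (vlie X W p) (Y p) (Z p) - h p (vlie Y Z p) (X p) (W p)
  + h p (vlie Y W p) (X p) (Z p) - h p (vlie Z W p) (X p) (Y p).
Proof.
move=> sX sY sZ sW.
rewrite !lieE !form3_D1 !form3_N1.
rewrite (der_form3 (X p) sY sZ sW) (der_form3 (Y p) sX sZ sW).
rewrite (der_form3 (Z p) sX sY sW) (der_form3 (W p) sX sY sZ).
by rewrite /d3 /= -vderE /vext; ring.
Qed.

End ThreeForms.

(** * The projections onto the types of vectors *)

Section ComplexStructure.
Variables (R : realType) (n : nat).
Local Notation C := R[i].
Local Notation T := 'rV[C]_(n + n).
Implicit Types (A : algebroid) (u v : T).

Local Notation J := (Jmx C n).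

Lemma Jmx_sqr : J *m J = - 1%:M.
Proof.
rewrite /Jmx mulmx_block !mul0mx !mulmx0 !mul1mx !mulmx1 !add0r !addr0.
by rewrite (scalar_mx_block n n 1) opp_block_mx !oppr0.
Qed.

Lemma sqr_im : 'i * 'i = -1 :> C. Proof. by rewrite -expr2 sqr_i. Qed.

(** The matrix of [apr A]: it has constant coefficients in every chart. *)
Definition amx A : 'M[C]_(n + n) :=
  match A with
  | Full => 1%:M
  | Holo => 2^-1 *: (1%:M - 'i *: J)
  | Anti => 2^-1 *: (1%:M + 'i *: J)
  end.

Lemma aprE A v : apr A v = v *m amx A.
Proof.
case: A; rewrite /apr /amx; first by rewrite mulmx1.
- by rewrite -scalemxAr mulmxBr mulmx1 -scalemxAr.
- by rewrite -scalemxAr mulmxDr mulmx1 -scalemxAr.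
Qed.

Lemma apr_lin A c u v : apr A (c *: u + v) = c *: apr A u + apr A v.
Proof. by rewrite !aprE mulmxDl -scalemxAl. Qed.
Lemma aprD A u v : apr A (u + v) = apr A u + apr A v.
Proof. by rewrite !aprE mulmxDl. Qed.
Lemma aprN A u : apr A (- u) = - apr A u.
Proof. by rewrite !aprE mulNmx. Qed.
Lemma aprZ A c u : apr A (c *: u) = c *: apr A u.
Proof. by rewrite !aprE -scalemxAl. Qed.
Lemma apr0 A : apr A (0 : T) = 0.
Proof. by rewrite aprE mul0mx. Qed.

Lemma two_neq0 : (2 : C) != 0. Proof. by rewrite pnatr_eq0. Qed.

Lemma half_addxx (V : lmodType C) (w : V) : 2^-1 *: (w + w) = w.
Proof.
have -> : w + w = (2 : C) *: w by rewrite scaler_nat mulr2n.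
by rewrite scalerA mulVf ?scale1r//; exact: two_neq0.
Qed.

Section Eigenprojection.
Variables (c : C) (cc : c * c = - 1).

(** Since [J *m J = - 1], the map [v |-> (v - c v J) / 2] projects onto the
    eigenspace of [J] for the eigenvalue [c]. *)
Lemma eigenprojP v : v *m J = c *: v <-> 2^-1 *: (v - c *: (v *m J)) = v.
Proof.
split=> [->|E].
  by rewrite scalerA cc scaleN1r opprK half_addxx.
have {}E : v - c *: (v *m J) = v + v.
  by rewrite -[in RHS]E -scalerDr half_addxx.
have {}E : - (c *: (v *m J)) = v by apply: (addrI v).
by rewrite -[in RHS]E scalerN scalerA cc scaleN1r opprK.
Qed.

Lemma eigenproj_eigen v :
  (2^-1 *: (v - c *: (v *m J))) *m J = c *: (2^-1 *: (v - c *: (v *m J))).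
Proof.
rewrite -scalemxAl scalerA mulrC -scalerA; congr (_ *: _).
rewrite mulmxBl -scalemxAl -mulmxA Jmx_sqr mulmxN mulmx1 scalerN opprK.
by rewrite scalerBr scalerA cc scaleN1r opprK addrC.
Qed.
End Eigenprojection.

Lemma sqr_Nim : (- 'i) * (- 'i) = -1 :> C. Proof. by rewrite mulrNN sqr_im. Qed.

Lemma aprAntiE v : apr Anti v = 2^-1 *: (v - (- 'i) *: (v *m J)).
Proof. by rewrite /apr scaleNr opprK. Qed.

Lemma afibP A v : afib A v <-> apr A v = v.
Proof.
case: A; [by []|exact: (eigenprojP sqr_im)|rewrite aprAntiE; exact: (eigenprojP sqr_Nim)].
Qed.

Lemma afib_apr A v : afib A (apr A v).
Proof.
case: A; [by []|exact: (eigenproj_eigen sqr_im)|rewrite aprAntiE; exact: (eigenproj_eigen sqr_Nim)].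
Qed.

Lemma apr_id A v : afib A v -> apr A v = v. Proof. by move/afibP. Qed.

Lemma aprK A v : apr A (apr A v) = apr A v.
Proof. exact/apr_id/afib_apr. Qed.

Lemma amx_idem A : amx A *m amx A = amx A.
Proof. by apply/row_matrixP => i; rewrite row_mul !rowE -!aprE aprK. Qed.

(** Complex conjugation of types; together with [A], it decomposes the
    complexified tangent bundle unless [A] is [Full]. *)
Definition conj_type A := match A with Full => Full | Holo => Anti | Anti => Holo end.

Lemma apr_sum A v : A <> Full -> apr A v + apr (conj_type A) v = v.
Proof.
have H : apr Holo v + apr Anti v = v.
  by rewrite /= -scalerDr addrACA addNr addr0 half_addxx.
by case: A => //= _; rewrite addrC.
Qed.

Lemma afib_lin A c u v : afib A u -> afib A v -> afib A (c *: u + v).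
Proof. by move=> /afibP uA /afibP vA; apply/afibP; rewrite apr_lin uA vA. Qed.

Lemma apr_conj A v : A <> Full -> apr A (apr (conj_type A) v) = 0.
Proof.
move=> AF; apply: (addrI (apr A v)).
by rewrite addr0 -[X in X + _]aprK -aprD apr_sum.
Qed.

End ComplexStructure.

(** * Local sections of [A] and of [A + A*] *)

Section TypedSections.
Variables (R : realType) (n : nat) (X : complex_manifold R n).
Local Notation C := R[i].
Local Notation T := 'rV[C]_(n + n).
Local Notation G := (T * (T -> C^o))%type.
Implicit Types (p q : X) (A : algebroid) (Y Z U W : X -> T) (s t r : X -> G).
Implicit Types (a : X -> T -> C).

Lemma map_Jmx : map_mx (real_complex R) (Jmx R n) = Jmx C n.
Proof. by rewrite /Jmx map_block_mx map_mx0 map_mxN map_mx1. Qed.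

(** The Cauchy-Riemann equations: Jacobians commute with [J], hence with the
    projections. *)
Lemma amx_cjac A (i j : mf_chart X) p : mf_dom i p -> mf_dom j p ->
  cjac i j p *m amx R n A = amx R n A *m cjac i j p.
Proof.
move=> di dj; have JC : cjac i j p *m Jmx C n = Jmx C n *m cjac i j p.
  by rewrite -map_Jmx -!map_mxM (cm_holomorphic di dj).
case: A; rewrite /amx; first by rewrite mulmx1 mul1mx.
  by rewrite -scalemxAr -scalemxAl mulmxBr mulmxBl mulmx1 mul1mx -scalemxAr -scalemxAl JC.
by rewrite -scalemxAr -scalemxAl mulmxDr mulmxDl mulmx1 mul1mx -scalemxAr -scalemxAl JC.
Qed.

Lemma apr_tcoord A (i : mf_chart X) q v : mf_dom i q ->
  tcoord i q (apr A v) = apr A (tcoord i q v).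
Proof.
by move=> di; rewrite !aprE !tcoordE -!mulmxA (amx_cjac A (chart_at_dom q) di).
Qed.

Lemma apr_tconst A (i : mf_chart X) q v : mf_dom i q ->
  tconst i q (apr A v) = apr A (tconst i q v).
Proof.
by move=> di; rewrite !aprE !tconstE -!mulmxA (amx_cjac A di (chart_at_dom q)).
Qed.

Lemma apr_smooth A p Y : vec_smooth_at p Y -> vec_smooth_at p (fun q => apr A (Y q)).
Proof.
move=> sY i di l.
apply: (@smooth_at_eq _ _ _ p (fun q => \sum_k tcoord i q (Y q) 0 k * amx R n A k l)).
  by apply: filterS (dom_near di) => q dq; rewrite apr_tcoord// aprE mxE.
by apply: smooth_at_sum => k; exact: smooth_atM (sY i di k) (@smooth_at_cst _ _ _ p _).
Qed.

(** The projection has constant coefficients in the chart, so it commutes with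
    the flat derivative. *)
Lemma cder_apr A p u Y : vec_smooth_at p Y ->
  cder p u (fun q => apr A (Y q)) = apr A (cder p u Y).
Proof.
move=> sY; have dp := chart_at_dom p; set c := chart_at p in dp.
apply/rowP => l; rewrite aprE [LHS]mxE [RHS]mxE.
rewrite (@der_eq _ _ _ p u _ (fun q => \sum_k tcoord c q (Y q) 0 k * amx R n A k l)); last first.
  by apply: filterS (dom_near dp) => q dq; rewrite apr_tcoord// aprE mxE.
have s1 k := smooth_atM (sY c dp k) (@smooth_at_cst _ _ X p (amx R n A k l)).
rewrite (der_sum u s1); apply: eq_bigr => k _.
rewrite (derM u (sY c dp k) (@smooth_at_cst _ _ X p (amx R n A k l))) der_cst mulr0 addr0.
by rewrite mxE.
Qed.

Lemma cder_eq p u Y Z : (\forall q \near p, Y q = Z q) -> cder p u Y = cder p u Z.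
Proof.
move=> YZ; apply/rowP => l; rewrite [LHS]mxE [RHS]mxE; apply: der_eq.
by apply: filterS YZ => q ->.
Qed.

(** Germs at [p] of smooth sections of the subbundle [A] of the complexified
    tangent bundle. *)
Definition asec A p Y := vec_smooth_at p Y /\ \forall q \near p, apr A (Y q) = Y q.

Lemma asec_at A p Y : asec A p Y -> apr A (Y p) = Y p.
Proof. by move=> [_ /nbhs_singleton]. Qed.

Lemma asec_near A p Y : asec A p Y -> \forall q \near p, asec A q Y.
Proof.
move=> [sY aY]; apply: filterS2 (vec_smooth_near sY) (near_join aY) => q; exact: conj.
Qed.

Lemma asec_eq A p Y Z : (\forall q \near p, Y q = Z q) -> asec A p Y -> asec A p Z.
Proof.
move=> YZ [sY aY]; split; first exact: vec_smooth_eq YZ sY.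
by apply: filterS2 YZ aY => q ->.
Qed.

Lemma asec_apr A p Y : vec_smooth_at p Y -> asec A p (fun q => apr A (Y q)).
Proof.
by move=> sY; split; [exact: apr_smooth|apply: nearW => q; exact: aprK].
Qed.

Lemma asec_vext A p u : afib A u -> asec A p (vext p u).
Proof.
move=> /apr_id uA; split; first exact: vext_smooth.
apply: filterS (dom_near (chart_at_dom p)) => q dq.
by rewrite /vext -apr_tconst// uA.
Qed.

(** Integrability of [A]: the flat derivative of a section of [A] is again in
    [A]. *)
Lemma asec_lie A p Y Z : asec A p Y -> asec A p Z -> asec A p (vlie Y Z).
Proof.
move=> sY sZ; split; first exact: lie_smooth (proj1 sY) (proj1 sZ).
apply: filterS2 (asec_near sY) (asec_near sZ) => q [vY aY] [vZ aZ].
rewrite lieE aprD aprN -!cder_apr//.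
by rewrite (cder_eq (Y q) aZ) (cder_eq (Z q) aY).
Qed.

Local Notation gsm A p s := (@vb_smooth _ _ _ (gtb X A) p s).

Lemma gsm_asec A p s : gsm A p s -> asec A p (fun q => (s q).1).
Proof.
by move=> [fs vs _]; split=> //; apply: filterS fs => q [/apr_id].
Qed.

Lemma gsm_form A p s : gsm A p s -> form1_at p (fun q => (s q).2).
Proof. by move=> [fs _ ss]; split=> //; apply: filterS fs => q []. Qed.

Lemma gsm_factor A p s : gsm A p s ->
  \forall q \near p, forall v, (s q).2 (apr A v) = (s q).2 v.
Proof. by move=> [fs _ _]; apply: filterS fs => q []. Qed.

Lemma gsm_intro A p s : asec A p (fun q => (s q).1) ->
  form1_at p (fun q => (s q).2) ->
  (\forall q \near p, forall v, (s q).2 (apr A v) = (s q).2 v) -> gsm A p s.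
Proof.
move=> [vs as_] [ls ss] fs; split=> //.
by apply: filterS3 as_ ls fs => q aq lq fq; split=> //; exact/afibP.
Qed.

Lemma gsm_near A p s : gsm A p s -> \forall q \near p, gsm A q s.
Proof.
move=> ss; apply: filterS3 (asec_near (gsm_asec ss)) (form1_near (gsm_form ss))
  (near_join (gsm_factor ss)) => q; exact: gsm_intro.
Qed.

Lemma gsm_eq A p s t : (\forall q \near p, s q = t q) -> gsm A p s -> gsm A p t.
Proof.
move=> st [fs vs ss]; split.
- by apply: filterS2 st fs => q ->.
- by apply: vec_smooth_eq vs; apply: filterS st => q ->.
- move=> i di u; apply: smooth_at_eq (ss i di u).
  by apply: filterS st => q ->.
Qed.

End TypedSections.

Notation gsm X A p s := (@vb_smooth _ _ _ (gtb X A) p s).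

(** * The twisted bracket and its Jacobi identity *)

(** Opaque copy of the bracket of [twisted A h], accessible through its vector
    part [tbr1] and its form part [tbr2]. *)
HB.lock Definition tbr (R : realType) (n : nat) (X : complex_manifold R n)
    (A : algebroid) (h : form3 X) :
    let G := ('rV[R[i]]_(n + n) * ('rV[R[i]]_(n + n) -> R[i]^o))%type in
    (X -> G) -> (X -> G) -> X -> G := @ca_br _ _ _ (twisted A h).

Arguments tbr {R n X} A h s t p.

Section TwistedBracket.
Variables (R : realType) (n : nat) (X : complex_manifold R n) (A : algebroid).
Local Notation C := R[i].
Local Notation T := 'rV[C]_(n + n).
Local Notation G := (T * (T -> C^o))%type.
Implicit Types (p q : X) (Y Z U W : X -> T) (s t r : X -> G).
Variables (h : form3 X) (hh : is_form3 h).

Lemma tbrE : tbr A h = @ca_br _ _ _ (twisted A h). Proof. by rewrite tbr.unlock. Qed.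

Lemma tbr1 s t p : (tbr A h s t p).1 = vlie (fun q => (s q).1) (fun q => (t q).1) p.
Proof. by rewrite tbrE vlieE. Qed.

(** On a local section of [A] the projections in [d_A] disappear, and the
    Koszul formula leaves only derivatives of functions and brackets of vector
    fields. The three algebroids can thus be treated at once. *)
Lemma tbr2 s t p U : gsm X A p s -> gsm X A p t -> asec A p U ->
  (tbr A h s t p).2 (U p) =
    vder p (s p).1 (fun q => (t q).2 (U q)) - (t p).2 (vlie (fun q => (s q).1) U p)
  - vder p (t p).1 (fun q => (s q).2 (U q)) + vder p (U p) (fun q => (s q).2 (t q).1)
  + (s p).2 (vlie (fun q => (t q).1) U p) + h p (s p).1 (t p).1 (U p).
Proof.
move=> ss st sU; rewrite tbrE/= /lieA /dA1 /dA0 -vderE.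
rewrite (asec_at sU) (asec_at (gsm_asec ss)) (asec_at (gsm_asec st)).
rewrite (d1_koszul (gsm_form st) (proj1 (gsm_asec ss)) (proj1 sU)).
rewrite (d1_koszul (gsm_form ss) (proj1 (gsm_asec st)) (proj1 sU)).
by ring.
Qed.

End TwistedBracket.

Section TwistedJacobi.
Variables (R : realType) (n : nat) (X : complex_manifold R n) (A : algebroid).
Local Notation C := R[i].
Local Notation T := 'rV[C]_(n + n).
Local Notation G := (T * (T -> C^o))%type.
Implicit Types (p q : X) (Y Z U W : X -> T) (s t r : X -> G).
Variables (h : form3 X) (hh : is_form3 h).
Hypothesis h_typed : forall p u v w, afib A u -> afib A v ->
  h p u v (apr A w) = h p u v w.

Local Notation br := (tbr A h).

Lemma d1_linr p (a : X -> T -> C) u x v w : form1_at p a ->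
  d1 a p u (x *: v + w) = x * d1 a p u v + d1 a p u w.
Proof.
move=> fa; rewrite /d1 -vderE der_lin.
have sv v' := pair_smooth fa (tconst_smooth v' (chart_at_dom p)).
have sc := @smooth_at_cst _ _ X p x.
rewrite (@der_eq _ _ _ p u _ (fun q => x * a q (tconst (chart_at p) q v)
   + a q (tconst (chart_at p) q w))); last first.
  apply: filterS (form1_lin fa) => q la.
  by rewrite !tconstE mulmxDl -scalemxAl lin1P.
rewrite (derD _ (smooth_atM sc (sv v)) (sv w)) (derM _ sc (sv v)) der_cst.
by ring.
Qed.

Lemma tbr_factor s t p v : gsm X A p s -> gsm X A p t ->
  ((br s t) p).2 (apr A v) = ((br s t) p).2 v.
Proof.
move=> ss st; rewrite tbrE/= /lieA /dA1 /dA0 aprK h_typed//; apply/afibP.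
  exact: asec_at (gsm_asec ss).
exact: asec_at (gsm_asec st).
Qed.

Lemma tbr_lin s t p : gsm X A p s -> gsm X A p t -> linear ((br s t) p).2.
Proof.
move=> ss st x u v.
have E w : ((br s t) p).2 w = d1 (fun q => (t q).2) p (apr A (s p).1) (apr A w) +
    vder p (apr A w) (fun q => (t q).2 (s q).1) -
    d1 (fun q => (s q).2) p (apr A (t p).1) (apr A w) + h p (s p).1 (t p).1 w :> C.
  by rewrite tbrE vderE.
rewrite !E !apr_lin !(d1_linr _ _ _ _ (gsm_form ss)) !(d1_linr _ _ _ _ (gsm_form st)) der_lin.
rewrite (form3_D3 hh) (form3_Z3 hh).
have ringE (a b c d a' b' c' d' : C) : x * a + a' + (x * b + b') - (x * c + c') + (x * d + d')
  = x * (a + b - c + d) + (a' + b' - c' + d') by ring.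
exact: ringE.
Qed.

Lemma gsm_pair s p U : gsm X A p s -> vec_smooth_at p U -> smooth_at p (fun q => (s q).2 (U q)).
Proof. by move=> ss sU; exact: pair_smooth (gsm_form ss) sU. Qed.

Lemma gsm_vec s p : gsm X A p s -> vec_smooth_at p (fun q => (s q).1).
Proof. by move=> ss; exact: (proj1 (gsm_asec ss)). Qed.

(** The formula [tbr2], read on nearby points, exhibits the values of the form
    part as smooth functions. *)
Lemma tbr_gsm s t p : gsm X A p s -> gsm X A p t -> gsm X A p (br s t).
Proof.
move=> ss st; have ns := gsm_near ss; have nt := gsm_near st.
have vs := gsm_vec ss; have vt := gsm_vec st.
apply: gsm_intro.
- have := asec_lie (gsm_asec ss) (gsm_asec st); apply: asec_eq.
  by apply: nearW => q; rewrite tbr1.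
- apply: form1_smooth_fields.
    by apply: filterS2 ns nt => q sq tq; exact: tbr_lin.
  move=> U0 sU0; have sU := @asec_apr _ _ _ A _ _ sU0.
  set U := (fun q => apr A (U0 q)) in sU; have vU := proj1 sU.
  have lsU := lie_smooth vs vU; have ltU := lie_smooth vt vU.
  have := form3_smooth_fields hh vs vt vU.
  move=> /(smooth_atD (gsm_pair ss ltU)).
  move=> /(smooth_atD (der_smooth vU (gsm_pair ss vt))).
  move=> /(smooth_atB (der_smooth vt (gsm_pair ss vU))).
  move=> /(smooth_atD (gsm_pair st lsU)).
  move=> /(smooth_atB (der_smooth vs (gsm_pair st vU))).
  apply: smooth_at_eq; apply: filterS3 ns nt (asec_near sU) => q sq tq Uq.
  by rewrite -(tbr_factor (U0 q) sq tq) (tbr2 h sq tq Uq); ring.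
- by apply: filterS2 ns nt => q sq tq v; exact: tbr_factor.
Qed.

Lemma der_tbr s t p u U : gsm X A p s -> gsm X A p t -> asec A p U ->
  vder p u (fun q => ((br s t) q).2 (U q)) =
    vder p u (fun q => vder q (s q).1 (fun q' => (t q').2 (U q')))
  - vder p u (fun q => (t q).2 (vlie (fun q => (s q).1) U q))
  - vder p u (fun q => vder q (t q).1 (fun q' => (s q').2 (U q')))
  + vder p u (fun q => vder q (U q) (fun q' => (s q').2 (t q').1))
  + vder p u (fun q => (s q).2 (vlie (fun q => (t q).1) U q))
  + vder p u (fun q => h q (s q).1 (t q).1 (U q)).
Proof.
move=> ss st sU; have vU := proj1 sU.
have vs := gsm_vec ss; have vt := gsm_vec st.
have lsU := lie_smooth vs vU; have ltU := lie_smooth vt vU.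
have s1 := der_smooth vs (gsm_pair st vU).
have s2 := gsm_pair st lsU.
have s3 := der_smooth vt (gsm_pair ss vU).
have s4 := der_smooth vU (gsm_pair ss vt).
have s5 := gsm_pair ss ltU.
have s6 := form3_smooth_fields hh vs vt vU.
have s12 := smooth_atB s1 s2; have s13 := smooth_atB s12 s3.
have s14 := smooth_atD s13 s4; have s15 := smooth_atD s14 s5.
rewrite -(derB u s1 s2) -(derB u s12 s3) -(derD u s13 s4) -(derD u s14 s5) -(derD u s15 s6).
apply: der_eq; apply: filterS3 (gsm_near ss) (gsm_near st) (asec_near sU) => q sq tq Uq.
exact: tbr2.
Qed.

(** After expansion by [tbr2], the terms with two derivatives cancel by
    [der_lie] and those with iterated brackets by [lie_jacobi]; the remaining
    terms, all in [h], are the Koszul formula for [d3 h = 0]. *)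
Lemma tbr_jacobi2 s t r p U :
  (forall p u v w x, afib A u -> afib A v -> afib A w -> afib A x -> d3 h p u v w x = 0) ->
  gsm X A p s -> gsm X A p t -> gsm X A p r -> asec A p U ->
  ((br s (br t r)) p).2 (U p) = ((br (br s t) r) p).2 (U p) + ((br t (br s r)) p).2 (U p).
Proof.
move=> closed ss st sr sU; have vU := proj1 sU.
have vs := gsm_vec ss; have vt := gsm_vec st; have vr := gsm_vec sr.
have as_ := gsm_asec ss; have at_ := gsm_asec st; have ar := gsm_asec sr.
have str := tbr_gsm st sr; have sst := tbr_gsm ss st; have ssr := tbr_gsm ss sr.
have asU := asec_lie as_ sU; have atU := asec_lie at_ sU; have arU := asec_lie ar sU.
rewrite (tbr2 h ss str sU) (tbr2 h sst sr sU) (tbr2 h st ssr sU).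
rewrite (der_tbr _ st sr sU) (der_tbr _ ss st sU) (der_tbr _ ss sr sU).
rewrite (der_tbr _ ss st ar).
rewrite (tbr2 h st sr asU) (tbr2 h ss st arU) (tbr2 h ss sr atU).
rewrite !tbr1.
have fst1 s1 s2 : (fun q => ((br s1 s2) q).1) = vlie (fun q => (s1 q).1) (fun q => (s2 q).1).
  by apply/funext => q; rewrite tbr1.
have fst2 s0 s1 s2 : (fun q => (s0 q).2 ((br s1 s2) q).1) =
    (fun q => (s0 q).2 (vlie (fun q => (s1 q).1) (fun q => (s2 q).1) q)).
  by apply/funext => q; rewrite tbr1.
rewrite !fst1 !fst2.
rewrite (der_lie vt vr (gsm_pair ss vU)) (der_lie vs vt (gsm_pair sr vU)) /=.
rewrite (der_lie vs vr (gsm_pair st vU)) (der_lie vs vU (gsm_pair st vr)) /=.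
rewrite (der_lie vr vU (gsm_pair ss vt)) (der_lie vt vU (gsm_pair ss vr)) /=.
have ls := nbhs_singleton (form1_lin (gsm_form ss)).
have lt := nbhs_singleton (form1_lin (gsm_form st)).
have lr := nbhs_singleton (form1_lin (gsm_form sr)).
rewrite (lie_jacobi vs vt vU) (lie_jacobi vs vr vU) (lie_jacobi vt vr vU).
rewrite (lin1D _ _ ls) (lin1D _ _ lt) (lin1D _ _ lr).
have := d3_koszul hh vs vt vr vU.
rewrite closed; last first.
- exact/afibP/(asec_at sU).
- exact/afibP/(asec_at ar).
- exact/afibP/(asec_at at_).
- exact/afibP/(asec_at as_).
move=> /= K; rewrite -[LHS]subr0 [X in _ - X]K.
rewrite (form3_rot hh p (t p).1 (r p).1 (vlie _ U p)) (form3_swap12 hh p (s p).1 (vlie _ _ p) (U p)).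
rewrite (form3_rot hh p (s p).1 (t p).1 (vlie _ U p)).
rewrite (form3_rot hh p (s p).1 (r p).1 (vlie _ U p)) (form3_swap12 hh p (t p).1 (vlie _ _ p) (U p)).
by ring.
Qed.
End TwistedJacobi.

(** * Local frames of [A + A*] *)

Section Frame.
Variables (R : realType) (n : nat) (X : complex_manifold R n) (A : algebroid).
Local Notation C := R[i].
Local Notation T := 'rV[C]_(n + n).
Local Notation G := (T * (T -> C^o))%type.
Implicit Types (p q : X) (s t : X -> G).

Local Notation rk := (\rank (amx R n A)).
Local Notation W := (row_base (amx R n A)).
Local Notation K := (col_base (amx R n A)).

Lemma frame_base : K *m W = amx R n A. Proof. exact: mulmx_base. Qed.

(** The idempotent matrix [amx A] has the rank factorization [K *m W], which
    forces [W *m K = 1]. So the rows of [W] form a frame of [A] and the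
    columns of [K] the dual frame of [A*], constant in the coordinates of a
    chart. *)
Lemma frame_dual : W *m K = 1%:M.
Proof.
have /row_freeP[B WB] := row_base_free (amx R n A).
have /row_fullP[B' B'K] := col_base_full (amx R n A).
have E : K *m W *m (K *m W) = K *m W by rewrite frame_base amx_idem.
move: B'K WB E; move: B B' W K => B B' W0 K0 B'K WB E.
have {E} := congr1 (fun M => B' *m M *m B) E.
by rewrite !mulmxA B'K !mul1mx -!mulmxA WB !mulmx1.
Qed.

Lemma amx_K : amx R n A *m K = K.
Proof.
have -> : amx R n A *m K = K *m W *m K by rewrite frame_base.
by rewrite -mulmxA frame_dual mulmx1.
Qed.

Lemma W_amx : W *m amx R n A = W.
Proof.
have -> : W *m amx R n A = W *m (K *m W) by rewrite frame_base.
by rewrite mulmxA frame_dual mul1mx.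
Qed.

Variable c : mf_chart X.

Definition frame (k : 'I_(rk + rk)) (q : X) : G :=
  match fintype.split k with
  | inl a => (tconst c q (row a W), fun=> 0)
  | inr b => (0, fun u => (tcoord c q u *m K) 0 b)
  end.

Definition fcomb (q : X) (x : 'rV[C]_(rk + rk)) : G :=
  (tconst c q (lsubmx x *m W), fun u => (tcoord c q u *m K *m (rsubmx x)^T) 0 0).

(** The frame splits into a frame of [A] and the dual one of [A*], hence the
    block form [fcomb] of linear combinations. *)
Lemma frame_sum q (x : 'rV[C]_(rk + rk)) : \sum_k x 0 k *: frame k q = fcomb q x.
Proof.
have fst_sum m (F : 'I_m -> G) : (\sum_k F k).1 = \sum_k (F k).1.
  by elim/big_rec2: _ => // k a b _ <-.
have snd_sum m (F : 'I_m -> G) u : (\sum_k F k).2 u = \sum_k (F k).2 u.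
  by elim/big_rec2: _ => // k a b _ <-.
rewrite /fcomb [LHS]surjective_pairing; congr pair.
  rewrite fst_sum big_split_ord/= addrC big1 ?add0r; last first.
    move=> b _; rewrite /frame; case: splitP => [a /= ab|b' /= _].
      by have := ltn_ord a; rewrite -ab ltnNge leq_addr.
    by rewrite scaler0.
  rewrite tconstE (mulmx_sum_row (lsubmx x)) mulmx_suml; apply: eq_bigr => a _.
  rewrite /frame; case: splitP => [a' /= aa|b /= ab]; last first.
    by have := ltn_ord a; rewrite ab ltnNge leq_addr.
  have -> : a' = a by apply: val_inj.
  by rewrite tconstE -scalemxAl mxE.
apply/funext => u; rewrite snd_sum big_split_ord/= big1 ?add0r; last first.
  move=> a _; rewrite /frame; case: splitP => [a' /= _|b /= ab].
    exact: mulr0.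
  by have := ltn_ord a; rewrite ab ltnNge leq_addr.
rewrite mxE; apply: eq_bigr => b _; rewrite /frame.
case: splitP => [a /= ab|b' /= /addnI bb].
  by have := ltn_ord a; rewrite -ab ltnNge leq_addr.
have -> : b' = b by apply: val_inj.
by rewrite mulrC; congr (_ * _); rewrite !mxE.
Qed.

Definition fcoef (q : X) (v : G) : 'rV[C]_(rk + rk) :=
  row_mx (tcoord c q v.1 *m K) (W *m \col_k v.2 (tconst c q (delta_mx 0 k)))^T.

Lemma fcoefK q v : mf_dom c q -> gtb_fib A v -> fcomb q (fcoef q v) = v.
Proof.
case: v => v l dq [/= /apr_id av ll lf].
rewrite /fcomb /fcoef row_mxKl row_mxKr/= trmxK; congr pair.
  rewrite -mulmxA frame_base -aprE -apr_tcoord// av.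
  exact: tcoordK.
apply/funext => u; rewrite -lf mulmxA -(mulmxA _ K) frame_base -aprE -apr_tcoord//.
rewrite (@lin1_chart _ _ X c q (fun _ => l) (apr A u) dq ll) mxE.
by apply: eq_bigr => k _; rewrite !mxE.
Qed.

Lemma fcomb_fib q x : mf_dom c q -> gtb_fib A (fcomb q x).
Proof.
move=> dq; split=> /=.
- by apply/afibP; rewrite -apr_tconst// aprE -mulmxA W_amx.
- by move=> y u v; rewrite tcoordE mulmxDl -!scalemxAl !mulmxDl -!scalemxAl !mxE.
- by move=> v; rewrite apr_tcoord// aprE -(mulmxA _ (amx R n A)) amx_K.
Qed.

Lemma fcomb_inj0 q x : mf_dom c q -> fcomb q x = 0 -> x = 0.
Proof.
move=> dq [E1 E2]; rewrite -[x]hsubmxK.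
have -> : lsubmx x = 0.
  have : tcoord c q (tconst c q (lsubmx x *m W)) *m K = 0.
    by rewrite E1 tcoordE !mul0mx.
  by rewrite tconstK// -mulmxA frame_dual mulmx1.
have -> : rsubmx x = 0.
  apply/rowP => b; have := congr1 (fun f => f (tconst c q (row b W))) E2.
  rewrite tconstK// rowE -(mulmxA _ W) frame_dual mulmx1.
  move=> E; have {E} : (delta_mx 0 b *m (rsubmx x)^T) 0 0 = 0 := E.
  by rewrite -rowE mxE [_^T _ _]mxE => ->; rewrite mxE.
by rewrite row_mx0.
Qed.

End Frame.

Section GtbBundle.
Variables (R : realType) (n : nat) (X : complex_manifold R n) (A : algebroid).
Local Notation C := R[i].
Local Notation T := 'rV[C]_(n + n).
Local Notation G := (T * (T -> C^o))%type.
Implicit Types (p q : X) (s t : X -> G) (Y U : X -> T).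
Local Notation rk := (\rank (amx R n A)).

Lemma fcomb_smooth c q (x : X -> 'rV[C]_(rk + rk)) : mf_dom c q ->
  (forall k, smooth_at q (fun q' => x q' 0 k)) ->
  gsm X A q (fun q' => fcomb c q' (x q')).
Proof.
move=> dq sx; have nd := dom_near dq.
have fib : \forall q' \near q, gtb_fib A (fcomb c q' (x q')).
  by apply: filterS nd => q' dq'; exact: fcomb_fib.
split=> //.
  apply: (vec_smooth_chart dq) => l.
  apply: (@smooth_at_eq _ _ _ q
    (fun q' => \sum_a x q' 0 (lshift rk a) * row_base (amx R n A) a l)).
    apply: filterS nd => q' dq'; rewrite [fcomb _ _ _]surjective_pairing/= tconstK// mxE.
    by apply: eq_bigr => a _; rewrite [lsubmx _ _ _]mxE.
  apply: smooth_at_sum => a; exact: smooth_atM (sx _) (@smooth_at_cst _ _ X q _).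
apply: (form1_smooth_chart dq); first by apply: filterS fib => q' [].
move=> u; apply: (@smooth_at_eq _ _ _ q
    (fun q' => \sum_b (u *m col_base (amx R n A)) 0 b * x q' 0 (rshift rk b))).
  apply: filterS nd => q' dq'; rewrite /= tconstK// mxE.
  by apply: eq_bigr => a _; rewrite [_^T _ _]mxE [rsubmx _ _ _]mxE.
apply: smooth_at_sum => a; exact: smooth_atM (@smooth_at_cst _ _ X q _) (sx _).
Qed.

Lemma fcoef_smooth c q s : mf_dom c q -> gsm X A q s ->
  forall k, smooth_at q (fun q' => fcoef A c q' (s q') 0 k).
Proof.
move=> dq [_ vs ss] k; rewrite -[k]splitK; case: (fintype.split k) => [a|b] /=.
  apply: (@smooth_at_eq _ _ _ q
    (fun q' => \sum_l tcoord c q' (s q').1 0 l * col_base (amx R n A) l a)).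
    by apply: nearW => q'; rewrite /fcoef row_mxEl mxE.
  apply: smooth_at_sum => l; exact: smooth_atM (vs c dq l) (@smooth_at_cst _ _ X q _).
apply: (@smooth_at_eq _ _ _ q (fun q' => \sum_l row_base (amx R n A) b l *
    (s q').2 (tconst c q' (delta_mx 0 l)))).
  apply: nearW => q'; rewrite /fcoef row_mxEr mxE [RHS]mxE.
  by apply: eq_bigr => l _; rewrite [X in _ = _ * X]mxE.
apply: smooth_at_sum => l; exact: smooth_atM (@smooth_at_cst _ _ X q _) (ss c dq _).
Qed.

Lemma gtb_vbundle : is_vbundle (gtb X A).
Proof.
move=> p; have dp := chart_at_dom p; set c := chart_at p in dp.
exists (rk + rk)%N, (@frame R n X A c); apply: filterS (dom_near dp) => q dq; split.
- move=> v; split=> [fv|[x ->]].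
    by exists (fcoef A c q v); rewrite frame_sum fcoefK.
  by rewrite frame_sum; exact: fcomb_fib.
- by move=> x; rewrite frame_sum; exact: fcomb_inj0.
- move=> s; split=> [ss|[x [sx E]]].
    exists (fun q' => fcoef A c q' (s q')); split; first exact: fcoef_smooth.
    have [fs _ _] := ss; apply: filterS2 (dom_near dq) fs => q' dq' fq'.
    by rewrite frame_sum fcoefK.
  apply: gsm_eq (fcomb_smooth dq sx); apply: filterS E => q' ->.
  by rewrite frame_sum.
Qed.

End GtbBundle.

(** * The twisted Courant algebroids *)

Section TwistedCourant.
Variables (R : realType) (n : nat) (X : complex_manifold R n) (A : algebroid).
Local Notation C := R[i].
Local Notation T := 'rV[C]_(n + n).
Local Notation G := (T * (T -> C^o))%type.
Implicit Types (p q : X) (s t : X -> G) (Y U : X -> T).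
Variables (h : form3 X) (hh : is_form3 h).
Hypothesis h_typed : forall p u v w, afib A u -> afib A v ->
  h p u v (apr A w) = h p u v w.

Local Notation E := (twisted A h).
Local Notation br := (tbr A h).

Lemma lin0 (f : T -> C^o) : linear f -> f 0 = 0.
Proof. by move=> lf; have := lf (-1) 0 0; rewrite scaler0 addr0 scaleN1r addNr. Qed.

Definition gip (x y : G) : C := x.2 y.1 + y.2 x.1.

Lemma gipC x y : gip x y = gip y x. Proof. exact: addrC. Qed.

Lemma gip_lin1 a x y z : gtb_fib A z -> gip (a *: x + y) z = a * gip x z + gip y z.
Proof.
move=> [_ lz _]; rewrite /gip/= lz.
have ringE (b c d e : C) : a * b + c + (a * d + e) = a * (b + d) + (c + e) by ring.
exact: ringE.
Qed.

Definition coordf (k : 'I_(n + n)) : G := (0, fun u : T => apr A u 0 k).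

Lemma coordf_fib k : gtb_fib A (coordf k).
Proof.
split=> /=; first by apply/afibP; rewrite apr0.
  by move=> a u v; rewrite apr_lin !mxE.
by move=> v; rewrite aprK.
Qed.

Lemma vec_fib u : gtb_fib A (apr A u, 0 : T -> C^o).
Proof. by split=> //=; [exact: afib_apr|move=> a v w; rewrite scaler0 addr0]. Qed.

(** Test against the covectors [coordf k] for the vector parts and against the
    vectors of [A] for the form parts. *)
Lemma gip_nondeg x y : gtb_fib A x -> gtb_fib A y ->
  (forall z, gtb_fib A z -> gip x z = gip y z) -> x = y.
Proof.
case: x y => [u f] [v g] [/= uA lf ff] [/= vA lg fg] H; congr pair.
  apply/rowP => k; have := H _ (coordf_fib k).
  rewrite /gip/= (apr_id uA) (apr_id vA).
  by rewrite (lin0 lf) (lin0 lg) !add0r.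
apply/funext => w; have := H _ (vec_fib w).
by rewrite /gip/= ff fg ![(0 : T -> C^o) _]/(0 : C^o) !addr0.
Qed.

(** The explicit value of the operator [cD] of [twisted A h], see
    [cD_twisted]. *)
Definition gD (f : X -> C) p : G := (0, fun u => vder p (apr A u) f).

Lemma gD_fib f p : gtb_fib A (gD f p).
Proof.
split=> /=; first by apply/afibP; rewrite apr0.
  by move=> a u v; rewrite apr_lin der_lin.
by move=> v; rewrite aprK.
Qed.

Lemma cD_twisted f p : cD E f p = gD f p.
Proof.
rewrite /cD; apply: xget_unique => /=.
  split; first exact: gD_fib.
  by move=> v [/apr_id vA lv fv]; rewrite vA vderE (lin0 lv) addr0.
move=> e [ef eD]; apply: (gip_nondeg ef (gD_fib f p)) => z zf.
have [/apr_id zA lz _] := zf; have ez : gip e z = der p z.1 f := eD z zf.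
by rewrite ez /gip/= zA vderE (lin0 lz) addr0.
Qed.

End TwistedCourant.

Section TwistedAxioms.
Variables (R : realType) (n : nat) (X : complex_manifold R n) (A : algebroid).
Local Notation C := R[i].
Local Notation T := 'rV[C]_(n + n).
Local Notation G := (T * (T -> C^o))%type.
Implicit Types (p q : X) (s t : X -> G) (Y U : X -> T).
Variables (h : form3 X) (hh : is_form3 h).
Hypothesis h_typed : forall p u v w, afib A u -> afib A v ->
  h p u v (apr A w) = h p u v w.

Local Notation br := (tbr A h).

(** Form parts factor through the projection onto [A], and every vector of [A]
    extends to a local section, so that it suffices to test on local sections. *)
Lemma gtb_ext p (x y : G) : (forall v, x.2 (apr A v) = x.2 v) ->
  (forall v, y.2 (apr A v) = y.2 v) -> x.1 = y.1 ->
  (forall U, asec A p U -> x.2 (U p) = y.2 (U p)) -> x = y.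
Proof.
case: x y => [u f] [v g] /= ff gg -> fg; congr pair; apply/funext => w.
rewrite -ff -gg; have := fg _ (@asec_vext _ _ X A p _ (afib_apr A w)).
by rewrite vext_id.
Qed.

Lemma fib_factor (x : G) : gtb_fib A x -> forall v, x.2 (apr A v) = x.2 v.
Proof. by case. Qed.

Lemma gsm_fib p s : gsm X A p s -> gtb_fib A (s p).
Proof. by move=> [/nbhs_singleton]. Qed.

Lemma secP s : sections (gtb X A) s <-> forall p, gsm X A p s.
Proof.
split=> [H p|H p]; first by have [] := H p.
by split; [exact: gsm_fib|exact: H].
Qed.

Lemma fib_lin (a : C) (x y : G) : gtb_fib A x -> gtb_fib A y -> gtb_fib A (a *: x + y).
Proof.
move=> [xA lx fx] [yA ly fy]; split=> /=; first exact: afib_lin.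
  move=> b u v; change (a * x.2 (b *: u + v) + y.2 (b *: u + v) =
    b * (a * x.2 u + y.2 u) + (a * x.2 v + y.2 v) :> C).
  rewrite lx ly; change (b *: x.2 u) with (b * x.2 u : C); change (b *: y.2 u) with (b * y.2 u : C).
  have ringE (c d e f : C) : a * (b * c + d) + (b * e + f) = b * (a * c + e) + (a * d + f) by ring.
  exact: ringE.
move=> v; change (a * x.2 (apr A v) + y.2 (apr A v) = a * x.2 v + y.2 v :> C).
by rewrite fx fy.
Qed.

Lemma fibZ (a : C) (x : G) : gtb_fib A x -> gtb_fib A (a *: x).
Proof.
move=> fx; have f0 : gtb_fib A (0 : G).
  split=> /=; [by apply/afibP; rewrite apr0|by move=> a' u v; rewrite scaler0 addr0|by []].
by have := fib_lin a fx f0; rewrite addr0.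
Qed.

Lemma fibD (x y : G) : gtb_fib A x -> gtb_fib A y -> gtb_fib A (x + y).
Proof. by move=> fx fy; have := fib_lin 1 fx fy; rewrite scale1r. Qed.

Lemma gsm_lin p (f : X -> C) s t : smooth_at p f -> gsm X A p s -> gsm X A p t ->
  gsm X A p (fun q => f q *: s q + t q).
Proof.
move=> sf ss st.
have fib : \forall q \near p, gtb_fib A (f q *: s q + t q).
  have [fs _ _] := ss; have [ft _ _] := st; apply: filterS2 fs ft => q; exact: fib_lin.
split=> //.
  have := vec_smooth_lin sf (@smooth_at_cst _ _ X p 1) (gsm_vec ss) (gsm_vec st).
  by apply: vec_smooth_eq; apply: nearW => q; rewrite scale1r.
have [] // : form1_at p (fun q => (f q *: s q + t q).2).
apply: form1_smooth_fields; first by apply: filterS fib => q [].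
by move=> U vU; exact: smooth_atD (smooth_atM sf (gsm_pair ss vU)) (gsm_pair st vU).
Qed.

Lemma tbr_fib p s t : gsm X A p s -> gsm X A p t -> gtb_fib A (br s t p).
Proof. by move=> ss st; exact: gsm_fib (tbr_gsm hh h_typed ss st). Qed.

Lemma gip_smooth p s t : gsm X A p s -> gsm X A p t ->
  smooth_at p (fun q => gip (s q) (t q)).
Proof.
move=> ss st; exact: smooth_atD (gsm_pair ss (gsm_vec st)) (gsm_pair st (gsm_vec ss)).
Qed.

(** The polarized form of the axiom on the bracket of a section with itself;
    it transfers linearity from the second argument of the bracket to the
    first. *)
Lemma tbr_sym p s t : gsm X A p s -> gsm X A p t ->
  br s t p + br t s p = gD A (fun q => gip (s q) (t q)) p.
Proof.
move=> ss st; have vs := gsm_vec ss; have vt := gsm_vec st.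
apply: (@gtb_ext p).
- exact: fib_factor (fibD (tbr_fib ss st) (tbr_fib st ss)).
- exact: fib_factor (gD_fib _ _ _).
- change ((br s t p).1 + (br t s p).1 = 0).
  by rewrite !tbr1 [X in X + _]lieC addNr.
- move=> U sU; change ((br s t p).2 (U p) + (br t s p).2 (U p) =
    vder p (apr A (U p)) (fun q => gip (s q) (t q)) :> C).
  rewrite (tbr2 h ss st sU) (tbr2 h st ss sU) (asec_at sU).
  rewrite (derD _ (gsm_pair ss vt) (gsm_pair st vs)).
  rewrite (form3_swap12 hh p (s p).1 (t p).1).
  by ring.
Qed.

Lemma tbr_leibniz p (f : X -> C) s t t' : smooth_at p f ->
  gsm X A p s -> gsm X A p t -> gsm X A p t' ->
  br s (fun q => f q *: t q + t' q) p =
  vder p (s p).1 f *: t p + f p *: br s t p + br s t' p.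
Proof.
move=> sf ss st st'; have stt := gsm_lin sf st st'.
have vs := gsm_vec ss; have vt := gsm_vec st; have vt' := gsm_vec st'.
have lieE U : vec_smooth_at p U ->
    vlie U (fun q => (f q *: t q + t' q).1) p =
    vder p (U p) f *: (t p).1 + f p *: vlie U (fun q => (t q).1) p
    + vlie U (fun q => (t' q).1) p.
  move=> vU; rewrite -(lieZr vU vt sf) -(lieDr vU (vec_smoothZ sf vt) vt').
  by [].
apply: (@gtb_ext p).
- exact: fib_factor (tbr_fib ss stt).
- apply: fib_factor; apply: fibD; last exact: tbr_fib.
  apply: fibD; apply: fibZ; [exact: gsm_fib|exact: tbr_fib].
- change ((br s (fun q => f q *: t q + t' q) p).1 =
    vder p (s p).1 f *: (t p).1 + f p *: (br s t p).1 + (br s t' p).1).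
  by rewrite !tbr1 lieE.
- move=> U sU; have vU := proj1 sU.
  change ((br s (fun q => f q *: t q + t' q) p).2 (U p) =
    vder p (s p).1 f * (t p).2 (U p) + f p * (br s t p).2 (U p) + (br s t' p).2 (U p) :> C).
  rewrite (tbr2 h ss stt sU) (tbr2 h ss st sU) (tbr2 h ss st' sU).
  rewrite [vlie (fun q => (f q *: t q + t' q).1) U p]lieC (lieE _ vU).
  have ls := nbhs_singleton (form1_lin (gsm_form ss)).
  rewrite (lin1N _ ls) (lin1D _ _ ls) (lin1D _ _ ls) (lin1Z _ _ ls) (lin1Z _ _ ls).
  rewrite [vlie U (fun q => (t q).1) p]lieC [vlie U (fun q => (t' q).1) p]lieC.
  rewrite !(lin1N _ ls).
  have E1 : vder p (s p).1 (fun q => (f q *: t q + t' q).2 (U q)) =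
     vder p (s p).1 f * (t p).2 (U p) + f p * vder p (s p).1 (fun q => (t q).2 (U q)) +
     vder p (s p).1 (fun q => (t' q).2 (U q)).
    by rewrite -(derM _ sf (gsm_pair st vU)) -(derD _ (smooth_atM sf (gsm_pair st vU)) (gsm_pair st' vU)).
  have E2 : vder p (U p) (fun q => (s q).2 (f q *: t q + t' q).1) =
     vder p (U p) f * (s p).2 (t p).1 + f p * vder p (U p) (fun q => (s q).2 (t q).1) +
     vder p (U p) (fun q => (s q).2 (t' q).1).
    rewrite -(derM _ sf (gsm_pair ss vt)).
    rewrite -(derD _ (smooth_atM sf (gsm_pair ss vt)) (gsm_pair ss vt')).
    apply: der_eq; apply: filterS (form1_lin (gsm_form ss)) => q lq.
    exact: (lin1P _ _ _ lq).
  rewrite E1 E2.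
  change ((f p *: t p + t' p).1) with (f p *: (t p).1 + (t' p).1).
  change ((f p *: t p + t' p).2 ?x) with (f p * (t p).2 x + (t' p).2 x : C).
  rewrite der_lin (form3_D2 hh) (form3_Z2 hh).
  by ring.
Qed.

Lemma tbr_metric p s t r : gsm X A p s -> gsm X A p t -> gsm X A p r ->
  vder p (s p).1 (fun q => gip (t q) (r q)) = gip (br s t p) (r p) + gip (t p) (br s r p).
Proof.
move=> ss st sr; have at_ := gsm_asec st; have ar := gsm_asec sr.
have vt := gsm_vec st; have vr := gsm_vec sr.
rewrite (derD _ (gsm_pair st vr) (gsm_pair sr vt)) /gip !tbr1.
rewrite (tbr2 h ss st ar) (tbr2 h ss sr at_) /=.
rewrite [vlie (fun q => (r q).1) (fun q => (t q).1) p]lieC.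
rewrite (lin1N _ (nbhs_singleton (form1_lin (gsm_form ss)))).
rewrite (form3_swap23 hh p (s p).1 (r p).1).
by ring.
Qed.

End TwistedAxioms.

Section TwistedIsCourant.
Variables (R : realType) (n : nat) (X : complex_manifold R n) (A : algebroid).
Local Notation C := R[i].
Local Notation T := 'rV[C]_(n + n).
Local Notation G := (T * (T -> C^o))%type.
Implicit Types (p q : X) (s t : X -> G) (Y U : X -> T).
Variables (h : form3 X) (hh : is_form3 h).
Hypothesis h_typed : forall p u v w, afib A u -> afib A v ->
  h p u v (apr A w) = h p u v w.
Hypothesis h_closed : forall p u v w x,
  afib A u -> afib A v -> afib A w -> afib A x -> d3 h p u v w x = 0.

Local Notation br := (tbr A h).

Lemma gsm0 p : gsm X A p (fun=> 0 : G).
Proof.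
have f0 : gtb_fib A (0 : G).
  by split=> /=; [apply/afibP; rewrite apr0|move=> a' u v; rewrite scaler0 addr0|].
split; [exact: nearW|exact: vec_smooth0|].
by move=> i di u; exact: smooth_at_cst.
Qed.

Lemma tbr_lin2 p (a : C) s t t' : gsm X A p s -> gsm X A p t -> gsm X A p t' ->
  br s (fun q => a *: t q + t' q) p = a *: br s t p + br s t' p.
Proof.
move=> ss st st'; rewrite (tbr_leibniz hh h_typed (@smooth_at_cst _ _ X p a) ss st st').
by rewrite der_cst scale0r add0r.
Qed.

Lemma tbr_0r p s : gsm X A p s -> br s (fun=> 0) p = 0.
Proof.
move=> ss; have := tbr_lin2 1 ss (gsm0 p) (gsm0 p).
have -> : (fun q : X => 1 *: (0 : G) + (0 : G)) = (fun=> 0).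
  by apply/funext => q; rewrite scaler0 addr0.
rewrite scale1r => /eqP; rewrite -[X in X == _]addr0 => /eqP/addrI.
by [].
Qed.

Lemma tbr_mulr p (f : X -> C) s t : smooth_at p f -> gsm X A p s -> gsm X A p t ->
  br s (fun q => f q *: t q) p = vder p (s p).1 f *: t p + f p *: br s t p.
Proof.
move=> sf ss st; have := tbr_leibniz hh h_typed sf ss st (gsm0 p).
rewrite (tbr_0r ss) addr0 => <-; congr (br s _ p).
by apply/funext => q; rewrite addr0.
Qed.

Lemma gD_lin p (a : C) f g : smooth_at p f -> smooth_at p g ->
  gD A (fun q => a * f q + g q) p = a *: gD A f p + gD A g p.
Proof.
move=> sf sg; have sa := @smooth_at_cst _ _ X p a.
apply: (@gtb_ext _ _ X A p).
- exact: fib_factor (gD_fib _ _ _).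
- exact: fib_factor (fib_lin _ (gD_fib _ _ _) (gD_fib _ _ _)).
- by change ((0 : T) = a *: (0 : T) + 0); rewrite scaler0 addr0.
- move=> U _; change (vder p (apr A (U p)) (fun q => a * f q + g q) =
    a * vder p (apr A (U p)) f + vder p (apr A (U p)) g :> C).
  by rewrite (derD _ (smooth_atM sa sf) sg) (derM _ sa sf) der_cst mul0r add0r.
Qed.

Lemma gip_linl p a (s s' t : X -> G) : (forall q, gtb_fib A (t q)) ->
  (fun q => gip (a *: s q + s' q) (t q)) = (fun q => a * gip (s q) (t q) + gip (s' q) (t q)).
Proof. by move=> ft; apply/funext => q; exact: gip_lin1 (ft q). Qed.

(** The axioms for the form parts are checked on local sections of [A], where
    [tbr2] reduces them to the rules for vector fields. *)
Lemma twisted_courant : is_courant (twisted A h).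
Proof.
split.
- exact: gtb_vbundle.
- by move=> p a u v w _ _; exact: gip_lin1.
- by move=> p u v _ _; exact: gipC.
- move=> p u fu H; have f0 := gsm_fib (gsm0 p); apply: (gip_nondeg fu f0) => z fz.
  rewrite [LHS](H z fz) /gip/=; have [_ lz _] := fz.
  by rewrite (lin0 lz) addr0.
- by move=> p s t; exact: gip_smooth.
- by [].
- by move=> p s; exact: gsm_vec.
- move=> s t /secP ss /secP st; apply/secP => p; rewrite -tbrE.
  exact: tbr_gsm.
- move=> a s s' t /secP ss /secP ss' /secP st p; rewrite -tbrE.
  have sas := gsm_lin (@smooth_at_cst _ _ X p a) (ss p) (ss' p).
  have E1 := tbr_sym hh h_typed sas (st p).
  have E2 := tbr_sym hh h_typed (ss p) (st p).
  have E3 := tbr_sym hh h_typed (ss' p) (st p).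
  rewrite (tbr_lin2 a (st p) (ss p) (ss' p)) in E1.
  rewrite (gip_linl p) in E1; last by move=> q; exact: gsm_fib.
  rewrite (gD_lin a (gip_smooth (ss p) (st p)) (gip_smooth (ss' p) (st p))) -E2 -E3 in E1.
  move/(canRL (addrK _)) : E1 => ->.
  by rewrite scalerDr addrACA addrK.
- move=> a s t t' /secP ss /secP st /secP st' p; rewrite -tbrE.
  exact: tbr_lin2.
- move=> s t r /secP ss /secP st /secP sr p; rewrite -tbrE.
  have str := tbr_gsm hh h_typed (st p) (sr p).
  have sst := tbr_gsm hh h_typed (ss p) (st p).
  have ssr := tbr_gsm hh h_typed (ss p) (sr p).
  have fst1 s1 s2 : (fun q => ((br s1 s2) q).1) = vlie (fun q => (s1 q).1) (fun q => (s2 q).1).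
    by apply/funext => q; rewrite tbr1.
  apply: (@gtb_ext _ _ X A p).
  + exact: fib_factor (tbr_fib hh h_typed (ss p) str).
  + exact: fib_factor (fibD (tbr_fib hh h_typed sst (sr p)) (tbr_fib hh h_typed (st p) ssr)).
  + change ((br s (br t r) p).1 = (br (br s t) r p).1 + (br t (br s r) p).1).
    by rewrite !tbr1 !fst1; apply: lie_jacobi; exact: gsm_vec.
  + move=> U sU.
    change ((br s (br t r) p).2 (U p) = (br (br s t) r p).2 (U p) + (br t (br s r) p).2 (U p) :> C).
    exact: tbr_jacobi2.
- move=> f s t sf /secP ss /secP st p; rewrite -tbrE /anch -vderE.
  exact: tbr_mulr.
- move=> s /secP ss p; rewrite -tbrE cD_twisted -(tbr_sym hh h_typed (ss p) (ss p)).
  by rewrite half_addxx.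
- move=> s t /secP ss /secP st p; rewrite /ipf -tbrE /anch -vderE.
  rewrite (tbr_metric hh (ss p) (st p) (st p)) [X in _ + X]gipC -mulr2n.
  by rewrite mulr_natl.
Qed.

End TwistedIsCourant.

(** * The splitting of the full algebroid into two types *)

Section Projections.
Variables (R : realType) (n : nat) (X : complex_manifold R n).
Local Notation C := R[i].
Local Notation T := 'rV[C]_(n + n).
Local Notation G := (T * (T -> C^o))%type.
Implicit Types (A : algebroid) (p q : X) (s t : X -> G) (Y U : X -> T) (x y : G).

Definition gpr A x : G := (apr A x.1, fun u => x.2 (apr A u)).

Lemma gpr2 A x : (gpr A x).2 = (fun u => x.2 (apr A u)) :> (T -> C^o).
Proof. by []. Qed.

Lemma gprD A x y : gpr A (x + y) = gpr A x + gpr A y.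
Proof. by rewrite /gpr/= aprD. Qed.
Lemma gprN A x : gpr A (- x) = - gpr A x.
Proof. by rewrite /gpr/= aprN. Qed.
Lemma gprZ A (a : C) x : gpr A (a *: x) = a *: gpr A x.
Proof. by rewrite /gpr/= aprZ. Qed.

Lemma gpr_fib A x : gtb_fib Full x -> gtb_fib A (gpr A x).
Proof.
move=> [_ lx _]; split; first exact: afib_apr.
  by move=> a u v; rewrite gpr2 apr_lin lx.
by move=> v; rewrite gpr2 aprK.
Qed.

Lemma gpr_id A x : gtb_fib A x -> gpr A x = x.
Proof.
case: x => u f [/= /apr_id uA _ ff]; rewrite /gpr/= uA; congr pair.
by apply/funext.
Qed.

Lemma fib_full A x : gtb_fib A x -> gtb_fib Full x.
Proof. by move=> [_ lx _]. Qed.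

Lemma gpr_sum A x : A <> Full -> gtb_fib Full x -> gpr A x + gpr (conj_type A) x = x.
Proof.
move=> AF [_ lx _]; case: x lx => u f /= lf; congr pair; first exact: apr_sum.
apply/funext => v; change (f (apr A v) + f (apr (conj_type A) v) = f v).
have := lf 1 (apr A v) (apr (conj_type A) v); rewrite !scale1r => <-.
by rewrite apr_sum.
Qed.

Lemma conj_typeK A : conj_type (conj_type A) = A. Proof. by case: A. Qed.
Lemma conj_type_full A : A <> Full -> conj_type A <> Full. Proof. by case: A. Qed.

Lemma apr_conj2 A (u : T) : A <> Full -> afib (conj_type A) u -> apr A u = 0.
Proof. by move=> AF /apr_id <-; exact: apr_conj. Qed.

Lemma form_conj A x u : A <> Full -> gtb_fib A x -> afib (conj_type A) u -> x.2 u = 0.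
Proof. by move=> AF [_ lx fx] uB; rewrite -fx apr_conj2// lin0. Qed.

Lemma gpr_conj A x : A <> Full -> gtb_fib (conj_type A) x -> gpr A x = 0.
Proof.
move=> AF fx; have [uB lx _] := fx; rewrite /gpr apr_conj2//; congr pair.
apply/funext => v; apply: (form_conj (conj_type_full AF) fx).
by rewrite conj_typeK; exact: afib_apr.
Qed.

Lemma gip_orth A x y : A <> Full -> gtb_fib A x -> gtb_fib (conj_type A) y -> gip x y = 0.
Proof.
move=> AF fx fy; have [xA _ _] := fx; have [yB _ _] := fy.
rewrite /gip (form_conj AF fx yB) (form_conj (conj_type_full AF) fy) ?addr0//.
by rewrite conj_typeK.
Qed.

Lemma gipDl x y (z : G) : gtb_fib Full z -> gip (x + y) z = gip x z + gip y z.
Proof. by move=> fz; have := @gip_lin1 R n Full 1 x y z fz; rewrite scale1r mul1r. Qed.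

Lemma gipZl (a : C) x (z : G) : gtb_fib Full z -> gip (a *: x) z = a * gip x z.
Proof.
move=> fz; have := @gip_lin1 R n Full a x 0 z fz; rewrite addr0 => ->.
have [_ lz _] := fz; rewrite /gip/= (lin0 lz).
by change (a * (x.2 z.1 + z.2 x.1) + ((0:C) + 0) = a * (x.2 z.1 + z.2 x.1)); rewrite !addr0.
Qed.

Lemma gipNl x (z : G) : gtb_fib Full z -> gip (- x) z = - gip x z.
Proof. by move=> fz; rewrite -scaleN1r gipZl// mulN1r. Qed.

Lemma gipBl x y (z : G) : gtb_fib Full z -> gip (x - y) z = gip x z - gip y z.
Proof. by move=> fz; rewrite gipDl// gipNl. Qed.

(** The components in [A + A*] and in the conjugate type are orthogonal. *)
Lemma gip_gprl A x y : A <> Full -> gtb_fib Full x -> gtb_fib A y -> gip (gpr A x) y = gip x y.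
Proof.
move=> AF fx fy; have fy' : gtb_fib (conj_type (conj_type A)) y by rewrite conj_typeK.
have <- : gip (gpr A x) y + gip (gpr (conj_type A) x) y = gip x y.
  by rewrite -(gipDl _ _ (fib_full fy)) (gpr_sum AF fx).
by rewrite (gip_orth (conj_type_full AF) (gpr_fib _ fx) fy') addr0.
Qed.

Lemma gip_gprr A x y : A <> Full -> gtb_fib Full x -> gtb_fib A y -> gip y (gpr A x) = gip y x.
Proof. by move=> AF fx fy; rewrite gipC gip_gprl// gipC. Qed.

Lemma gpr_gD A f p : gpr A (gD Full f p) = gD A f p :> G.
Proof.
by rewrite /gpr /gD; congr pair; exact: apr0.
Qed.

Lemma asec_toFull A p U : asec A p U -> asec Full p U.
Proof. by move=> [vU _]; split=> //; exact: nearW. Qed.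

Lemma gsm_toFull A p s : gsm X A p s -> gsm X Full p s.
Proof. by move=> [fs vs ss]; split=> //; apply: filterS fs => q; exact: fib_full. Qed.

Lemma form1_apr A p (a : X -> T -> C) : form1_at p a -> form1_at p (fun q u => a q (apr A u)).
Proof.
move=> fa; apply: form1_smooth_fields.
  by apply: filterS (form1_lin fa) => q lq c u v; rewrite apr_lin; exact: lq.
by move=> Y vY; exact: pair_smooth fa (apr_smooth A vY).
Qed.

Lemma gsm_gpr A p s : gsm X Full p s -> gsm X A p (fun q => gpr A (s q)).
Proof.
move=> ss; apply: gsm_intro; first exact: asec_apr (gsm_vec ss).
  exact: form1_apr (gsm_form ss).
by apply: nearW => q v; rewrite gpr2 aprK.
Qed.

Lemma gD_gsm A p f : smooth_at p f -> gsm X A p (gD A f).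
Proof.
move=> sf; apply: gsm_intro.
- by split; [exact: vec_smooth0|apply: nearW => q; exact: apr0].
- apply: form1_smooth_fields.
    by apply: nearW => q a u v; rewrite /= apr_lin der_lin.
  by move=> Y vY; exact: der_smooth (apr_smooth A vY) sf.
- by apply: nearW => q v; rewrite /= aprK.
Qed.

End Projections.

(** The second clause says that [h] only sees the [A3]-part of its last
    argument, once the first two are in [A1] and [A2]. *)
Definition form_component (R : realType) (n : nat) (X : complex_manifold R n)
    (A1 A2 A3 : algebroid) (H h : form3 X) : Prop :=
  (forall (p : X) u v w, afib A1 u -> afib A2 v -> afib A3 w -> H p u v w = h p u v w) /\
  (forall (p : X) u v w, afib A1 u -> afib A2 v -> h p u v (apr A3 w) = h p u v w).

Section ProjectedOperations.
Variables (R : realType) (n : nat) (X : complex_manifold R n).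
Local Notation C := R[i].
Local Notation T := 'rV[C]_(n + n).
Local Notation G := (T * (T -> C^o))%type.
Implicit Types (p q : X) (s t a b : X -> G) (Y U : X -> T) (x y : G).
Variables (H : form3 X) (hH : is_form3 H).

Local Notation br := (tbr Full H).

Lemma full_typed p (u v w : T) : afib Full u -> afib Full v ->
  H p u v (apr Full w) = H p u v w.
Proof. by []. Qed.

Lemma br_gsm p s t : gsm X Full p s -> gsm X Full p t -> gsm X Full p (br s t).
Proof. exact: tbr_gsm hH full_typed _ _ _. Qed.

(** Both form parts are given by the formula of [tbr2], and the two 3-forms
    agree on vectors of [A]. *)
Lemma tbr_gpr A (h : form3 X) p a b : is_form3 h -> form_component A A A H h ->
  gsm X A p a -> gsm X A p b -> tbr A h a b p = gpr A (br a b p).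
Proof.
move=> hh [Hh hty] sa sb; have fa := gsm_toFull sa; have fb := gsm_toFull sb.
apply: (@gtb_ext _ _ X A p).
- exact: fib_factor (tbr_fib hh hty sa sb).
- exact: fib_factor (gpr_fib A (gsm_fib (br_gsm fa fb))).
- rewrite /gpr/= !tbr1.
  by rewrite (asec_at (asec_lie (gsm_asec sa) (gsm_asec sb))).
- move=> U sU; rewrite /gpr/= (asec_at sU) (tbr2 h sa sb sU) (tbr2 H fa fb (asec_toFull sU)).
  rewrite (Hh p (a p).1 (b p).1 (U p))//; apply/afibP.
  + exact: asec_at (gsm_asec sa).
  + exact: asec_at (gsm_asec sb).
  + exact: asec_at sU.
Qed.

(** Compared with the Lie derivative in [nabla], the bracket has an extra term
    [d alpha (Z, U)], with [alpha] a section of [A*] and [Z], [U] sections of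
    the conjugate type. By the Koszul formula it vanishes, as that type is
    integrable and killed by [alpha]. *)
Lemma nabla_gpr A (k : form3 X) p a b : A <> Full ->
  form_component A (conj_type A) (conj_type A) H k ->
  gsm X A p a -> gsm X (conj_type A) p b ->
  nabla A (conj_type A) k a b p = gpr (conj_type A) (br a b p).
Proof.
move=> AF [Hk kty] sa sb; have fa := gsm_toFull sa; have fb := gsm_toFull sb.
set B := conj_type A in Hk kty sb fb *.
have aA : afib A (a p).1 by apply/afibP; exact: asec_at (gsm_asec sa).
have bB : afib B (b p).1 by apply/afibP; exact: asec_at (gsm_asec sb).
apply: (@gtb_ext _ _ X B p).
- by move=> v; rewrite /nabla/= aprK kty.
- exact: fib_factor (gpr_fib B (gsm_fib (br_gsm fa fb))).
- by rewrite /gpr tbr1 vlieE.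
- move=> U sU; rewrite /gpr /= (asec_at sU) (tbr2 H fa fb (asec_toFull sU)).
  rewrite /lieA /dA1 /dA0 -vderE.
  change (apr Full (a p).1) with (a p).1; change (apr Full (U p)) with (U p).
  rewrite (d1_koszul (gsm_form sb) (gsm_vec sa) (proj1 sU)).
  have zero V : asec B p V -> \forall q \near p, (a q).2 (V q) = 0.
    move=> [_ aV]; have [fs _ _] := sa; apply: filterS2 fs aV => q fq /afibP.
    exact: form_conj AF fq.
  rewrite [X in _ = _ - X + _ + _ + _](_ : _ = 0); last first.
    by rewrite -(@der_cst _ _ X p (b p).1 0); apply: der_eq; exact: zero.
  rewrite [X in _ = _ + X + _ + _](_ : _ = 0); last first.
    rewrite -(@der_cst _ _ X p (U p) 0); apply: der_eq; exact: zero (gsm_asec sb).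
  rewrite (nbhs_singleton (zero _ (asec_lie (gsm_asec sb) sU))).
  rewrite (Hk p (a p).1 (b p).1 (U p))//; last by apply/afibP; exact: asec_at sU.
  by ring.
Qed.

End ProjectedOperations.

(** * The matched pair read off from the full bracket *)

Section MatchedAlgebra.
Variables (R : realType) (n : nat) (X : complex_manifold R n).
Local Notation C := R[i].
Local Notation T := 'rV[C]_(n + n).
Local Notation G := (T * (T -> C^o))%type.
Implicit Types (p q : X) (f : X -> C).
Variables (H : form3 X) (hH : is_form3 H).
Hypothesis H_closed : forall p u v w x, d3 H p u v w x = 0.

Local Notation br := (tbr Full H).
Local Notation sec A s := (forall p, gsm X A p s).

Lemma full_courant : is_courant (twisted Full H).
Proof. by apply: twisted_courant => // *; exact: H_closed. Qed.

Lemma brDr s t t' p : sec Full s -> sec Full t -> sec Full t' ->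
  br s (fun q => t q + t' q) p = br s t p + br s t' p.
Proof.
move=> ss st st'; have := tbr_lin2 hH (@full_typed _ _ _ H) 1 (ss p) (st p) (st' p).
by rewrite scale1r => <-; congr (br _ _ p); apply/funext => q; rewrite scale1r.
Qed.

Lemma brDl s s' t p : sec Full s -> sec Full s' -> sec Full t ->
  br (fun q => s q + s' q) t p = br s t p + br s' t p.
Proof.
move=> ss ss' st.
have := cou_br_linear1 full_courant 1 (iffRL (secP _ _) ss) (iffRL (secP _ _) ss') (iffRL (secP _ _) st) p.
rewrite -tbrE scale1r => <-; congr (br _ _ p); apply/funext => q.
by rewrite scale1r.
Qed.

Lemma gsmD A p s t : gsm X A p s -> gsm X A p t -> gsm X A p (fun q => s q + t q).
Proof.
move=> ss st; have := gsm_lin (@smooth_at_cst _ _ X p 1) ss st.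
by apply: gsm_eq; apply: nearW => q; rewrite scale1r.
Qed.

Lemma gsmZ A p f s : smooth_at p f -> gsm X A p s -> gsm X A p (fun q => f q *: s q).
Proof.
move=> sf ss; have := gsm_lin sf ss (gsm0 A p).
by apply: gsm_eq; apply: nearW => q; rewrite addr0.
Qed.

Lemma gsmN A p s : gsm X A p s -> gsm X A p (fun q => - s q).
Proof.
move=> ss; have := gsmZ (@smooth_at_cst _ _ X p (-1)) ss.
by apply: gsm_eq; apply: nearW => q; rewrite scaleN1r.
Qed.

Lemma brBr s t t' p : sec Full s -> sec Full t -> sec Full t' ->
  br s (fun q => t q - t' q) p = br s t p - br s t' p.
Proof.
move=> ss st st'; have st2 : sec Full (fun q => t q - t' q).
  by move=> q; apply: gsmD => //; exact: gsmN.
apply: (addIr (br s t' p)); rewrite -brDr// addrNK.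
by congr (br _ _ p); apply/funext => q; rewrite addrNK.
Qed.

Lemma brBl s s' t p : sec Full s -> sec Full s' -> sec Full t ->
  br (fun q => s q - s' q) t p = br s t p - br s' t p.
Proof.
move=> ss ss' st; have ss2 : sec Full (fun q => s q - s' q).
  by move=> q; apply: gsmD => //; exact: gsmN.
apply: (addIr (br s' t p)); rewrite -brDl// addrNK.
by congr (br _ _ p); apply/funext => q; rewrite addrNK.
Qed.

Lemma br_sec s t : sec Full s -> sec Full t -> sec Full (br s t).
Proof. by move=> ss st p; exact: br_gsm. Qed.

Lemma gD_cst0 A p : gD A (fun _ : X => 0 : C) p = 0.
Proof. by rewrite /gD; congr pair; apply/funext => u; rewrite der_cst. Qed.

Definition opposite A B := A <> Full /\ B = conj_type A.

Lemma opposite_sym A B : opposite A B -> opposite B A.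
Proof. by move=> [AF ->]; split; [exact: conj_type_full|rewrite conj_typeK]. Qed.

(** The maps [Omega] and [Mho]: the [B]-component of the bracket of two
    sections of [A + A*], minus its symmetric part. *)
Definition skew_part B (a b : X -> G) : X -> G :=
  fun p => gpr B (br a b p) - 2^-1 *: gD B (fun q => gip (a q) (b q)) p.

Section OnePair.
Variables (A B : algebroid) (AB : opposite A B).
Variables (hA hB kAB kBA : form3 X).
Hypotheses (fA : is_form3 hA) (fB : is_form3 hB) (fAB : is_form3 kAB).
Hypotheses (cA : form_component A A A H hA) (cB : form_component B B B H hB).
Hypotheses (cAB : form_component A B B H kAB) (cBA : form_component B A A H kBA).

Local Notation E1 := (twisted A hA).
Local Notation E2 := (twisted B hB).
Local Notation fwd := (nabla A B kAB).
Local Notation bwd := (nabla B A kBA).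

Lemma AF : A <> Full. Proof. by have [] := AB. Qed.
Lemma BF : B <> Full. Proof. by have [] := opposite_sym AB. Qed.

Lemma toF D s : sec D s -> sec Full s. Proof. by move=> ss p; exact: gsm_toFull. Qed.

Lemma fwdE a al : sec A a -> sec B al -> fwd a al = (fun p => gpr B (br a al p)).
Proof.
move=> sa sb; apply/funext => p; have [AF' E] := AB; move: sb cAB; rewrite E => sb c.
exact: nabla_gpr.
Qed.

Lemma bwdE a al : sec A a -> sec B al -> bwd al a = (fun p => gpr A (br al a p)).
Proof.
move=> sa sb; apply/funext => p; have [BF' E] := opposite_sym AB; move: sa cBA; rewrite E => sa c.
exact: nabla_gpr.
Qed.

Lemma brAE a b : sec A a -> sec A b -> ca_br (c := E1) a b = (fun p => gpr A (br a b p)).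
Proof. by move=> sa sb; apply/funext => p; rewrite -(tbr_gpr hH fA cA (sa p) (sb p)) tbrE. Qed.

Lemma brBE a b : sec B a -> sec B b -> ca_br (c := E2) a b = (fun p => gpr B (br a b p)).
Proof. by move=> sa sb; apply/funext => p; rewrite -(tbr_gpr hH fB cB (sa p) (sb p)) tbrE. Qed.

Lemma gpr_sec D s : sec Full s -> sec D (fun p => gpr D (s p)).
Proof. by move=> ss p; exact: gsm_gpr. Qed.

Lemma gprAB s p : gsm X Full p s -> gpr A (s p) + gpr B (s p) = s p.
Proof. by move=> /gsm_fib fs; have [AF' ->] := AB; exact: gpr_sum. Qed.

Lemma gprAB_fun s : sec Full s -> s = (fun p => gpr A (s p) + gpr B (s p)).
Proof. by move=> ss; apply/funext => p; rewrite gprAB. Qed.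

Lemma gip0 a al p : gsm X A p a -> gsm X B p al -> gip (a p) (al p) = 0.
Proof. by move=> /gsm_fib sa /gsm_fib; have [AF' ->] := AB; exact: gip_orth. Qed.

Lemma gsm_gpr_id D a p : gsm X D p a -> gpr D (a p) = a p.
Proof. by move=> /gsm_fib; exact: gpr_id. Qed.

Lemma gprB0 a p : gsm X A p a -> gpr B (a p) = 0.
Proof.
move=> /gsm_fib fa; have [BF' E] := opposite_sym AB; apply: (gpr_conj BF').
by rewrite -E.
Qed.

(** The symmetric part of the bracket is [D <a, al> / 2], and [a], [al] are
    orthogonal. *)
Lemma br_skew a al p : sec A a -> sec B al -> br a al p = - br al a p.
Proof.
move=> sa sb; have := tbr_sym hH (@full_typed _ _ _ H) (toF sa p) (toF sb p).
have -> : (fun q => gip (a q) (al q)) = (fun=> 0 : C).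
  by apply/funext => q; exact: gip0.
by rewrite gD_cst0 => /eqP; rewrite addr_eq0 => /eqP.
Qed.

Lemma br_metric s t r p : sec Full s -> sec Full t -> sec Full r ->
  vder p (s p).1 (fun q => gip (t q) (r q)) = gip (br s t p) (r p) + gip (t p) (br s r p).
Proof. by move=> ss st sr; exact: tbr_metric. Qed.

Lemma vlie_0l (Y : X -> T) p : vlie (fun=> 0) Y p = 0.
Proof.
rewrite lieE; apply/rowP => k; rewrite !mxE der0l.
rewrite (@der_eq _ _ _ p (Y p) _ (fun=> 0)) ?der_cst ?subr0//.
by apply: nearW => q; rewrite tcoordE mul0mx mxE.
Qed.

(** [nabla] depends on its first argument only through the vector part. *)
Lemma nabla_vec0 s t p : (forall q, (s q).1 = 0) -> gsm X B p t ->
  nabla A B kAB s t p = 0.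
Proof.
move=> s0 st; have s1 : (fun q => (s q).1) = (fun=> 0) by apply/funext.
have la := form1_lin (gsm_form st).
have Dt u : vder p u (fun q => (t q).2 (s q).1) = 0.
  rewrite -(@der_cst _ _ X p u 0); apply: der_eq; apply: filterS la => q lq.
  by rewrite s0 (lin1_0 lq).
have d0 u : d1 (fun q => (t q).2) p 0 u = 0.
  rewrite /d1 -vderE der0l (@der_eq _ _ _ p u _ (fun=> 0)) ?der_cst ?subr0//.
  by apply: filterS la => q lq; rewrite tconstE mul0mx (lin1_0 lq).
rewrite /nabla; congr pair.
  by rewrite -vlieE s1 vlie_0l apr0.
apply/funext => u; rewrite /lieA /dA1 /dA0 -vderE Dt s0.
change (apr Full (0 : T)) with (0 : T); rewrite d0.
by rewrite (lin1_0 (a := fun q x => kAB q x (t p).1 u) (form3_linear1 fAB p _ _)) !addr0.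
Qed.

(** By [br_skew], the behaviour under multiplication of the first argument
    follows from the Leibniz rule for the second one; its derivative term lies
    in [A + A*] and is projected away. *)
Lemma fwd_connection : is_connection (E := E1) (V := gtb X B) fwd.
Proof.
split.
- move=> s v /secP ss /secP sv; apply/secP; rewrite fwdE//; apply: gpr_sec.
  exact: br_sec (toF ss) (toF sv).
- move=> s s' v /secP ss /secP ss' /secP sv p.
  rewrite !fwdE//; last by move=> q; exact: gsmD.
  by rewrite (brDl _ (toF ss) (toF ss') (toF sv)) gprD.
- move=> s v v' /secP ss /secP sv /secP sv' p.
  rewrite !fwdE//; last by move=> q; exact: gsmD.
  by rewrite (brDr _ (toF ss) (toF sv) (toF sv')) gprD.
- move=> f s v sf /secP ss /secP sv p.
  have sfs : sec A (fun q => f q *: s q) by move=> q; exact: gsmZ.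
  rewrite !fwdE// (br_skew _ sfs sv) (br_skew _ ss sv).
  rewrite (tbr_mulr hH (@full_typed _ _ _ H) (sf p) (toF sv p) (toF ss p)).
  by rewrite !gprN gprD !gprZ (gprB0 (ss p)) scaler0 add0r scalerN.
- move=> f s v sf /secP ss /secP sv p.
  have sfv : sec B (fun q => f q *: v q) by move=> q; exact: gsmZ.
  rewrite !fwdE//.
  rewrite (tbr_mulr hH (@full_typed _ _ _ H) (sf p) (toF ss p) (toF sv p)).
  by rewrite gprD !gprZ (gsm_gpr_id (sv p)) /anch -vderE.
Qed.

(** This is the invariance of the metric under the full bracket, since the
    projection does not change pairings with [B + B*]. *)
Lemma fwd_preserves_metric : preserves_metric (E1 := E1) (E2 := E2) fwd.
Proof.
move=> a c d /secP sa /secP sc /secP sd p.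
rewrite !fwdE// /anch -vderE /ipf.
have fac := gsm_fib (br_sec (toF sa) (toF sc) p).
have fad := gsm_fib (br_sec (toF sa) (toF sd) p).
change (vder p (a p).1 (fun q => gip (c q) (d q)) =
  gip (gpr B (br a c p)) (d p) + gip (c p) (gpr B (br a d p))).
rewrite (br_metric p (toF sa) (toF sc) (toF sd)).
by rewrite (gip_gprl BF fac (gsm_fib (sd p))) (gip_gprr BF fad (gsm_fib (sc p))).
Qed.

(** [cD E1 f] has no vector part. *)
Lemma fwd_cD f be p : smooth f -> sections E2 be -> fwd (cD E1 f) be p = 0.
Proof.
by move=> sf /secP sb; apply: nabla_vec0 => // q; rewrite cD_twisted.
Qed.

(** Invariance of the metric applied to [<c, b> = 0]: the [B]-component of the
    bracket of two sections of [A + A*] is adjoint to the connection. *)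
Lemma gip_br a b c p : sec A a -> sec A b -> sec B c ->
  gip (c p) (br a b p) = gip (gpr A (br c a p)) (b p).
Proof.
move=> sa sb sc; have fca := gsm_fib (br_sec (toF sc) (toF sa) p).
rewrite (gip_gprl AF fca (gsm_fib (sb p))).
have := br_metric p (toF sa) (toF sc) (toF sb).
have -> : (fun q => gip (c q) (b q)) = (fun=> 0 : C).
  by apply/funext => q; rewrite gipC (gip0 (sb q) (sc q)).
rewrite der_cst (br_skew p sa sc) (gipNl _ (gsm_fib (toF sb p))) => /eqP.
by rewrite eq_sym addrC subr_eq0 => /eqP.
Qed.

Lemma gip_gD c p D f : gtb_fib D c -> gip c (gD D f p) = vder p c.1 f.
Proof.
move=> [/apr_id cD' lc _]; rewrite /gip/=.
by rewrite (lin0 lc) add0r cD'.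
Qed.

Lemma skew_part_sec a b : sec A a -> sec A b -> sec B (skew_part B a b).
Proof.
move=> sa sb p; apply: gsmD; first exact: gpr_sec (br_sec (toF sa) (toF sb)) p.
apply: gsmN; apply: (@gsmZ B p (fun=> 2^-1)); first exact: smooth_at_cst.
by apply: gD_gsm; exact: gip_smooth.
Qed.

(** Skewness comes from [tbr_sym]; the pairing formula is [gip_br] minus half
    the derivative of [<a, b>], expanded by the invariance of the metric. *)
Lemma skew_part_skew_map : is_skew_map (E1 := E1) (E2 := E2) bwd (skew_part B).
Proof.
move=> a b /secP sa /secP sb; split.
- by apply/secP; exact: skew_part_sec.
- move=> p; rewrite /skew_part.
  have E : gpr B (br a b p) + gpr B (br b a p) = gD B (fun q => gip (a q) (b q)) p.
    by rewrite -gprD (tbr_sym hH (@full_typed _ _ _ H) (toF sa p) (toF sb p)) gpr_gD.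
  have -> : (fun q => gip (b q) (a q)) = (fun q => gip (a q) (b q)).
    by apply/funext => q; exact: gipC.
  rewrite -{}E; set x := gpr B _; set y := gpr B _.
  rewrite scalerDr opprB -[X in X - _](half_addxx x) scalerDr opprD addrA addrK.
  by rewrite -[X in _ = _ + _ - X](half_addxx y) scalerDr opprD addrA addrK.
- move=> c /secP sc p; rewrite !bwdE// /ipf.
  change (gip (c p) (skew_part B a b p) =
     2^-1 * (gip (gpr A (br c a p)) (b p) - gip (a p) (gpr A (br c b p)))).
  have fc := gsm_fib (toF sc p).
  have fab := gpr_fib B (gsm_fib (br_sec (toF sa) (toF sb) p)).
  rewrite gipC /skew_part (gipBl _ _ fc) (gipZl _ _ fc) [gip (gD _ _ _) _]gipC.
  rewrite (gip_gD _ _ (gsm_fib (sc p))) (br_metric p (toF sc) (toF sa) (toF sb)).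
  rewrite (gip_gprl BF (gsm_fib (br_sec (toF sa) (toF sb) p)) (gsm_fib (sc p))) [gip _ (c p)]gipC.
  rewrite (gip_br p sa sb sc).
  rewrite (gip_gprl AF (gsm_fib (br_sec (toF sc) (toF sa) p)) (gsm_fib (sb p))).
  rewrite (gip_gprr AF (gsm_fib (br_sec (toF sc) (toF sb) p)) (gsm_fib (sa p))).
  by field.
Qed.

(** [A] is integrable, so the bracket has no vector part in [B]. *)
Lemma skew_part_vec0 a b p : gsm X A p a -> gsm X A p b -> (skew_part B a b p).1 = 0.
Proof.
move=> sa sb.
change (apr B (br a b p).1 - 2^-1 *: (0 : T) = 0).
rewrite scaler0 subr0 tbr1; have := asec_at (asec_lie (gsm_asec sa) (gsm_asec sb)).
move=> <-; have [BF' ->] := opposite_sym AB; exact: apr_conj.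
Qed.

(** The symmetric part subtracted in [skew_part] is added back in [omega12]. *)
Lemma omega12E a1 a2 : omega12 (E1 := E1) (E2 := E2) (skew_part B) a1 a2 =
  (fun p => gpr B (br a1 a2 p)).
Proof.
apply/funext => p; rewrite /omega12 cD_twisted /skew_part.
exact: subrK.
Qed.

Lemma br_jac s t r p : sec Full s -> sec Full t -> sec Full r ->
  br s (br t r) p = br (br s t) r p + br t (br s r) p.
Proof.
move=> ss st sr; rewrite tbrE.
exact: (cou_jacobi full_courant (iffRL (secP _ _) ss) (iffRL (secP _ _) st) (iffRL (secP _ _) sr)).
Qed.

(** A mixed bracket is the difference of the two connections, by [br_skew]. *)
Lemma br_mixed a al : sec A a -> sec B al ->
  br al a = (fun q => gpr A (br al a q) - gpr B (br a al q)).
Proof.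
move=> sa sb; apply/funext => p.
rewrite (br_skew p sa sb) gprN opprK gprAB//.
exact: br_sec (toF sb) (toF sa) p.
Qed.

Lemma derivation_rearrange (V : zmodType) (b c1 c2 d1 d2 M D : V) :
  b + (M + D) = c1 - d1 + (c2 + d2) -> b - c1 - c2 - d2 + d1 = - M - D.
Proof.
move/(canRL (addrK _)) => ->.
have -> (x : V) : x - c1 - c2 - d2 + d1 = x - (c1 - d1 + (c2 + d2)).
  by rewrite !opprD opprK !addrA [LHS](addrAC _ _ d1) [in LHS](addrAC _ _ d1).
by rewrite addrAC subrr add0r opprD.
Qed.

Lemma gpr_split D (x1 x2 y1 y2 z1 z2 : G) : x1 + x2 = y1 - y2 + (z1 + z2) ->
  gpr D x1 + gpr D x2 = gpr D y1 - gpr D y2 + (gpr D z1 + gpr D z2).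
Proof. by rewrite -gprN -!gprD => ->. Qed.

(** Names for the components of the mixed brackets, which are at the same time
    the values of the two connections; identities between connections thus
    become identities between components of brackets. *)
Lemma mixed_components a al : sec A a -> sec B al -> exists u v,
  [/\ sec B u, sec A v, fwd a al = u & bwd al a = v] /\
  [/\ br a al = (fun q => u q - v q), br al a = (fun q => v q - u q),
      forall q, gpr B (br a al q) = u q & forall q, gpr A (br al a q) = v q].
Proof.
move=> sa sb; have sba := br_sec (toF sb) (toF sa); have sab := br_sec (toF sa) (toF sb).
exists (fun q => gpr B (br a al q)), (fun q => gpr A (br al a q)); split; split=> //.
- exact: gpr_sec.
- exact: gpr_sec.
- exact: fwdE.
- exact: bwdE.
- apply/funext => q; rewrite -[LHS](gprAB (sab q)) [X in gpr A X](br_skew q sa sb).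
  by rewrite gprN addrC.
- exact: br_mixed.
Qed.

(** Likewise for the bracket of two sections of the same type. *)
Lemma pure_components a b : sec A a -> sec A b -> exists m w,
  [/\ sec A m, sec B w, ca_br (c := E1) a b = m &
      omega12 (E1 := E1) (E2 := E2) (skew_part B) a b = w] /\
  br a b = (fun q => m q + w q).
Proof.
move=> sa sb; have sab := br_sec (toF sa) (toF sb).
exists (fun q => gpr A (br a b q)), (fun q => gpr B (br a b q)); split; first split.
- exact: gpr_sec.
- exact: gpr_sec.
- exact: brAE.
- exact: omega12E.
- exact: gprAB_fun.
Qed.

(** The [A]-component of the Jacobi identity of the full bracket for [al],
    [a1] and [a2]. *)
Lemma derivation_cond :
  derivation_condition (E1 := E1) (E2 := E2) fwd bwd (skew_part B) (skew_part A).
Proof.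
move=> a1 a2 al /secP s1 /secP s2 /secP sl p.
have F1 := toF s1; have F2 := toF s2; have Fl := toF sl.
have [m [w [[sm sw -> ->] e12]]] := pure_components s1 s2.
have [u1 [v1 [[su1 sv1 -> ->] [_ e1 _ _]]]] := mixed_components s1 sl.
have [u2 [v2 [[su2 sv2 -> ->] [_ e2 _ _]]]] := mixed_components s2 sl.
rewrite (bwdE sm sl) (brAE sv1 s2) (brAE s1 sv2) (bwdE s1 su2) (bwdE s2 su1) cD_twisted.
apply: derivation_rearrange; rewrite /skew_part subrK.
apply: gpr_split.
rewrite -(brDr p Fl (toF sm) (toF sw)) -e12 -(brBl p (toF sv1) (toF su1) F2) -e1.
have <- : br a1 (br al a2) p = br a1 v2 p + br u2 a1 p.
  by rewrite e2 (brBr p F1 (toF sv2) (toF su2)) (br_skew p s1 su2) opprK.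
exact: br_jac.
Qed.

Lemma pure_components_r al be : sec B al -> sec B be -> exists z y,
  [/\ sec B z, sec A y & ca_br (c := E2) al be = z] /\
  br al be = (fun q => y q + z q).
Proof.
move=> sa sb; have sab := br_sec (toF sa) (toF sb).
exists (fun q => gpr B (br al be q)), (fun q => gpr A (br al be q)); split; first split.
- exact: gpr_sec.
- exact: gpr_sec.
- exact: brBE.
- exact: gprAB_fun.
Qed.

Lemma gip_sec_orth a al p : sec A a -> sec B al -> gip (al p) (a p) = 0.
Proof. by move=> sa sl; rewrite gipC; exact: gip0. Qed.

(** The Jacobi identity of the full bracket for [a1], [a2] and [al1], paired
    with [al2]. The terms that are not in the first curvature are moved to the
    other side by [gip_br] and the invariance of the metric, where they make
    up the second curvature. *)
Lemma curvature_cond a1 a2 al1 al2 p : sections E1 a1 -> sections E1 a2 ->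
  sections E2 al1 -> sections E2 al2 ->
  ipf (E := E2) (curvature (E := E1) (V := gtb X B) fwd a1 a2 al1) al2 p +
  ipf (E := E1) (curvature (E := E2) (V := gtb X A) bwd al1 al2 a1) a2 p = 0.
Proof.
move=> /secP s1 /secP s2 /secP t1 /secP t2.
have F1 := toF s1; have F2 := toF s2; have G1 := toF t1; have G2 := toF t2.
rewrite /ipf /curvature.
have [z [y [[sz sy ->] ez]]] := pure_components_r t1 t2.
have [m [w [[sm sw -> _] e12]]] := pure_components s1 s2.
have [u11 [v11 [[su11 sv11 -> ->] [e11 _ _ k11]]]] := mixed_components s1 t1.
have [u21 [v21 [[su21 sv21 -> _] [e21 f21 _ k21]]]] := mixed_components s2 t1.
have [u12 [v12 [[su12 sv12 _ ->] [_ _ _ k12]]]] := mixed_components s1 t2.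
have [u22 [v22 [[su22 sv22 _ _] [_ f22 _ k22]]]] := mixed_components s2 t2.
rewrite (fwdE s1 su21) (fwdE s2 su11) (fwdE sm t1) (bwdE sv12 t1) (bwdE sv11 t2) (bwdE s1 sz).
have Fw := toF sw; have Fv11 := toF sv11; have Fv12 := toF sv12.
have Fb s t : sec Full s -> sec Full t -> gtb_fib Full (br s t p).
  by move=> ss st; exact: gsm_fib (br_sec ss st p).
have B2 := gsm_fib (t2 p); have B2F := fib_full B2.
have A2 := gsm_fib (s2 p); have A2F := fib_full A2.
(* pair the Jacobi identity for [a1], [a2], [al1] with [al2] *)
have J : gip (br a1 u21 p) (al2 p) - gip (br a1 v21 p) (al2 p) =
    gip (br m al1 p) (al2 p) + gip (br w al1 p) (al2 p) +
    (gip (br a2 u11 p) (al2 p) - gip (br a2 v11 p) (al2 p)).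
  rewrite -!(gipBl _ _ B2F) -!(gipDl _ _ B2F).
  rewrite -(brBr p F1 (toF su21) (toF sv21)) -(brDl p (toF sm) Fw G1).
  rewrite -(brBr p F2 (toF su11) Fv11) -e21 -e12 -e11.
  by rewrite -(br_jac p F1 F2 G1).
have P1 : gip (br a1 v21 p) (al2 p) = gip (v12 p) (v21 p).
  by rewrite gipC (gip_br p s1 sv21 t2) k12.
have P2 : gip (br a2 v11 p) (al2 p) = gip (v22 p) (v11 p).
  by rewrite gipC (gip_br p s2 sv11 t2) k22.
(* [w] pairs with [B + B*] as the bracket of [a1] and [a2] does *)
have wE c q : sec B c -> gip (w q) (c q) = gip (gpr A (br c a1 q)) (a2 q).
  move=> sc; rewrite -(gip_br q s1 s2 sc) e12 gipC [RHS]gipC.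
  rewrite (gipDl _ _ (fib_full (gsm_fib (sc q)))) (gip0 (sm q) (sc q)) add0r.
  exact: gipC.
have w1 : (fun q => gip (w q) (al1 q)) = (fun q => gip (v11 q) (a2 q)).
  by apply/funext => q; rewrite (wE _ _ t1) k11.
have w2 : (fun q => gip (w q) (al2 q)) = (fun q => gip (v12 q) (a2 q)).
  by apply/funext => q; rewrite (wE _ _ t2) k12.
have P3 : gip (br w al1 p) (al2 p) + gip (br al1 w p) (al2 p) =
    vder p (al2 p).1 (fun q => gip (v11 q) (a2 q)).
  rewrite -(gipDl _ _ B2F) (tbr_sym hH (@full_typed _ _ _ H) (Fw p) (G1 p)) gipC.
  by rewrite (gip_gD _ _ B2F) w1.
have P4 : vder p (al1 p).1 (fun q => gip (v12 q) (a2 q)) =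
    gip (br al1 w p) (al2 p) + gip (gpr A (br z a1 p)) (a2 p).
  rewrite -w2 (br_metric p G1 Fw G2) ez -(wE z p sz); congr (_ + _).
  rewrite gipC (gipDl _ _ (gsm_fib (Fw p))) (gip0 (sy p) (sw p)) add0r.
  exact: gipC.
have P5 : vder p (al2 p).1 (fun q => gip (v11 q) (a2 q)) =
    gip (br al2 v11 p) (a2 p) + gip (v11 p) (v22 p).
  rewrite (br_metric p G2 Fv11 F2) f22; congr (_ + _).
  rewrite gipC (gipBl _ _ (gsm_fib (Fv11 p))) (gip_sec_orth p sv11 su22) subr0.
  exact: gipC.
have P6 : vder p (al1 p).1 (fun q => gip (v12 q) (a2 q)) =
    gip (br al1 v12 p) (a2 p) + gip (v12 p) (v21 p).
  rewrite (br_metric p G1 Fv12 F2) f21; congr (_ + _).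
  rewrite gipC (gipBl _ _ (gsm_fib (Fv12 p))) (gip_sec_orth p sv12 su21) subr0.
  exact: gipC.
change (gip (gpr B (br a1 u21 p) - gpr B (br a2 u11 p) - gpr B (br m al1 p)) (al2 p) +
  gip (gpr A (br al1 v12 p) - gpr A (br al2 v11 p) - gpr A (br z a1 p)) (a2 p) = 0).
rewrite !(gipBl _ _ B2F) !(gipBl _ _ A2F).
rewrite (gip_gprl BF (Fb _ _ F1 (toF su21)) B2) (gip_gprl BF (Fb _ _ F2 (toF su11)) B2).
rewrite (gip_gprl BF (Fb _ _ (toF sm) G1) B2).
rewrite (gip_gprl AF (Fb _ _ G1 Fv12) A2) (gip_gprl AF (Fb _ _ G2 Fv11) A2).
move/(canRL (addrK _)) : P3 => P3; move/esym/(canRL (addrK _)) : P4 => P4.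
move/(canRL (subrK _)) : J => J.
rewrite J P3 P4 P5 P6 P1 P2 (gipC (v22 p)).
by ring.
Qed.

End OnePair.
End MatchedAlgebra.

Section Assembly.
Variables (R : realType) (n : nat) (X : complex_manifold R n).
Local Notation C := R[i].
Local Notation T := 'rV[C]_(n + n).
Local Notation G := (T * (T -> C^o))%type.
Implicit Types (p q : X) (f : X -> C).
Variables (H : form3 X) (hH : is_form3 H).
Hypothesis H_closed : forall p u v w x, d3 H p u v w x = 0.

(** On vectors of [A], extended with constant coefficients, [h] and [H] have
    the same values near [p]. *)
Lemma d3_component A (h : form3 X) p u v w x : form_component A A A H h ->
  afib A u -> afib A v -> afib A w -> afib A x -> d3 h p u v w x = 0.
Proof.
move=> [Hh _] uA vA wA xA; rewrite -(H_closed p u v w x) /d3 -vderE.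
have dp := chart_at_dom p; set c := chart_at p in dp *.
have cA q y : mf_dom c q -> afib A y -> afib A (tconst c q y).
  by move=> dq /apr_id yA; apply/afibP; rewrite -apr_tconst// yA.
have E y1 y2 y3 : afib A y1 -> afib A y2 -> afib A y3 -> \forall q \near p,
    h q (tconst c q y1) (tconst c q y2) (tconst c q y3) =
    H q (tconst c q y1) (tconst c q y2) (tconst c q y3).
  move=> A1 A2 A3; apply: filterS (dom_near dp) => q dq.
  by rewrite (Hh q _ _ _ (cA q _ dq A1) (cA q _ dq A2) (cA q _ dq A3)).
by rewrite (der_eq _ (E v w x vA wA xA)) (der_eq _ (E u w x uA wA xA))
  (der_eq _ (E u v x uA vA xA)) (der_eq _ (E u v w uA vA wA)).
Qed.

Lemma component_courant A (h : form3 X) : is_form3 h -> form_component A A A H h ->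
  is_courant (twisted A h).
Proof.
move=> hh ch; apply: (twisted_courant hh); first by case: ch.
by move=> p u v w x; exact: d3_component.
Qed.

Variables (A B : algebroid) (AB : opposite A B).
Variables (hA hB kAB kBA : form3 X).
Hypotheses (fA : is_form3 hA) (fB : is_form3 hB).
Hypothesis fBA : is_form3 kBA.
Hypotheses (cA : form_component A A A H hA) (cB : form_component B B B H hB).
Hypotheses (cAB : form_component A B B H kAB) (cBA : form_component B A A H kBA).

(** The cyclic conditions on the skew maps hold term by term: the skew maps
    have no vector part, and [nabla] only depends on that part. *)
Lemma skew_part_nabla0 a1 a2 a3 p : sections (gtb X A) a1 -> sections (gtb X A) a2 ->
  sections (gtb X A) a3 -> nabla B A kBA (skew_part H B a1 a2) a3 p = 0.
Proof.
move=> /secP s1 /secP s2 /secP s3.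
apply: (@nabla_vec0 _ _ _ B A kBA fBA _ _ p _ (s3 p)) => q.
exact: (skew_part_vec0 H AB).
Qed.

End Assembly.

Section MatchedPair.
Variables (R : realType) (n : nat) (X : complex_manifold R n).
Variables (H : form3 X) (hH : is_form3 H).
Hypothesis H_closed : forall p u v w x, d3 H p u v w x = 0.
Variables (A B : algebroid) (AB : opposite A B).
Variables (hA hB kAB kBA : form3 X).
Hypotheses (fA : is_form3 hA) (fB : is_form3 hB).
Hypotheses (fAB : is_form3 kAB) (fBA : is_form3 kBA).
Hypotheses (cA : form_component A A A H hA) (cB : form_component B B B H hB).
Hypotheses (cAB : form_component A B B H kAB) (cBA : form_component B A A H kBA).

Theorem opposite_matched_pair :
  @matched_pair R (n + n) X (twisted A hA) (twisted B hB) (nabla A B kAB) (nabla B A kBA)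
    (skew_part H B) (skew_part H A).
Proof.
have BA := opposite_sym AB; split.
- exact: (component_courant H_closed fA cA).
- exact: (component_courant H_closed fB cB).
- exact: (fwd_connection hH H_closed AB hA cAB).
- exact: (fwd_connection hH H_closed BA hB cBA).
- exact: (fwd_preserves_metric hH AB cAB).
- exact: (fwd_preserves_metric hH BA cBA).
- by move=> f be sf sb p; exact: (fwd_cD A hA fAB p sf sb).
- by move=> f be sf sb p; exact: (fwd_cD B hB fBA p sf sb).
- exact: (skew_part_skew_map hH AB hB cBA).
- exact: (skew_part_skew_map hH BA hA cAB).
- exact: (derivation_cond hH H_closed AB fA cA cAB cBA).
- exact: (derivation_cond hH H_closed BA fB cB cBA cAB).
- by move=> a1 a2 al1 al2 s1 s2 t1 t2 p; exact: (curvature_cond hH H_closed AB fA fB cA cB cAB cBA).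
- by move=> a1 a2 a3 s1 s2 s3 p; rewrite !(skew_part_nabla0 H AB fBA)// !addr0.
- by move=> a1 a2 a3 s1 s2 s3 p; rewrite !(skew_part_nabla0 H BA fAB)// !addr0.
Qed.

End MatchedPair.

(** * Transport of the Courant algebroid axioms *)

Section Bundles.
Variables (R : realType) (m : nat) (M : manifold R m).
Local Notation C := R[i].
Implicit Types (p q : M) (E F : vbundle M).

Lemma vbundle_fib_lin E p (a : C) (u v : vb_amb E) : is_vbundle E ->
  vb_fib p u -> vb_fib p v -> vb_fib p (a *: u + v).
Proof.
move=> /(_ p)[r [e /nbhs_singleton[fibE _ _]]] /fibE[c ->] /fibE[d ->].
apply/fibE; exists (a *: c + d); rewrite scaler_sumr -big_split/=.
by apply: eq_bigr => k _; rewrite !mxE scalerDl scalerA.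
Qed.

Lemma vbundle_fib0 E p : is_vbundle E -> vb_fib p (0 : vb_amb E).
Proof.
move=> /(_ p)[r [e /nbhs_singleton[fibE _ _]]]; apply/fibE; exists 0.
by rewrite big1// => k _; rewrite mxE scale0r.
Qed.

Lemma vbundle_fibZ E p (a : C) (u : vb_amb E) : is_vbundle E ->
  vb_fib p u -> vb_fib p (a *: u).
Proof.
by move=> bE fu; rewrite -[_ *: _]addr0; apply: vbundle_fib_lin => //; exact: vbundle_fib0.
Qed.

Lemma vbundle_fibD E p (u v : vb_amb E) : is_vbundle E ->
  vb_fib p u -> vb_fib p v -> vb_fib p (u + v).
Proof. by move=> bE fu fv; rewrite -[u]scale1r; exact: vbundle_fib_lin. Qed.

Lemma vbundle_smooth_fib E p (s : M -> vb_amb E) : is_vbundle E ->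
  vb_smooth p s -> \forall q \near p, vb_fib q (s q).
Proof.
move=> /(_ p)[r [e He]]; have [_ _ smE] := nbhs_singleton He.
move=> /smE[c [_ sE]]; apply: filterS2 He sE => q [fibE _ _] ->.
by apply/fibE; exists (c q).
Qed.

Lemma vbundle_smooth_lin E p (f : M -> C) (s t : M -> vb_amb E) : is_vbundle E ->
  smooth_at p f -> vb_smooth p s -> vb_smooth p t ->
  vb_smooth p (fun q => f q *: s q + t q).
Proof.
move=> /(_ p)[r [e /nbhs_singleton[_ _ smE]]] sf /smE[c [sc cE]] /smE[d [sd dE]].
apply/smE; exists (fun q => f q *: c q + d q); split.
  move=> k; apply: smooth_at_eq (smooth_atD (smooth_atM sf (sc k)) (sd k)).
  by apply: nearW => q; rewrite !mxE.
apply: filterS2 cE dE => q -> ->; rewrite scaler_sumr -big_split/=.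
by apply: eq_bigr => k _; rewrite !mxE scalerDl scalerA.
Qed.

(** Concatenate local frames of the two bundles. *)
Lemma vb_sum_vbundle E F : is_vbundle E -> is_vbundle F -> is_vbundle (vb_sum E F).
Proof.
move=> bE bF p; have [r [e He]] := bE p; have [t [g Hg]] := bF p.
pose h (k : 'I_(r + t)) q : vb_amb (vb_sum E F) :=
  match fintype.split k with inl a => (e a q, 0) | inr b => (0, g b q) end.
have hE q (c : 'rV[C]_(r + t)) : \sum_k c 0 k *: h k q =
    (\sum_a (lsubmx c) 0 a *: e a q, \sum_b (rsubmx c) 0 b *: g b q).
  rewrite big_split_ord/= /h.
  under eq_bigr => a _ do rewrite (unsplitK (inl a)).
  under [X in _ + X]eq_bigr => b _ do rewrite (unsplitK (inr b)).
  have fst_sum k (G : 'I_k -> vb_amb (vb_sum E F)) : (\sum_i G i).1 = \sum_i (G i).1.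
    by elim/big_rec2: _ => // i x y _ <-.
  have snd_sum k (G : 'I_k -> vb_amb (vb_sum E F)) : (\sum_i G i).2 = \sum_i (G i).2.
    by elim/big_rec2: _ => // i x y _ <-.
  rewrite [LHS]surjective_pairing; congr pair.
    change ((\sum_(a < r) (c 0 (lshift t a) *: (e a q, 0 : vb_amb F) : vb_amb (vb_sum E F))).1 +
      (\sum_(b < t) (c 0 (rshift r b) *: (0 : vb_amb E, g b q) : vb_amb (vb_sum E F))).1 =
      \sum_(a < r) lsubmx c 0 a *: e a q).
    rewrite !fst_sum [X in _ + X]big1 ?addr0; last by move=> b _; exact: scaler0.
    by apply: eq_bigr => a _; rewrite [lsubmx _ _ _]mxE.
  change ((\sum_(a < r) (c 0 (lshift t a) *: (e a q, 0 : vb_amb F) : vb_amb (vb_sum E F))).2 +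
      (\sum_(b < t) (c 0 (rshift r b) *: (0 : vb_amb E, g b q) : vb_amb (vb_sum E F))).2 =
      \sum_(a < t) rsubmx c 0 a *: g a q).
  rewrite !snd_sum [X in X + _]big1 ?add0r; last by move=> b _; exact: scaler0.
  by apply: eq_bigr => a _; rewrite [rsubmx _ _ _]mxE.
exists (r + t)%N, h; apply: filterS2 He Hg => q [fE iE sE] [fF iF sF]; split.
- move=> v; split=> [[/fE[c vc] /fF[d vd]]|[c ->]].
    by exists (row_mx c d); rewrite hE row_mxKl row_mxKr -vc -vd -surjective_pairing.
  by rewrite hE; split=> /=; [apply/fE; exists (lsubmx c)|apply/fF; exists (rsubmx c)].
- move=> c; rewrite hE => -[/iE c1 /iF c2].
  by rewrite -[c]hsubmxK c1 c2 row_mx0.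
- move=> s; split=> [[/sE[c [sc cE]] /sF[d [sd dE]]]|[c [sc cE]]].
    exists (fun q' => row_mx (c q') (d q')); split.
      move=> k; rewrite -[k]splitK; case: (fintype.split k) => [a|b] /=.
        by apply: smooth_at_eq (sc a); apply: nearW => q'; rewrite row_mxEl.
      by apply: smooth_at_eq (sd b); apply: nearW => q'; rewrite row_mxEr.
    apply: filterS2 cE dE => q' cE' dE'.
    by rewrite hE row_mxKl row_mxKr -cE' -dE' -surjective_pairing.
  split.
    apply/sE; exists (fun q' => lsubmx (c q')); split.
      by move=> k; apply: smooth_at_eq (sc (lshift t k)); apply: nearW => q'; rewrite mxE.
    by apply: filterS cE => q' ->; rewrite hE.
  apply/sF; exists (fun q' => rsubmx (c q')); split.
    by move=> k; apply: smooth_at_eq (sc (rshift r k)); apply: nearW => q'; rewrite mxE.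
  by apply: filterS cE => q' ->; rewrite hE.
Qed.

End Bundles.

Section Transport.
Variables (R : realType) (m : nat) (M : manifold R m).
Local Notation C := R[i].
Variables (E F : courant M) (Phi : M -> vb_amb E -> vb_amb F).
Hypotheses (cF : is_courant F) (bE : is_vbundle E) (iso : is_courant_iso Phi).
Hypothesis br_fib : forall s t, sections E s -> sections E t ->
  forall p, vb_fib p (ca_br (c := E) s t p).
Implicit Types (p q : M) (s t : M -> vb_amb E).

Let bF := cou_bundle cF.

Lemma iso_fib p (u : vb_amb E) : vb_fib p u -> vb_fib p (Phi p u).
Proof. by have [+ _ _] := iso_bij iso p; apply. Qed.

Lemma iso_injE p (u v : vb_amb E) : vb_fib p u -> vb_fib p v -> Phi p u = Phi p v -> u = v.
Proof. by have [_ + _] := iso_bij iso p => inj fu fv; apply: inj; exact/mem_set. Qed.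

Lemma iso_surjE p (w : vb_amb F) : vb_fib p w -> exists2 u, vb_fib p u & Phi p u = w.
Proof. by have [_ _ +] := iso_bij iso p => surj fw; have [u fu uw] := surj _ fw; exists u. Qed.

Lemma iso0 p : Phi p 0 = 0.
Proof.
have f0 := vbundle_fib0 p bE; have := iso_linear iso (-1) f0 f0.
by rewrite scaler0 addr0 scaleN1r addNr.
Qed.

Lemma isoZ p (a : C) (u : vb_amb E) : vb_fib p u -> Phi p (a *: u) = a *: Phi p u.
Proof.
by move=> fu; have := iso_linear iso a fu (vbundle_fib0 p bE); rewrite iso0 !addr0.
Qed.

Lemma isoD p (u v : vb_amb E) : vb_fib p u -> vb_fib p v -> Phi p (u + v) = Phi p u + Phi p v.
Proof. by move=> fu fv; have := iso_linear iso 1 fu fv; rewrite !scale1r. Qed.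

Lemma iso_sections s : sections E s -> sections F (fun q => Phi q (s q)).
Proof.
move=> ss p; have [fs sm] := ss p; split; first exact: iso_fib.
by apply/(iso_smooth iso) => //; apply: nearW => q; have [] := ss q.
Qed.

Lemma iso_br_fun s t : sections E s -> sections E t ->
  (fun p => Phi p (ca_br s t p)) =
  ca_br (fun q => Phi q (s q)) (fun q => Phi q (t q)).
Proof. by move=> ss st; apply/funext => p; exact: iso_br. Qed.

Lemma br_sectionE s t : sections E s -> sections E t -> sections E (ca_br s t).
Proof.
move=> ss st p; split; first exact: br_fib.
have fn : \forall q \near p, vb_fib q (ca_br s t q) by apply: nearW => q; exact: br_fib.
apply/(iso_smooth iso fn); rewrite (iso_br_fun ss st).
by have [] := cou_br_section cF (iso_sections ss) (iso_sections st) p.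
Qed.

Lemma iso_ipf s t : sections E s -> sections E t ->
  ipf (E := F) (fun q => Phi q (s q)) (fun q => Phi q (t q)) = ipf s t.
Proof.
by move=> ss st; apply/funext => p; apply: (iso_ip iso); [have [] := ss p|have [] := st p].
Qed.

Lemma iso_anch s f p : sections E s ->
  anch (E := F) (fun q => Phi q (s q)) f p = anch s f p.
Proof. by move=> ss; rewrite /anch (iso_anchor iso)//; have [] := ss p. Qed.

(** [cD] is given by a choice with default value [0], hence the hypothesis
    that the element to be chosen exists in [F]. *)
Lemma iso_cD f p : (exists e, vb_fib p e /\
    forall v, vb_fib p v -> ca_ip (c := F) p e v = der p (ca_anchor p v) f) ->
  vb_fib p (cD E f p) /\ Phi p (cD E f p) = cD F f p.
Proof.
move=> [e [fe eD]].
have [u fu ue] := iso_surjE fe.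
have uD : [set e | vb_fib p e /\
    forall v, vb_fib p v -> ca_ip (c := E) p e v = der p (ca_anchor p v) f] u.
  split=> // v fv; rewrite -(iso_ip iso fu fv) ue eD; last exact: iso_fib.
  by rewrite (iso_anchor iso).
have uE : cD E f p = u.
  apply: xget_unique => // w [fw wD]; apply: (iso_injE fw fu); rewrite ue.
  apply/eqP; rewrite -subr_eq0; apply/eqP.
  have fPw := iso_fib fw.
  have fd : vb_fib p (Phi p w - e).
    by rewrite addrC -scaleN1r; exact: vbundle_fib_lin.
  apply: (cou_ip_nondeg cF fd) => v fv.
  rewrite addrC -scaleN1r (cou_ip_linear cF)// eD//.
  have [v' fv' <-] := iso_surjE fv.
  rewrite (iso_ip iso fw fv') wD// (iso_anchor iso)// mulN1r.
  exact: addNr.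
rewrite uE; split=> //; rewrite ue; apply/esym.
apply: xget_unique => // w [fw wD].
apply/eqP; rewrite -subr_eq0; apply/eqP.
have fd : vb_fib p (w - e) by rewrite addrC -scaleN1r; exact: vbundle_fib_lin.
apply: (cou_ip_nondeg cF fd) => v fv.
rewrite addrC -scaleN1r (cou_ip_linear cF)// eD// wD// mulN1r.
exact: addNr.
Qed.

Lemma sections_lin f s t : smooth f -> sections E s -> sections E t ->
  sections E (fun q => f q *: s q + t q).
Proof.
move=> sf ss st p; have [fs sms] := ss p; have [ft smt] := st p.
by split; [exact: vbundle_fib_lin|exact: vbundle_smooth_lin].
Qed.

Lemma sections0 : sections E (fun=> 0).
Proof.
move=> p; split; first exact: vbundle_fib0.
have [r [e /nbhs_singleton[_ _ smE]]] := bE p.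
apply/smE; exists (fun=> 0); split.
  by move=> k; have := @smooth_at_cst _ _ M p 0; apply: smooth_at_eq; apply: nearW => q; rewrite mxE.
by apply: nearW => q; rewrite big1// => k _; rewrite mxE scale0r.
Qed.

Lemma sectionsZ f s : smooth f -> sections E s -> sections E (fun q => f q *: s q).
Proof.
move=> sf ss; have := sections_lin sf ss sections0.
by congr (sections E _); apply/funext => q; rewrite addr0.
Qed.

(** Each axiom of [E] becomes an axiom of [F] under the fibrewise injective
    map [Phi]. *)
Lemma courant_transport :
  (forall f p, exists e, vb_fib p e /\
    forall v, vb_fib p v -> ca_ip (c := F) p e v = der p (ca_anchor p v) f) ->
  is_courant E.
Proof.
move=> D_ex.
have smF p s : vb_smooth p s -> vb_smooth (v := F) p (fun q => Phi q (s q)).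
  by move=> ss; apply/(iso_smooth iso) => //; exact: vbundle_smooth_fib.
have secf s p : sections E s -> vb_fib p (s p) by move=> /(_ p)[].
have cst (a : C) : smooth (fun _ : M => a) by move=> p; exact: smooth_at_cst.
have Plin f s s' : sections E s -> sections E s' ->
    (fun q => Phi q (f q *: s q + s' q)) = (fun q => f q *: Phi q (s q) + Phi q (s' q)).
  by move=> ss ss'; apply/funext => q; apply: (iso_linear iso); exact: secf.
have PZ f s : sections E s ->
    (fun q => Phi q (f q *: s q)) = (fun q => f q *: Phi q (s q)).
  by move=> ss; apply/funext => q; apply: isoZ; exact: secf.
have isec := iso_sections.
split.
- exact: bE.
- move=> p a u v w fu fv fw.
  rewrite -!(iso_ip iso)//; last exact: vbundle_fib_lin.
  by rewrite (iso_linear iso)// (cou_ip_linear cF)//; exact: iso_fib.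
- by move=> p u v fu fv; rewrite -!(iso_ip iso)// (cou_ip_sym cF)//; exact: iso_fib.
- move=> p u fu H; apply: (iso_injE fu (vbundle_fib0 p bE)); rewrite iso0.
  apply: (cou_ip_nondeg cF (iso_fib fu)) => v /iso_surjE[v' fv' <-].
  by rewrite (iso_ip iso)// H.
- move=> p s t ss st.
  apply: smooth_at_eq (cou_ip_smooth cF (smF _ _ ss) (smF _ _ st)).
  apply: filterS2 (vbundle_smooth_fib bE ss) (vbundle_smooth_fib bE st) => q fs ft.
  exact: (iso_ip iso).
- move=> p a u v fu fv; rewrite -!(iso_anchor iso)//; last exact: vbundle_fib_lin.
  by rewrite (iso_linear iso)// (cou_anchor_linear cF)//; exact: iso_fib.
- move=> p s ss; apply: vec_smooth_eq (cou_anchor_smooth cF (smF _ _ ss)).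
  by apply: filterS (vbundle_smooth_fib bE ss) => q; exact: (iso_anchor iso).
- exact: br_sectionE.
- move=> a s s' t ss ss' st p.
  have sas := sections_lin (cst a) ss ss'.
  have f1 := br_fib ss st p; have f2 := br_fib ss' st p.
  apply: (iso_injE (br_fib sas st p)); first exact: vbundle_fib_lin.
  rewrite (iso_linear iso)// !(iso_br iso)// (Plin (fun=> a))//.
  exact: (cou_br_linear1 cF a (isec _ ss) (isec _ ss') (isec _ st)).
- move=> a s t t' ss st st' p.
  have sat := sections_lin (cst a) st st'.
  have f1 := br_fib ss st p; have f2 := br_fib ss st' p.
  apply: (iso_injE (br_fib ss sat p)); first exact: vbundle_fib_lin.
  rewrite (iso_linear iso)// !(iso_br iso)// (Plin (fun=> a))//.
  exact: (cou_br_linear2 cF a (isec _ ss) (isec _ st) (isec _ st')).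
- move=> s t r ss st sr p.
  have str := br_sectionE st sr; have sst := br_sectionE ss st; have ssr := br_sectionE ss sr.
  have f1 := br_fib sst sr p; have f2 := br_fib st ssr p.
  apply: (iso_injE (br_fib ss str p)); first exact: vbundle_fibD.
  rewrite isoD// !(iso_br iso)// !iso_br_fun//.
  exact: (cou_jacobi cF (isec _ ss) (isec _ st) (isec _ sr)).
- move=> f s t sf ss st p.
  have sft := sectionsZ sf st; have f1 := br_fib ss st p; have f2 := secf _ p st.
  apply: (iso_injE (br_fib ss sft p)).
    by apply: vbundle_fib_lin => //; exact: vbundle_fibZ.
  rewrite (iso_linear iso)//; last exact: vbundle_fibZ.
  rewrite (isoZ _ f1) !(iso_br iso)// PZ// -(iso_anch _ _ ss).
  exact: (cou_leibniz cF sf (isec _ ss) (isec _ st)).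
- move=> s ss p; have [fD PD] := iso_cD (D_ex (ipf s s) p).
  apply: (iso_injE (br_fib ss ss p)); first exact: vbundle_fibZ.
  rewrite (isoZ _ fD) (iso_br iso)// PD -(iso_ipf ss ss).
  exact: (cou_square cF (isec _ ss)).
- move=> s t ss st p; rewrite -(iso_anch _ _ ss) -(iso_ipf st st).
  rewrite -(iso_ipf (br_sectionE ss st) st) (iso_br_fun ss st).
  exact: (cou_metric cF (isec _ ss) (isec _ st)).
Qed.

End Transport.

(** * The matched sum *)

Section HalfBracket.
Variables (R : realType) (n : nat) (X : complex_manifold R n).
Local Notation C := R[i].
Local Notation T := 'rV[C]_(n + n).
Local Notation G := (T * (T -> C^o))%type.
Variables (H : form3 X) (hH : is_form3 H).
Hypothesis H_closed : forall p u v w x, d3 H p u v w x = 0.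
Variables (A B : algebroid) (AB : opposite A B).
Variables (hA hB kBA : form3 X).
Hypotheses (fA : is_form3 hA).
Hypotheses (cA : form_component A A A H hA) (cBA : form_component B A A H kBA).
Local Notation br := (tbr Full H).
Local Notation sec A s := (forall p, gsm X A p s).
Local Notation E1 := (twisted A hA).
Local Notation E2 := (twisted B hB).

(** Expand the full bracket of two sums: the pure terms are the bracket of
    [E1] and [Mho] with its symmetric part, the mixed ones are connections by
    [br_skew]. *)
Lemma half_bracket a b al be p : sec A a -> sec A b -> sec B al -> sec B be ->
  ca_br (c := E1) a b p + nabla B A kBA al b p - nabla B A kBA be a p
    + skew_part H A al be p + 2^-1 *: cD E1 (ipf (E := E2) al be) p =
  gpr A (br (fun q => a q + al q) (fun q => b q + be q) p).
Proof.
move=> sa sb sl se.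
have Fa := toF sa; have Fb := toF sb; have Fl := toF sl; have Fe := toF se.
rewrite (brAE hH fA cA sa sb) (bwdE hH AB cBA sb sl) (bwdE hH AB cBA sa se) cD_twisted.
rewrite (brDr hH p _ Fb Fe); last by move=> q; exact: gsmD.
rewrite (brDl hH H_closed p Fa Fl Fb) (brDl hH H_closed p Fa Fl Fe).
rewrite (br_skew hH AB p sa se) !gprD gprN.
have E : skew_part H A al be p + 2^-1 *: gD A (ipf (E := E2) al be) p =
    gpr A (br al be p) by exact: subrK.
by rewrite -[LHS]addrA E -[LHS]addrA.
Qed.

End HalfBracket.

Section SumIso.
Variables (R : realType) (n : nat) (X : complex_manifold R n).
Local Notation C := R[i].
Local Notation T := 'rV[C]_(n + n).
Local Notation G := (T * (T -> C^o))%type.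
Implicit Types (p q : X).
Variables (H : form3 X) (hH : is_form3 H).
Hypothesis H_closed : forall p u v w x, d3 H p u v w x = 0.
Variables (A B : algebroid) (AB : opposite A B).
Variables (hA hB kAB kBA : form3 X).
Hypotheses (fA : is_form3 hA) (fB : is_form3 hB).
Hypotheses (cA : form_component A A A H hA) (cB : form_component B B B H hB).
Hypotheses (cAB : form_component A B B H kAB) (cBA : form_component B A A H kBA).

Local Notation br := (tbr Full H).
Local Notation sec A s := (forall p, gsm X A p s).
Local Notation E1 := (twisted A hA).
Local Notation E2 := (twisted B hB).
Local Notation S := (@matched_sum R (n + n) X E1 E2 (nabla A B kAB) (nabla B A kBA)
  (skew_part H B) (skew_part H A)).

Definition sum_map (p : X) (x : vb_amb S) : vb_amb (twisted Full H) := x.1 + x.2.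

Lemma sum_sections (s : X -> vb_amb S) : sections S s ->
  sec A (fun q => (s q).1) /\ sec B (fun q => (s q).2).
Proof. by move=> ss; split=> p; have [_ []] := ss p. Qed.

(** [half_bracket] for both components, with the two types exchanged for the
    second one. *)
Lemma sum_br_eq (s t : X -> vb_amb S) : sections S s -> sections S t -> forall p,
  ca_br s t p = (gpr A (br (fun q => sum_map q (s q)) (fun q => sum_map q (t q)) p),
                 gpr B (br (fun q => sum_map q (s q)) (fun q => sum_map q (t q)) p)).
Proof.
move=> /sum_sections[sa sl] /sum_sections[sb se] p.
have BA := opposite_sym AB.
have h1 := half_bracket hH H_closed AB hB fA cA cBA p sa sb sl se.
have h2 := half_bracket hH H_closed BA hA fB cB cAB p sl se sa sb.
have sumC (x : X -> vb_amb S) : (fun q => (x q).2 + (x q).1 : G) = (fun q => sum_map q (x q)).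
  by apply/funext => q; rewrite addrC.
rewrite !sumC in h2; rewrite -h2 -h1.
by [].
Qed.

Lemma sum_map_sec (s : X -> vb_amb S) : sections S s -> sec Full (fun q => sum_map q (s q)).
Proof.
by move=> /sum_sections[sa sl] p; apply: gsmD; [exact: gsm_toFull (sa p)|exact: gsm_toFull (sl p)].
Qed.

Lemma sum_map_fib p (x : vb_amb S) : vb_fib p x -> gtb_fib Full (sum_map p x).
Proof. by move=> [fx fy]; apply: fibD; [exact: fib_full fx|exact: fib_full fy]. Qed.

Lemma gprA_sum p (x : vb_amb S) : vb_fib p x -> gpr A (sum_map p x) = x.1.
Proof.
move=> [fx fy]; have [AF' E] := AB; rewrite /sum_map gprD (gpr_id fx).
by rewrite (gpr_conj AF') ?addr0// -E.
Qed.

Lemma gprB_sum p (x : vb_amb S) : vb_fib p x -> gpr B (sum_map p x) = x.2.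
Proof.
move=> [fx fy]; have [BF' E] := opposite_sym AB; rewrite /sum_map gprD (gpr_id fy).
by rewrite (gpr_conj BF') ?add0r// -E.
Qed.

Lemma gpr_sumAB (x : G) : gtb_fib Full x -> gpr A x + gpr B x = x.
Proof. by have [AF' ->] := AB; exact: gpr_sum. Qed.

Lemma gip_sum (x1 y1 x2 y2 : G) : gtb_fib A x1 -> gtb_fib A y1 ->
  gtb_fib B x2 -> gtb_fib B y2 -> gip (x1 + x2) (y1 + y2) = gip x1 y1 + gip x2 y2.
Proof.
move=> f1 g1 f2 g2; have [AF' E] := AB; rewrite E in f2 g2.
rewrite (gipDl _ _ (fibD (fib_full g1) (fib_full g2))).
rewrite (gipC x1 (y1 + y2)) (gipC x2 (y1 + y2)).
rewrite (gipDl _ _ (fib_full f1)) (gipDl _ _ (fib_full f2)).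
rewrite (gip_orth AF' g1 f2) (gipC y2 x1) (gip_orth AF' f1 g2) addr0 add0r.
by rewrite (gipC y1 x1) (gipC y2 x2).
Qed.

Lemma sum_map_iso : is_courant_iso sum_map.
Proof.
split.
- by move=> p a u v _ _; rewrite /sum_map/= scalerDr addrACA.
- move=> p; split.
  + by move=> x fx; exact: sum_map_fib fx.
  + move=> x y /set_mem fx /set_mem fy E.
    rewrite [x]surjective_pairing [y]surjective_pairing.
    by rewrite -(gprA_sum fx) -(gprB_sum fx) E (gprA_sum fy) (gprB_sum fy).
  + move=> x fx; exists (gpr A x, gpr B x); last exact: gpr_sumAB.
    by split; exact: gpr_fib.
- move=> p s fs; split=> [[sa sl]|ss].
    by apply: gsmD; [exact: gsm_toFull sa|exact: gsm_toFull sl].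
  split.
    by apply: gsm_eq (gsm_gpr A ss); apply: filterS fs => q; exact: gprA_sum.
  by apply: gsm_eq (gsm_gpr B ss); apply: filterS fs => q; exact: gprB_sum.
- by move=> p u v [fu1 fu2] [fv1 fv2]; exact: gip_sum.
- by [].
- move=> s t ss st p; rewrite (sum_br_eq ss st p) /sum_map/=.
  rewrite gpr_sumAB ?tbrE//; rewrite -tbrE.
  have := br_sec hH (sum_map_sec ss) (sum_map_sec st) p.
  exact: gsm_fib.
Qed.

Lemma matched_sum_courant : is_courant S.
Proof.
apply: (courant_transport _ _ sum_map_iso).
- exact: full_courant.
- by apply: (@vb_sum_vbundle R _ X (gtb X A) (gtb X B)); exact: gtb_vbundle.
- move=> s t ss st p; rewrite (sum_br_eq ss st p).
  have ft := gsm_fib (br_sec hH (sum_map_sec ss) (sum_map_sec st) p).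
  by split; exact: gpr_fib.
- move=> f p; exists (gD Full f p); split; first exact: gD_fib.
  by move=> v fv; rewrite [LHS]gipC [LHS](gip_gD _ _ fv) vderE.
Qed.

End SumIso.

Section Types.
Variables (R : realType) (n : nat) (X : complex_manifold R n).

Definition holo_type (b : bool) := if b then Holo else Anti.

(** The number of holomorphic arguments selects the type of the only component
    of [H] that contributes; [false] stands for the antiholomorphic type. *)
Lemma form_type_component (H H30 H21 H12 H03 : form3 X) (b1 b2 b3 : bool)
  (t30 : is_form_type 3 H30) (t21 : is_form_type 2 H21)
  (t12 : is_form_type 1 H12) (t03 : is_form_type 0 H03)
  (f30 : is_form3 H30) (f21 : is_form3 H21) (f12 : is_form3 H12) (f03 : is_form3 H03)
  (Hsum : forall p u v w,
     H p u v w = H30 p u v w + H21 p u v w + H12 p u v w + H03 p u v w) :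
  form_component (holo_type b1) (holo_type b2) (holo_type b3) H
    (nth H03 [:: H03; H12; H21; H30] (b1 + b2 + b3)).
Proof.
have zero (a : nat) (h : form3 X) (p : X) c1 c2 c3 u v w : is_form_type a h ->
    afib (holo_type c1) u -> afib (holo_type c2) v -> afib (holo_type c3) w ->
    (c1 + c2 + c3 != a)%N -> h p u v w = 0.
  by move=> th A1 A2 A3 /eqP ne; exact: (th p c1 c2 c3).
split=> [p u v w A1 A2 A3|p u v w A1 A2].
  rewrite Hsum.
  have z30 := zero _ _ p _ _ _ _ _ _ t30 A1 A2 A3.
  have z21 := zero _ _ p _ _ _ _ _ _ t21 A1 A2 A3.
  have z12 := zero _ _ p _ _ _ _ _ _ t12 A1 A2 A3.
  have z03 := zero _ _ p _ _ _ _ _ _ t03 A1 A2 A3.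
  case: b1 b2 b3 z30 z21 z12 z03 {A1 A2 A3} => -[] -[] /= z30 z21 z12 z03;
    by rewrite ?(z30 isT) ?(z21 isT) ?(z12 isT) ?(z03 isT) ?addr0 ?add0r.
have w3 : afib (holo_type (~~ b3)) (apr (holo_type (~~ b3)) w) by exact: afib_apr.
have sumw : apr (holo_type b3) w + apr (holo_type (~~ b3)) w = w.
  have := @apr_sum R n (holo_type b3) w; case: (b3) => /=; exact.
set h := nth _ _ _.
have fh : is_form3 h by rewrite /h; case: (b1) (b2) (b3) => -[] -[].
rewrite -[in RHS]sumw (form3_D3 fh) [X in _ = _ + X](_ : _ = 0) ?addr0//.
rewrite /h; case: b1 b2 b3 A1 A2 w3 {sumw h fh} => -[] -[] A1 A2 w3 /=.
all: first [exact: zero _ _ p _ _ _ _ _ _ t30 A1 A2 w3 isT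
  | exact: zero _ _ p _ _ _ _ _ _ t21 A1 A2 w3 isT
  | exact: zero _ _ p _ _ _ _ _ _ t12 A1 A2 w3 isT
  | exact: zero _ _ p _ _ _ _ _ _ t03 A1 A2 w3 isT].
Qed.

End Types.

Theorem proposition4p11 (R : realType) (n : nat) (X : complex_manifold R n)
  (H H30 H21 H12 H03 : form3 X)
  (hH : is_form3 H)
  (h30 : is_form3 H30) (t30 : is_form_type 3 H30)
  (h21 : is_form3 H21) (t21 : is_form_type 2 H21)
  (h12 : is_form3 H12) (t12 : is_form_type 1 H12)
  (h03 : is_form3 H03) (t03 : is_form_type 0 H03)
  (Hsum : forall p u v w,
     H p u v w = H30 p u v w + H21 p u v w + H12 p u v w + H03 p u v w)
  (Hclosed : forall p u v w x, d3 H p u v w x = 0) :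
  let E1 := twisted Holo H30 in
  let E2 := twisted Anti H03 in
  let fwd : conn E1 E2 := nabla Holo Anti H12 in
  let bwd : conn E2 E1 := nabla Anti Holo H21 in
  exists (Om : (X -> vb_amb E1) -> (X -> vb_amb E1) -> (X -> vb_amb E2))
         (Mho : (X -> vb_amb E2) -> (X -> vb_amb E2) -> (X -> vb_amb E1)),
    matched_pair fwd bwd Om Mho /\
    courant_isomorphic (matched_sum fwd bwd Om Mho) (twisted Full H).
Proof.
move=> E1 E2 fwd bwd.
have comp b1 b2 b3 :=
  form_type_component b1 b2 b3 t30 t21 t12 t03 h30 h21 h12 h03 Hsum.
have AB : opposite Holo Anti by [].
exists (skew_part H Anti), (skew_part H Holo); split.
  exact: (opposite_matched_pair hH Hclosed AB h30 h03 h12 h21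
    (comp true true true) (comp false false false)
    (comp true false false) (comp false true true)).
split.
- exact: (matched_sum_courant hH Hclosed AB h30 h03
    (comp true true true) (comp false false false)
    (comp true false false) (comp false true true)).
- exact: full_courant.
- exists (@sum_map R n X H Holo Anti H30 H03 H12 H21).
  exact: (sum_map_iso hH Hclosed AB h30 h03
    (comp true true true) (comp false false false)
    (comp true false false) (comp false true true)).
Qed.
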